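(* Let $\eta>0$, $t>0$, let $\alpha,\theta$ be real with $0<\alpha\le2$ and $|\theta|\le\min(\alpha,2-\alpha)$, let $0<\mu<1$, $0\le\nu\le1$, and put $\rho=\frac{\alpha-\theta}{2\alpha}$. For $x\in\mathbb{R}\setminus\{0\}$ let $$N(x,t)=\frac{t^{\mu+\nu(1-\mu)-1}}{\alpha|x|}\,H_{3,3}^{2,1}\left[\frac{|x|}{\eta^{1/\alpha}t^{\mu/\alpha}}\,\middle|\,\begin{matrix}(1,\frac1\alpha),\ (\mu+\nu(1-\mu),\frac{\mu}{\alpha}),\ (1,\rho)\\ (1,\frac1\alpha),\ (1,1),\ (1,\rho)\end{matrix}\right].$$ Then for every $\delta$ with $-\min\{\alpha,1\}<\Re(\delta)<0$ the fractional order moment $\langle|x(t)|^\delta\rangle=\int_{-\infty}^{\infty}|x|^\delta N(x,t)\,dx$ is given by $$\langle|x(t)|^{\delta}\rangle=\frac{2}{\alpha}\,\eta^{\delta/\alpha}\,t^{\mu+\nu(1-\mu)+\mu\delta/\alpha-1}\,\frac{\Gamma(-\frac{\delta}{\alpha})\,\Gamma(1+\delta)\,\Gamma(1+\frac{\delta}{\alpha})}{\Gamma(-\rho\delta)\,\Gamma\big(\mu+\nu(1-\mu)+\frac{\mu\delta}{\alpha}\big)\,\Gamma(1+\rho\delta)}.$$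
   Context: Fox H-function: $H^{m,n}_{p,q}\left[z\,\middle|\,\begin{matrix}(a_1,A_1),\dots,(a_p,A_p)\\(b_1,B_1),\dots,(b_q,B_q)\end{matrix}\right]=\frac{1}{2\pi i}\int_L\frac{\prod_{j=1}^m\Gamma(b_j+B_js)\prod_{j=1}^n\Gamma(1-a_j-A_js)}{\prod_{j=m+1}^q\Gamma(1-b_j-B_js)\prod_{j=n+1}^p\Gamma(a_j+A_js)}z^{-s}\,ds$, where $L$ is a Mellin-Barnes contour separating the poles of the $\Gamma(b_j+B_js)$, $j\le m$, from those of the $\Gamma(1-a_j-A_js)$, $j\le n$. Throughout, $1/\Gamma$ is taken to be $0$ at the poles of $\Gamma$. *)

(* Defs.v *)
From HB Require Import structures.
From mathcomp Require Import all_boot all_order all_algebra.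
From mathcomp Require Import complex.
From mathcomp Require Import all_classical all_reals all_analysis.

Set Implicit Arguments.
Unset Strict Implicit.
Unset Printing Implicit Defensive.

Import Order.TTheory GRing.Theory Num.Theory.
Import numFieldNormedType.Exports.

Local Open Scope classical_set_scope.
Local Open Scope ring_scope.
Local Open Scope complex_scope.

Local Notation Re := complex.Re.
Local Notation Im := complex.Im.

Section ComplexFunctions.
Context {R : realType}.
Implicit Types (x : R) (z w : R[i]).

Definition cexp z : R[i] :=
  (expR (Re z) * cos (Im z)) +i* (expR (Re z) * sin (Im z)).

(* Meaningful for [0 < x] only. *)
Definition cpow x w : R[i] := cexp (w * (ln x)%:C).

(* Euler's limit n! n^z / (z (z+1) ... (z+n)).  At a pole [z = - k] every term
   with [k <= n] is a division by [0], hence [0] in a field of MathComp; so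
   [Gamma z = 0] and [(Gamma z)^-1 = 0] there, which is the convention that
   1/Gamma vanishes at the poles of Gamma. *)
Definition Gamma z : R[i] :=
  lim (((n`!)%:R * cpow n%:R z / \prod_(k < n.+1) (z + k%:R) : R[i]^o)
        @[n --> \oo]).

Definition Gamma_pole z : Prop := exists k : nat, z = - k%:R.

Definition cintegrable (f : R -> R[i]) : Prop :=
  (@lebesgue_measure R).-integrable setT (fun y => (Re (f y))%:E) /\
  (@lebesgue_measure R).-integrable setT (fun y => (Im (f y))%:E).

Definition cintegral (f : R -> R[i]) : R[i] :=
  (\int[@lebesgue_measure R]_y Re (f y)) +i*
  (\int[@lebesgue_measure R]_y Im (f y)).

End ComplexFunctions.

Section FoxH.
Context {R : realType}.
(* [a] lists the pairs (a_j, A_j) and [b] the pairs (b_j, B_j), so that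
   p = size a and q = size b; m and n split [b] and [a] respectively. *)
Variables (m n : nat) (a b : seq (R[i] * R)).
Implicit Types (sigma : R -> R) (s : R[i]) (y z : R).

Definition foxH_kernel s : R[i] :=
  (\prod_(u <- take m b) Gamma (u.1 + u.2%:C * s) *
   \prod_(u <- take n a) Gamma (1 - u.1 - u.2%:C * s)) /
  (\prod_(u <- drop m b) Gamma (1 - u.1 - u.2%:C * s) *
   \prod_(u <- drop n a) Gamma (u.1 + u.2%:C * s)).

(* The contour is the path [y |-> sigma y + i y], from c - i oo to c + i oo:
   a vertical line with finite smooth indentations.  A point [s] is on its left
   iff [Re s < sigma (Im s)]. *)
Definition mellin_barnes_contour sigma : Prop :=
  [/\ forall y, derivable sigma y 1,
      continuous (derive1 sigma),
      exists c M : R, forall y, M <= `|y| -> sigma y = c,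
      forall u s, u \in take m b -> Gamma_pole (u.1 + u.2%:C * s) ->
        Re s < sigma (Im s)
    & forall u s, u \in take n a -> Gamma_pole (1 - u.1 - u.2%:C * s) ->
        sigma (Im s) < Re s].

Definition contour_integral sigma (f : R[i] -> R[i]) : R[i] :=
  cintegral (fun y => f (sigma y +i* y) * (derive1 sigma y +i* 1)).

(* The function H^{m,n}_{p,q}[z | a ; b] for [0 < z], computed along the
   contour given by [sigma]. *)
Definition foxH sigma z : R[i] :=
  (2 * pi%:C * (0 +i* 1))^-1 *
  contour_integral sigma (fun s => foxH_kernel s * cpow z (- s)).

End FoxH.

(* Main.v *)
Require Import Defs.
From mathcomp Require Import all_boot all_order all_algebra.
From mathcomp Require Import complex.
From mathcomp Require Import all_classical all_reals all_analysis.
From mathcomp Require Import measurable_realfun.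
From mathcomp Require Import ring lra.

Set Implicit Arguments.
Unset Strict Implicit.
Unset Printing Implicit Defensive.

Import Order.TTheory GRing.Theory Num.Theory.
Import numFieldNormedType.Exports.
Import Normc.

Local Open Scope classical_set_scope.
Local Open Scope ring_scope.
Local Open Scope complex_scope.

Local Notation Re := complex.Re.
Local Notation Im := complex.Im.

(** The integrand is even, so the moment is twice a Mellin transform over the
    positive half-line, and the H-function is an inverse Mellin transform, that
    of its kernel
      K(s) = Gamma(1 + s/alpha) Gamma(1 + s) Gamma(- s/alpha)
             / (Gamma(- rho s) Gamma(gam + mu s/alpha) Gamma(1 + rho s)).
    With [lam = eta^(1/alpha) t^(mu/alpha)] the theorem is therefore an instance
    of Mellin inversion: the integral of [x^(delta - 1) H(x / lam)] over the
    positive reals is [lam^delta K(delta)].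

    The poles of the three Gamma functions in the numerator are real: those at
    [- k] and [- alpha k] with [k >= 1] lie to the left of the contour, those at
    [alpha k] with [k >= 0] to its right.  Hence the contour may be replaced by
    any line [Re s = c] with [- min(alpha, 1) < c < 0] ([fox_contour_line]).  For
    [x <= lam] use a line to the left of [delta], for [x > lam] a line to its
    right.  The integral of [x^(delta - s - 1)] over each piece then converges
    and is [lam^(delta - s) / (delta - s)] up to sign, so that, by Fubini
    ([mellin_barnes_piece]), the Mellin transform becomes [lam^delta] times the
    difference of the integrals of [K(s) / (s - delta)] along the two lines.
    Cauchy's formula on the strip between them ([kern_cauchy]) evaluates this
    difference to [2 i pi K(delta)].

    All the exchanges of limits rest on the exponential decay of [K] on vertical
    strips ([kern_decay]): on vertical lines [Gamma] behaves like
    [exp (- pi |y| / 2)], up to [exp (eps |y|)], and [1 / Gamma] like its inverse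
    ([Gamma_decay], [GammaV_growth]), so that the rate of decay of [K] is [pi / 2]
    times [(2 + theta - mu) / alpha], which is positive since
    [|theta| <= min (alpha, 2 - alpha) <= 1 < 2 - mu].

    Euler's limit is the only description of [Gamma] used.  The quotient of two
    consecutive terms of Euler's sequence [e_n] is [1 + O(1/n^2)], locally
    uniformly, so [e_n] and [1 / e_n] converge, also at the poles
    ([eulerG_cvg], [eulerGV_cvg]), and all late terms are dominated by any fixed
    one ([eulerG_le], [eulerGV_le]).  The modulus of [e_n] on a vertical line is
    compared with the partial products of [sinh (pi y) / (pi y)], and these with
    exponentials through a primitive of [ln (1 + y^2 / u^2)] ([atanPhi]).
    Cauchy's theorem ([cauchy_sweep]) and formula ([cauchy_rect]) are applied to
    the kernels built from [e_n], which are products of elementary functions, and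
    pass to the limit by dominated convergence ([kern_seg_limit]). *)

(** * Complex numbers and componentwise limits *)

Section ComplexToolkit.
Context {R : realType}.
Local Notation C := R[i].
Implicit Types (x y : R) (z w : C).

Lemma ReD z w : Re (z + w) = Re z + Re w. Proof. by case: z w => [? ?] []. Qed.
Lemma ImD z w : Im (z + w) = Im z + Im w. Proof. by case: z w => [? ?] []. Qed.
Lemma ReN z : Re (- z) = - Re z. Proof. by case: z. Qed.
Lemma ImN z : Im (- z) = - Im z. Proof. by case: z. Qed.
Lemma ReM z w : Re (z * w) = Re z * Re w - Im z * Im w.
Proof. by case: z w => [? ?] []. Qed.
Lemma ImM z w : Im (z * w) = Re z * Im w + Im z * Re w.
Proof. by case: z w => [? ?] []. Qed.
Lemma Re1 : Re (1 : C) = 1. Proof. by []. Qed.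
Lemma Im1 : Im (1 : C) = 0. Proof. by []. Qed.
Lemma Re0 : Re (0 : C) = 0. Proof. by []. Qed.
Lemma Im0 : Im (0 : C) = 0. Proof. by []. Qed.
Lemma Re_nat n : Re (n%:R : C) = n%:R.
Proof. by elim: n => // n IH; rewrite -addn1 !natrD ReD IH. Qed.
Lemma Im_nat n : Im (n%:R : C) = 0.
Proof. by elim: n => // n IH; rewrite -addn1 !natrD ImD IH addr0. Qed.
Lemma ReV z : Re z^-1 = Re z / (Re z ^+ 2 + Im z ^+ 2).
Proof. by case: z. Qed.
Lemma ImV z : Im z^-1 = - Im z / (Re z ^+ 2 + Im z ^+ 2).
Proof. by case: z => a b; rewrite mulNr. Qed.

Definition reimE := (ReD, ImD, ReN, ImN, ReM, ImM, Re1, Im1, Re0, Im0, Re_nat, Im_nat).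

Lemma complex_ext z w : Re z = Re w -> Im z = Im w -> z = w.
Proof. by case: z w => [? ?] [? ?] /= -> ->. Qed.

Lemma natrC n : (n%:R : C) = (n%:R : R)%:C.
Proof. by apply: complex_ext; rewrite ?Re_nat ?Im_nat. Qed.

Lemma normcE2 z : normc z = Num.sqrt (Re z ^+ 2 + Im z ^+ 2).
Proof. by case: z. Qed.
Lemma normc_ge0 z : 0 <= normc z.
Proof. by rewrite normcE2 sqrtr_ge0. Qed.
Lemma sqr_normcE z : normc z ^+ 2 = Re z ^+ 2 + Im z ^+ 2.
Proof. by rewrite normcE2 sqr_sqrtr// addr_ge0 ?sqr_ge0. Qed.
Lemma normc_eq0 z : (normc z == 0) = (z == 0).
Proof. by apply/eqP/eqP => [/eq0_normc//|->]; rewrite normc0. Qed.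
Lemma normc_gt0 z : (0 < normc z) = (z != 0).
Proof. by rewrite lt_def normc_ge0 andbT normc_eq0. Qed.
Lemma ler_Re z : `|Re z| <= normc z.
Proof. by rewrite normcE2 -sqrtr_sqr ler_wsqrtr// lerDl sqr_ge0. Qed.
Lemma ler_Im z : `|Im z| <= normc z.
Proof. by rewrite normcE2 -sqrtr_sqr ler_wsqrtr// lerDr sqr_ge0. Qed.
Lemma normc_real x : normc x%:C = `|x|.
Proof. by rewrite normcE2/= expr0n/= addr0 sqrtr_sqr. Qed.
Lemma normc_nat n : normc (n%:R : C) = n%:R.
Proof. by rewrite natrC normc_real ger0_norm. Qed.
Lemma normc_le_ReIm z : normc z <= `|Re z| + `|Im z|.
Proof.
rewrite normcE2 -[leRHS]ger0_norm ?addr_ge0// -sqrtr_sqr ler_wsqrtr//.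
rewrite sqrrD !real_normK ?num_real// lerD2r lerDl.
by rewrite mulrn_wge0// mulr_ge0.
Qed.
Lemma normcB z w : normc (z - w) = normc (w - z).
Proof. by rewrite -normcN opprB. Qed.
Lemma ler_normcB z w : normc z - normc w <= normc (z - w).
Proof. by rewrite lerBlDr (le_trans _ (le_normcD _ _))// subrK. Qed.
Lemma normc_prod I (r : seq I) (P : pred I) (f : I -> C) :
  normc (\prod_(i <- r | P i) f i) = \prod_(i <- r | P i) normc (f i).
Proof. exact: (@big_morph _ _ (@normc R) 1 *%R 1 *%R (@normcM R) (normc1 R)). Qed.

(** Convergence is tested on real and imaginary parts, to which the limit
    theorems of real analysis apply. *)
Definition ccvg (T : Type) (F : set_system T) (u : T -> C) (l : C) : Prop :=
  (Re (u t) @[t --> F] --> Re l) /\ (Im (u t) @[t --> F] --> Im l).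

Section Ccvg.
Context {T : Type} {F : set_system T} {FF : Filter F}.
Implicit Types (u v : T -> C) (l m : C).

Lemma ccvg_cst l : ccvg F (fun=> l) l.
Proof. by split; exact: cvg_cst. Qed.

Lemma ccvg_real (r : T -> R) x : r t @[t --> F] --> x -> ccvg F (fun t => (r t)%:C) x%:C.
Proof. by move=> h; split=> //=; exact: cvg_cst. Qed.

Lemma ccvg_reim (r s : T -> R) x y : r t @[t --> F] --> x -> s t @[t --> F] --> y ->
  ccvg F (fun t => r t +i* s t) (x +i* y).
Proof. by move=> h; split. Qed.

Lemma ccvgD u v l m : ccvg F u l -> ccvg F v m -> ccvg F (fun t => u t + v t) (l + m).
Proof.
move=> [u1 u2] [v1 v2]; split.
- by rewrite ReD; under eq_fun do rewrite ReD; exact: cvgD.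
- by rewrite ImD; under eq_fun do rewrite ImD; exact: cvgD.
Qed.

Lemma ccvgN u l : ccvg F u l -> ccvg F (fun t => - u t) (- l).
Proof.
move=> [u1 u2]; split.
- by rewrite ReN; under eq_fun do rewrite ReN; exact: cvgN.
- by rewrite ImN; under eq_fun do rewrite ImN; exact: cvgN.
Qed.

Lemma ccvgB u v l m : ccvg F u l -> ccvg F v m -> ccvg F (fun t => u t - v t) (l - m).
Proof. by move=> ul vm; apply: ccvgD => //; exact: ccvgN. Qed.

Lemma ccvgM u v l m : ccvg F u l -> ccvg F v m -> ccvg F (fun t => u t * v t) (l * m).
Proof.
move=> [u1 u2] [v1 v2]; split.
- by rewrite ReM; under eq_fun do rewrite ReM; apply: cvgB; exact: cvgM.
- by rewrite ImM; under eq_fun do rewrite ImM; apply: cvgD; exact: cvgM.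
Qed.

Lemma ccvgV u l : l != 0 -> ccvg F u l -> ccvg F (fun t => (u t)^-1) l^-1.
Proof.
move=> l0 [u1 u2].
have n0 : Re l ^+ 2 + Im l ^+ 2 != 0.
  by rewrite -sqr_normcE expf_eq0/= normc_eq0.
have h : (Re (u t) ^+ 2 + Im (u t) ^+ 2)^-1 @[t --> F] -->
         (Re l ^+ 2 + Im l ^+ 2)^-1.
  by apply: cvgV => //; apply: cvgD; rewrite expr2; exact: cvgM.
split.
- by rewrite ReV; under eq_fun do rewrite ReV; exact: cvgM.
- rewrite ImV; under eq_fun do rewrite ImV.
  by apply: cvgM => //; exact: cvgN.
Qed.

Lemma ccvg_near u v l : (\forall t \near F, u t = v t) -> ccvg F u l -> ccvg F v l.
Proof.
move=> uv [u1 u2]; split.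
- apply: cvg_trans u1; apply: near_eq_cvg.
  by near=> t; congr Re; near: t.
- apply: cvg_trans u2; apply: near_eq_cvg.
  by near=> t; congr Im; near: t.
Unshelve. all: by end_near. Qed.

Lemma ccvg_normc u l : ccvg F u l -> normc (u t) @[t --> F] --> normc l.
Proof.
move=> [u1 u2]; rewrite normcE2; under eq_fun do rewrite normcE2.
have h : Re (u t) ^+ 2 + Im (u t) ^+ 2 @[t --> F] --> Re l ^+ 2 + Im l ^+ 2.
  by apply: cvgD; rewrite expr2; exact: cvgM.
by apply: cvg_comp h _; exact: sqrt_continuous.
Qed.

Lemma ccvg_of_normc u l (g : T -> R) : (\forall t \near F, normc (u t - l) <= g t) ->
  g t @[t --> F] --> (0 : R) -> ccvg F u l.
Proof.
move=> ug g0.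
have h e : 0 < e -> \forall t \near F, normc (u t - l) <= e.
  move=> e0; have he : \forall t \near F, `|g t| <= e by exact: cvgr0_norm_le.
  apply: filterS2 ug he => t h1 h2.
  by rewrite (le_trans h1)// (le_trans (ler_norm _)).
split; apply/cvgrPdist_le => e /h; apply: filterS => t; apply: le_trans.
- by rewrite distrC -ReN -ReD ler_Re.
- by rewrite distrC -ImN -ImD ler_Im.
Qed.

Lemma ccvg_near_neq0 u l : l != 0 -> ccvg F u l -> \forall t \near F, u t != 0.
Proof.
move=> l0 /ccvg_normc ul.
have : \forall t \near F, 0 < normc (u t) by apply: (cvgr_gt _ ul); rewrite normc_gt0.
by apply: filterS => t; rewrite normc_gt0.
Qed.

End Ccvg.

Lemma ccvg_unique T (F : set_system T) {FF : ProperFilter F} u (l m : C) :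
  ccvg F u l -> ccvg F u m -> l = m.
Proof.
move=> [u1 u2] [v1 v2]; apply: complex_ext.
- exact: (cvg_unique _ u1 v1).
- exact: (cvg_unique _ u2 v2).
Qed.

(** The topology of [C], through which Gamma is defined, enters only here. *)
Lemma ccvg_lim (u : nat -> C) (l : C) :
  ccvg \oo u l -> lim ((u n : C^o) @[n --> \oo]) = l.
Proof.
move=> ul; apply: cvg_lim => //.
apply/cvgrPdist_le => e; rewrite ltcE => /andP[/eqP/= ime ree].
have ul0 : normc (l - u n) @[n --> \oo] --> (0 : R).
  rewrite -(normc0 R) -(subrr l); apply: ccvg_normc.
  by apply: ccvgB ul; exact: ccvg_cst.
have he : \forall n \near \oo, `|normc (l - u n)| <= Re e by exact: cvgr0_norm_le.
apply: filterS he => n.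
rewrite ger0_norm ?normc_ge0// => h.
by rewrite normc_def -normcE2 lecE/= ime eqxx.
Qed.

Lemma Re_cexp z : Re (cexp z) = expR (Re z) * cos (Im z). Proof. by []. Qed.
Lemma Im_cexp z : Im (cexp z) = expR (Re z) * sin (Im z). Proof. by []. Qed.

Lemma cexp0 : cexp (0 : C) = 1.
Proof. by apply: complex_ext => /=; rewrite expR0 ?cos0 ?sin0 ?mulr1 ?mulr0. Qed.
Lemma cexpD z w : cexp (z + w) = cexp z * cexp w.
Proof.
apply: complex_ext; rewrite ?ReM ?ImM !(Re_cexp, Im_cexp) ReD ImD expRD.
- by rewrite cosD; ring.
- by rewrite sinD; ring.
Qed.
Lemma normc_cexp z : normc (cexp z) = expR (Re z).
Proof.
rewrite normcE2 Re_cexp Im_cexp !exprMn -mulrDr cos2Dsin2 mulr1 sqrtr_sqr.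
by rewrite ger0_norm// expR_ge0.
Qed.
Lemma cexp_neq0 z : cexp z != 0.
Proof. by rewrite -normc_eq0 normc_cexp gt_eqF// expR_gt0. Qed.
Lemma cexpN z : cexp (- z) = (cexp z)^-1.
Proof.
apply: (mulfI (cexp_neq0 z)); rewrite -cexpD subrr cexp0 divff//.
exact: cexp_neq0.
Qed.
Lemma cexp_real x : cexp x%:C = (expR x)%:C.
Proof. by apply: complex_ext => /=; rewrite ?cos0 ?sin0 ?mulr1 ?mulr0. Qed.

Lemma ccvg_cexp T (F : set_system T) {FF : Filter F} u l :
  ccvg F u l -> ccvg F (fun t => cexp (u t)) (cexp l).
Proof.
move=> [u1 u2]; split.
- rewrite Re_cexp; apply: cvgM.
  + by apply: cvg_comp u1 _; exact: continuous_expR.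
  + by apply: cvg_comp u2 _; exact: continuous_cos.
- rewrite Im_cexp; apply: cvgM.
  + by apply: cvg_comp u1 _; exact: continuous_expR.
  + by apply: cvg_comp u2 _; exact: continuous_sin.
Qed.

Lemma normc_cpow x w : normc (cpow x w) = expR (Re w * ln x).
Proof. by rewrite /cpow normc_cexp ReM/= mulr0 subr0. Qed.
Lemma cpowD x z w : cpow x (z + w) = cpow x z * cpow x w.
Proof. by rewrite /cpow mulrDl cexpD. Qed.
Lemma cpowN x z : cpow x (- z) = (cpow x z)^-1.
Proof. by rewrite /cpow mulNr cexpN. Qed.
Lemma cpow_neq0 x z : cpow x z != 0. Proof. exact: cexp_neq0. Qed.
Lemma cpow1 x : 0 < x -> cpow x 1 = x%:C.
Proof. by move=> x0; rewrite /cpow mul1r cexp_real lnK. Qed.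

End ComplexToolkit.

(** * Euler's sequence for the Gamma function *)

Section EulerSequence.
Context {R : realType}.
Local Notation C := R[i].
Implicit Types (x y : R) (z w : C).

Lemma MVT_le (f df : R -> R) (M a b : R) :
  (forall x, is_derive x (1:R) f (df x)) ->
  (forall x, `|x - a| <= `|b - a| -> `|df x| <= M) ->
  `|f b - f a| <= M * `|b - a|.
Proof.
move=> fd dfM.
have cf u v : {within `[u, v], continuous f}.
  apply: continuous_subspaceT => x; apply: differentiable_continuous.
  by apply/derivable1_diffP; have [] := fd x.
have [ab|ba|->] := ltgtP a b; last by rewrite !subrr normr0 mulr0.
- have [c cab ->] := MVT ab (fun x _ => fd x) (cf a b).
  rewrite normrM ler_wpM2r// dfM//.
  by move: cab; rewrite in_itv/= => /andP[? ?]; rewrite !gtr0_norm ?subr_gt0//; lra.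
- have [c cab e] := MVT ba (fun x _ => fd x) (cf b a).
  rewrite distrC e normrM (distrC b) ler_wpM2r// dfM//.
  by move: cab; rewrite in_itv/= => /andP[? ?]; rewrite !ltr0_norm ?subr_lt0//; lra.
Qed.

Lemma sin_le_norm y : `|sin y| <= `|y|.
Proof.
have := @MVT_le sin cos 1 0 y (@is_derive_sin R) (fun x _ => cos_max x).
by rewrite sin0 !subr0 mul1r.
Qed.

Lemma cos_ge y : 1 - cos y <= y ^+ 2 / 2.
Proof.
have -> : y = (y / 2) *+ 2 by rewrite mulr2n; lra.
rewrite cos_mulr2n cos2sin2.
have h : sin (y / 2) ^+ 2 <= (y / 2) ^+ 2.
  by rewrite -[leLHS]real_normK ?num_real// -[leRHS]real_normK ?num_real// lerXn2r ?nnegrE// sin_le_norm.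
by rewrite mulr2n; nra.
Qed.

Lemma sin_sub_le y : `|y| <= 1 -> `|sin y - y| <= y ^+ 2.
Proof.
move=> y1.
have d x : is_derive x (1:R) (fun t => sin t - t) (cos x - 1).
  by apply: is_deriveB.
have /= := @MVT_le _ _ `|y| 0 y d.
rewrite sin0 !subr0 -expr2 real_normK ?num_real//; apply=> x.
rewrite subr0 => xy; rewrite distrC ger0_norm ?subr_ge0 ?cos_le1//.
apply: (le_trans (cos_ge x)).
rewrite -[x ^+ 2]real_normK ?num_real//.
have := normr_ge0 x; nra.
Qed.

Lemma expR_quad x : `|x| <= 2^-1 -> 0 <= expR x - 1 - x <= 2 * x ^+ 2.
Proof.
move=> x2.
have [h1 h2] : - 2^-1 <= x /\ x <= 2^-1 by apply/andP; rewrite -ler_norml.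
have e1 := expR_ge1Dx x.
have e2 := expR_ge1Dx (- x); rewrite expRN in e2.
have e0 := expR_gt0 x.
have e3 : expR x * (1 - x) <= 1.
  by rewrite -[leRHS](divff (lt0r_neq0 e0)) ler_wpM2l// ltW.
apply/andP; split; first lra.
have x1 : 0 < 1 - x by lra.
rewrite -(ler_pM2r x1).
have : 0 <= x ^+ 2 * (1 - 2 * x) by rewrite mulr_ge0 ?sqr_ge0//; lra.
rewrite expr2; nra.
Qed.

(** The quadratic error makes the factors of Euler's sequence [1 + O(1/n^2)]. *)
Lemma cexp_quad z : normc z <= 2^-1 -> normc (cexp z - 1 - z) <= 9 * normc z ^+ 2.
Proof.
case: z => x y zz; set r := normc _ in zz *.
have xr : `|x| <= r by have := ler_Re (x +i* y).
have yr : `|y| <= r by have := ler_Im (x +i* y).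
have r0 : 0 <= r by exact: normc_ge0.
have [h1 h2] : - r <= x /\ x <= r by apply/andP; rewrite -ler_norml.
have x2 : x ^+ 2 <= r ^+ 2 by rewrite -[leLHS]real_normK ?num_real// lerXn2r ?nnegrE.
have y2 : y ^+ 2 <= r ^+ 2 by rewrite -[leLHS]real_normK ?num_real// lerXn2r ?nnegrE.
have /andP[e1 e2] := expR_quad (le_trans xr zz).
have c1 := cos_ge y; have c2 := cos_le1 y; have c3 := cos_max y.
have s1 : `|sin y - y| <= y ^+ 2 by apply: sin_sub_le; lra.
have s2 := le_trans (sin_le_norm y) yr.
apply: (le_trans (normc_le_ReIm _)).
have -> : Re (cexp (x +i* y) - 1 - (x +i* y)) =
    (expR x - 1 - x) * cos y - (1 + x) * (1 - cos y) by rewrite !reimE/=; ring.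
have -> : Im (cexp (x +i* y) - 1 - (x +i* y)) =
    (expR x - 1) * sin y + (sin y - y) by rewrite !reimE/=; ring.
have k1 : `|(expR x - 1 - x) * cos y - (1 + x) * (1 - cos y)| <= 2 * r ^+ 2 + 2 * r ^+ 2.
  apply: (le_trans (ler_normB _ _)); apply: lerD.
  - rewrite normrM -[leRHS]mulr1 ler_pM// ger0_norm//.
    by apply: (le_trans e2); rewrite ler_pM2l.
  - rewrite normrM; have -> : `|1 - cos y| = 1 - cos y by rewrite ger0_norm// subr_ge0.
    rewrite ger0_norm; last lra.
    by apply: ler_pM; lra.
have k2 : `|(expR x - 1) * sin y + (sin y - y)| <= 4 * r ^+ 2 + r ^+ 2.
  apply: (le_trans (ler_normD _ _)); apply: lerD; last exact: le_trans s1 y2.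
  rewrite normrM; apply: (@le_trans _ _ ((4 * r) * r)); last by rewrite -mulrA -expr2.
  apply: ler_pM => //; rewrite ler_norml; apply/andP; split.
    by nra.
  have : r ^+ 2 <= r by rewrite expr2 ler_piMr//; lra.
  lra.
lra.
Qed.

(** A summable scale, of the order of [1/n^2], whose sums telescope. *)
Definition gap n : R := n%:R^-1 - n.+1%:R^-1.

Lemma gapE n : (0 < n)%N -> gap n = (n%:R * n.+1%:R)^-1.
Proof.
move=> n0; rewrite /gap -[n.+1]addn1 natrD.
have : 0 < n%:R :> R by rewrite ltr0n.
by move=> h; field; rewrite !gt_eqF//; lra.
Qed.
Lemma gap_ge0 n : (0 < n)%N -> 0 <= gap n.
Proof. by move=> n0; rewrite gapE// invr_ge0 mulr_ge0. Qed.
Lemma gap_le n : gap n <= n%:R^-1.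
Proof. by rewrite /gap lerBlDr lerDl. Qed.

(** Subtracting [D / n] makes the sequence increasing, adding it makes it
    decreasing. *)
Lemma cvgn_of_gap (r : nat -> R) (D : R) N : 0 <= D -> (0 < N)%N ->
  (forall n, (N <= n)%N -> `|r n.+1 - r n| <= D * gap n) -> cvgn r.
Proof.
move=> D0 N0 rD.
pose v n := r (n + N)%N - D * (n + N)%:R^-1.
pose w n := r (n + N)%N + D * (n + N)%:R^-1.
have step n : v n <= v n.+1 /\ w n.+1 <= w n.
  have := rD (n + N)%N (leq_addl _ _).
  rewrite /v /w addSn /gap mulrBr ler_norml.
  by move: ((n + N).+1%:R^-1) => c /andP[? ?]; split; lra.
have vinc : {homo v : n m / (n <= m)%N >-> n <= m}.
  by apply: homo_leq => //; [exact: le_trans|move=> n; have [] := step n].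
have vub n : v n <= w 0%N.
  have wdec : w n <= w 0%N.
    by elim: n => // n IH; apply: le_trans IH; have [] := step n.
  apply: le_trans wdec; rewrite /v /w.
  have : 0 <= D * (n + N)%:R^-1 by rewrite mulr_ge0 ?invr_ge0.
  lra.
have /cvg_ex[/= l vl] : cvgn v.
  by apply: nondecreasing_is_cvgn => //; exists (w 0%N) => _ [n _ <-].
apply/cvg_ex; exists l; rewrite -(cvg_shiftn N).
have -> : (fun n => r (n + N)%N) = (fun n => v n + D * (n + N)%:R^-1).
  by apply/funext => n; rewrite /v subrK.
rewrite -[l]addr0; apply: cvgD => //; rewrite -(mulr0 D); apply: cvgMr.
rewrite (cvg_shiftn N (fun n => n%:R^-1 : R)).
by apply/gtr0_cvgV0; [near=> n; rewrite ltr0n; near: n; exact: nbhs_infty_gt|exact: cvgr_idn].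
Unshelve. all: by end_near. Qed.

Section MultSeq.
Variables (u a : nat -> C) (D : R) (N : nat).
Hypotheses (D0 : 0 <= D) (N0 : (0 < N)%N).
Hypothesis uS : forall n, (N <= n)%N -> u n.+1 = u n * (1 + a n).
Hypothesis aD : forall n, (N <= n)%N -> normc (a n) <= D * gap n.

(** The product of the [1 + D gap k] is at most the exponential of a
    telescoping sum. *)
Lemma mult_seq_le n : (N <= n)%N -> normc (u n) <= expR D * normc (u N).
Proof.
move=> Nn.
suff h m : normc (u (m + N)%N) <= normc (u N) * expR (D * (N%:R^-1 - (m + N)%:R^-1)).
  rewrite -(subnK Nn) mulrC (le_trans (h _))// ler_wpM2l ?normc_ge0// ler_expR.
  rewrite -[leRHS]mulr1 ler_wpM2l// lerBlDr.
  apply: (@le_trans _ _ 1); last by rewrite lerDl invr_ge0.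
  by rewrite invf_le1 ?ler1n// ltr0n.
elim: m => [|m IH]; first by rewrite add0n subrr mulr0 expR0 mulr1.
rewrite addSn uS ?leq_addl// normcM.
have -> : D * (N%:R^-1 - (m + N).+1%:R^-1) =
   D * (N%:R^-1 - (m + N)%:R^-1) + D * gap (m + N) by rewrite /gap; ring.
rewrite expRD mulrA ler_pM ?normc_ge0//.
apply: (le_trans _ (expR_ge1Dx _)); apply: (le_trans (le_normcD _ _)).
by rewrite normc1 lerD2l aD// leq_addl.
Qed.

Lemma mult_seq_cvg : exists l, ccvg \oo u l.
Proof.
pose E := expR D * normc (u N) * D.
have E0 : 0 <= E by rewrite /E mulr_ge0// mulr_ge0 ?expR_ge0 ?normc_ge0.
have h n : (N <= n)%N -> normc (u n.+1 - u n) <= E * gap n.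
  move=> Nn; rewrite uS// mulrDr mulr1 addrC addKr normcM /E -[leRHS]mulrA.
  by rewrite ler_pM ?normc_ge0 ?mult_seq_le ?aD.
have /cvg_ex[/= l1 c1] : cvgn (fun n => Re (u n)).
  apply: (@cvgn_of_gap _ E N) => // n /h; apply: le_trans.
  by rewrite -ReN -ReD ler_Re.
have /cvg_ex[/= l2 c2] : cvgn (fun n => Im (u n)).
  apply: (@cvgn_of_gap _ E N) => // n /h; apply: le_trans.
  by rewrite -ImN -ImD ler_Im.
by exists (l1 +i* l2).
Qed.
End MultSeq.

Definition eulerG n z : C := (n`!)%:R * cpow n%:R z / \prod_(k < n.+1) (z + k%:R).

(** The quotient [e_n / e_(n+1)] of two consecutive terms of Euler's sequence. *)
Definition eulerq n z : C :=
  (1 + z / n.+1%:R) * cexp (z * (ln n%:R - ln n.+1%:R)%:C).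

Lemma eulerG_step n z : eulerG n.+1 z = eulerG n z / eulerq n z.
Proof.
rewrite /eulerG /eulerq big_ord_recr/= factS natrM.
have n0 : n.+1%:R != 0 :> C by rewrite pnatr_eq0.
have -> : 1 + z / n.+1%:R = (z + n.+1%:R) / n.+1%:R.
  by rewrite mulrDl divff// addrC.
have -> : cpow n.+1%:R z = cpow n%:R z * (cexp (z * (ln n%:R - ln n.+1%:R)%:C))^-1.
  rewrite /cpow -cexpN -cexpD; congr cexp.
  by rewrite rmorphB/=; ring.
by rewrite !invfM invrK; ring.
Qed.

Lemma eulerGV_step n z : (eulerG n.+1 z)^-1 = (eulerG n z)^-1 * eulerq n z.
Proof. by rewrite eulerG_step invfM invrK. Qed.

Lemma ln_gap n : (0 < n)%N ->
  - n%:R^-1 <= ln (n%:R : R) - ln n.+1%:R <= - n.+1%:R^-1.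
Proof.
move=> n0; have n0' : 0 < n%:R :> R by rewrite ltr0n.
rewrite -ln_div ?posrE ?ltr0n//; apply/andP; split.
- rewrite lerNl -lnV ?posrE ?divr_gt0 ?ltr0n// invfM invrK mulrC.
  have -> : n.+1%:R / n%:R = 1 + n%:R^-1 :> R.
    by rewrite -addn1 natrD mulrDl divff ?gt_eqF// mul1r.
  by apply: le_ln1Dx; rewrite (lt_trans (ltrN10 _))// invr_gt0.
- have -> : n%:R / n.+1%:R = 1 + - n.+1%:R^-1 :> R.
    by rewrite -addn1 natrD; field; rewrite gt_eqF//; lra.
  apply: le_ln1Dx; rewrite ltrN2 invf_lt1 ?ltr0n// ltr1n.
  by rewrite ltnS.
Qed.

(** For [|z| <= B] the quotient [eulerq n z] differs from [1] by at most
    [eulerD B * gap n], once [n] is at least [eulerN B]. *)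
Definition eulerD (B : R) : R := B + B ^+ 2 + 18 * B ^+ 2 * (1 + B).

(** The linear terms in [z] of the two factors of [eulerq] cancel up to
    [O(1/n^2)], as [ln (n + 1) - ln n] is between [1/(n + 1)] and [1/n]. *)
Lemma eulerq_sub1 (B : R) z n : normc z <= B -> (0 < n)%N -> 2 * B <= n%:R ->
  normc (eulerq n z - 1) <= eulerD B * gap n.
Proof.
move=> zB n0 Bn; have n0' : 0 < n%:R :> R by rewrite ltr0n.
have B0 : 0 <= B := le_trans (normc_ge0 _) zB.
have /andP[l1 l2] := ln_gap n0.
set l := ln n%:R - ln n.+1%:R in l1 l2 *.
have n1 : 0 < n.+1%:R^-1 :> R by rewrite invr_gt0.
have nl : `|l| <= n%:R^-1.
  by rewrite ler_norml l1/= (le_trans l2)// (@le_trans _ _ 0) ?oppr_le0 ?invr_ge0.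
pose w := z * l%:C.
have wB : normc w <= B / n%:R by rewrite normcM normc_real ler_pM ?normc_ge0.
have w2 : normc w <= 2^-1.
  by apply: (le_trans wB); rewrite ler_pdivrMr//; lra.
have rq := cexp_quad w2.
set r := cexp w - 1 - w in rq.
have -> : eulerq n z - 1 = z * (l + n.+1%:R^-1)%:C + z * w * (n.+1%:R^-1)%:C
      + r * (1 + z * (n.+1%:R^-1)%:C).
  rewrite /eulerq -/l -/w.
  have -> : cexp w = 1 + w + r by rewrite /r; ring.
  have -> : (n.+1%:R^-1 : C) = (n.+1%:R^-1)%:C by rewrite natrC fmorphV.
  rewrite rmorphD/= /w; move: (real_complex R (n.+1%:R^-1)) (real_complex R l) r {rq} => c l' r'.
  by ring.
have g2 : n%:R^-1 * n.+1%:R^-1 = gap n by rewrite gapE// invfM.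
have k1 : normc (z * (l + n.+1%:R^-1)%:C) <= B * gap n.
  rewrite normcM normc_real ler_pM ?normc_ge0//.
  rewrite ler0_norm; last by rewrite -lerBrDr sub0r.
  by rewrite /gap opprD lerD2r lerNl.
have nn : normc (n.+1%:R^-1)%:C = n.+1%:R^-1 :> R by rewrite normc_real gtr0_norm.
have k2 : normc (z * w * (n.+1%:R^-1)%:C) <= B ^+ 2 * gap n.
  rewrite normcM nn normcM -g2 mulrA ler_pM2r//.
  by rewrite expr2 -mulrA ler_pM ?normc_ge0.
have k3 : normc (r * (1 + z * (n.+1%:R^-1)%:C)) <= 18 * B ^+ 2 * gap n * (1 + B).
  rewrite normcM ler_pM ?normc_ge0//.
  - apply: (le_trans rq).
    have h : normc w ^+ 2 <= B ^+ 2 * (n%:R^-1 * n%:R^-1).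
      by rewrite -expr2 -exprMn lerXn2r ?nnegrE ?normc_ge0 ?divr_ge0// ltW.
    have k : n%:R^-1 <= 2 * n.+1%:R^-1 :> R.
      rewrite -[leLHS]mul1r ler_pdivrMr// -mulrA [_^-1 * _]mulrC mulrA ler_pdivlMr//.
      by rewrite mul1r -natrM ler_nat mulSn mul1n -addn1 leq_add2l.
    have k' : B ^+ 2 * (n%:R^-1 * n%:R^-1) <= B ^+ 2 * (2 * gap n).
      rewrite ler_wpM2l ?sqr_ge0// -g2 mulrCA ler_pM2l ?invr_gt0//.
    lra.
  - apply: (le_trans (le_normcD _ _)); rewrite normc1 lerD2l normcM nn.
    rewrite -[leRHS]mulr1 ler_pM ?normc_ge0 ?(ltW n1)//.
    by rewrite invf_le1 ?ltr0n ?ler1n.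
apply: (le_trans (le_normcD _ _)).
apply: (@le_trans _ _ (B * gap n + B ^+ 2 * gap n + 18 * B ^+ 2 * gap n * (1 + B))).
  by apply: lerD => //; apply: (le_trans (le_normcD _ _)); exact: lerD.
by rewrite /eulerD; lra.
Qed.

Lemma eulerqV_sub1 (B : R) z n : normc z <= B -> (0 < n)%N -> 2 * B <= n%:R ->
  2 * eulerD B <= n%:R ->
  normc ((eulerq n z)^-1 - 1) <= 2 * eulerD B * gap n.
Proof.
move=> zB n0 Bn Dn; have n0' : 0 < n%:R :> R by rewrite ltr0n.
have q1 := eulerq_sub1 zB n0 Bn.
have B0 : 0 <= B := le_trans (normc_ge0 _) zB.
have D0 : 0 <= eulerD B by rewrite /eulerD; rewrite !(addr_ge0, mulr_ge0, sqr_ge0).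
have Dg : eulerD B * gap n <= 2^-1.
  apply: (@le_trans _ _ (eulerD B * n%:R^-1)); first by rewrite ler_wpM2l ?gap_le.
  by rewrite ler_pdivrMr//; lra.
have q2 : 2^-1 <= normc (eulerq n z).
  have := ler_normcB 1 (1 - eulerq n z); rewrite normc1 subKr normcB.
  lra.
have q0 : eulerq n z != 0 by rewrite -normc_gt0; apply: lt_le_trans q2.
have -> : (eulerq n z)^-1 - 1 = - ((eulerq n z - 1) / eulerq n z).
  by rewrite mulrBl divff// mul1r opprB.
rewrite normcN normcM normcV mulrC -mulrA.
apply: ler_pM; rewrite ?invr_ge0 ?normc_ge0//.
by rewrite -[leRHS]invrK lef_pV2 ?posrE ?normc_gt0.
Qed.

Definition eulerN (B : R) : nat :=
  (Num.truncn (2 * B + 2 * eulerD B)).+1.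

Lemma eulerNP (B : R) n : 0 <= B -> (eulerN B <= n)%N ->
  [/\ (0 < n)%N, 2 * B <= n%:R & 2 * eulerD B <= n%:R].
Proof.
move=> B0 Nn.
have D0 : 0 <= eulerD B by rewrite /eulerD; rewrite !(addr_ge0, mulr_ge0, sqr_ge0).
have h : 2 * B + 2 * eulerD B <= n%:R.
  apply: ltW; apply: (lt_le_trans (truncnS_gt _)).
  by rewrite ler_nat.
split; [exact: leq_trans Nn|lra|lra].
Qed.

(** One late term dominates all the following ones, uniformly on discs; with
    the same statement for the reciprocals this supplies the dominating functions
    for passing from Euler's sequence to Gamma under integral signs. *)
Lemma eulerG_le (B : R) z N n : normc z <= B -> (eulerN B <= N)%N -> (N <= n)%N ->
  normc (eulerG n z) <= expR (2 * eulerD B) * normc (eulerG N z).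
Proof.
move=> zB BN Nn.
have B0 : 0 <= B := le_trans (normc_ge0 _) zB.
have D0 : 0 <= eulerD B by rewrite /eulerD; rewrite !(addr_ge0, mulr_ge0, sqr_ge0).
have [N0 _ _] := eulerNP B0 BN.
apply: (@mult_seq_le (eulerG ^~ z) (fun n => (eulerq n z)^-1 - 1)) => //.
- by rewrite mulr_ge0.
- by move=> m Nm; rewrite eulerG_step [1 + _]addrC subrK.
- by move=> m Nm; have [? ? ?] := eulerNP B0 (leq_trans BN Nm); exact: eulerqV_sub1.
Qed.

Lemma eulerGV_le (B : R) z N n : normc z <= B -> (eulerN B <= N)%N -> (N <= n)%N ->
  normc (eulerG n z)^-1 <= expR (2 * eulerD B) * normc (eulerG N z)^-1.
Proof.
move=> zB BN Nn.
have B0 : 0 <= B := le_trans (normc_ge0 _) zB.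
have D0 : 0 <= eulerD B by rewrite /eulerD; rewrite !(addr_ge0, mulr_ge0, sqr_ge0).
have [N0 _ _] := eulerNP B0 BN.
apply: (@mult_seq_le (fun n => (eulerG n z)^-1) (fun n => eulerq n z - 1)) => //.
- by rewrite mulr_ge0.
- by move=> m Nm; rewrite eulerGV_step [1 + _]addrC subrK.
- move=> m Nm; have [? ? ?] := eulerNP B0 (leq_trans BN Nm).
  apply: (le_trans (eulerq_sub1 zB _ _)) => //.
  by rewrite ler_wpM2r ?gap_ge0// ler_peMl// ler1n.
Qed.

Lemma eulerG_cvg z : ccvg \oo (eulerG ^~ z) (Gamma z).
Proof.
have [l ul] : exists l, ccvg \oo (eulerG ^~ z) l.
  have B0 := normc_ge0 z.
  have D0 : 0 <= eulerD (normc z) by rewrite /eulerD; rewrite !(addr_ge0, mulr_ge0, sqr_ge0).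
  apply: (@mult_seq_cvg _ (fun n => (eulerq n z)^-1 - 1) (2 * eulerD (normc z)) (eulerN (normc z))).
  - by rewrite mulr_ge0.
  - by [].
  - by move=> m Nm; rewrite eulerG_step [1 + _]addrC subrK.
  - by move=> m Nm; have [? ? ?] := eulerNP B0 Nm; exact: eulerqV_sub1.
by have := ccvg_lim ul; rewrite -[X in X = l]/(Gamma z) => ->.
Qed.

Lemma eulerG_pole n z : (eulerG n z == 0) = [exists k : 'I_n.+1, z + k%:R == 0].
Proof.
rewrite /eulerG !mulf_eq0 invr_eq0 (negbTE (cpow_neq0 _ _)) orbF.
rewrite pnatr_eq0 eqn0Ngt fact_gt0/=.
apply/idP/existsP; first by move/prodf_eq0 => [k _ h]; exists k.
by move=> [k h]; apply/prodf_eq0; exists k.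
Qed.

(** At a pole of Gamma every late term of the sequence is [0], so the
    reciprocals converge to [0 = (Gamma z)^-1] there. *)
Lemma eulerGV_cvg z : ccvg \oo (fun n => (eulerG n z)^-1) (Gamma z)^-1.
Proof.
have [p|np] := pselect (Gamma_pole z).
  have [k zk] := p.
  have e0 : \forall n \near \oo, eulerG n z = 0.
    exists k => // n /= kn; apply/eqP; rewrite eulerG_pole.
    by apply/existsP; exists (Ordinal (kn : (k < n.+1)%N)); rewrite /= zk addrC subrr.
  have -> : Gamma z = 0.
    apply: ccvg_unique (eulerG_cvg z) _.
    apply: (ccvg_near (u := fun=> 0)); last exact: ccvg_cst.
    by apply: filterS e0 => n ->.
  apply: (ccvg_near (u := fun=> 0)); last by rewrite invr0; exact: ccvg_cst.
  by apply: filterS e0 => n ->; rewrite invr0.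
have e0 n : eulerG n z != 0.
  rewrite eulerG_pole; apply/existsPn => k; apply/negP => /eqP h.
  by apply: np; exists k; apply/eqP; rewrite -addr_eq0 h.
have [l ul] : exists l, ccvg \oo (fun n => (eulerG n z)^-1) l.
  have B0 := normc_ge0 z.
  have D0 : 0 <= eulerD (normc z) by rewrite /eulerD; rewrite !(addr_ge0, mulr_ge0, sqr_ge0).
  apply: (@mult_seq_cvg _ (fun n => eulerq n z - 1) (eulerD (normc z)) (eulerN (normc z))) => //.
  - by move=> m Nm; rewrite eulerGV_step [1 + _]addrC subrK.
  - by move=> m Nm; have [? ? ?] := eulerNP B0 Nm; exact: eulerq_sub1.
have h : Gamma z * l = 1.
  apply: ccvg_unique (ccvgM (eulerG_cvg z) ul) _.
  apply: (ccvg_near (u := fun=> 1)); last exact: ccvg_cst.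
  by apply: nearW => n; rewrite divff.
have g0 : Gamma z != 0.
  by apply/eqP => g0; move: h; rewrite g0 mul0r => /esym/eqP; rewrite oner_eq0.
by have -> : (Gamma z)^-1 = l by apply: (mulfI g0); rewrite divff.
Qed.

End EulerSequence.

(** * Euler's products on vertical lines *)

Section GammaGrowth.
Context {R : realType}.
Local Notation C := R[i].
Implicit Types (t c x y : R) (z w : C).

Section RealDerive.
Implicit Types (f g : R -> R).

(** The rules of differentiation for functions given by expressions in a
    variable, so that derivatives of composite expressions can be assembled. *)
Lemma rderD f g x a b : is_derive x (1:R) f a -> is_derive x (1:R) g b ->
  is_derive x (1:R) (fun t => f t + g t) (a + b).
Proof. by move=> df dg; apply: is_deriveD. Qed.
Lemma rderB f g x a b : is_derive x (1:R) f a -> is_derive x (1:R) g b ->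
  is_derive x (1:R) (fun t => f t - g t) (a - b).
Proof. by move=> df dg; apply: is_deriveB. Qed.
Lemma rderM f g x a b : is_derive x (1:R) f a -> is_derive x (1:R) g b ->
  is_derive x (1:R) (fun t => f t * g t) (a * g x + f x * b).
Proof.
move=> df dg; apply: (@is_derive_eq _ _ _ _ _ _ _ _ (is_deriveM df dg)).
by rewrite /GRing.scale/= addrC; congr (_ + _); rewrite mulrC.
Qed.
Lemma rder_cst (c x : R) : is_derive x (1:R) (fun=> c) 0.
Proof. exact: is_derive_cst. Qed.
Lemma rder_id (x : R) : is_derive x (1:R) (fun t => t) 1.
Proof. exact: is_derive_id. Qed.
Lemma rderZ f (c x a : R) : is_derive x (1:R) f a -> is_derive x (1:R) (fun t => c * f t) (c * a).
Proof. by move=> df; apply: is_deriveZ. Qed.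
Lemma rder_eq f x a b : is_derive x (1:R) f a -> a = b -> is_derive x (1:R) f b.
Proof. by move=> df <-. Qed.
Lemma rder_comp f g x a b : is_derive (g x) (1:R) f a -> is_derive x (1:R) g b ->
  is_derive x (1:R) (fun t => f (g t)) (a * b).
Proof. exact: is_derive1_comp. Qed.
End RealDerive.

Lemma expR_chord t c : 0 <= t <= 1 -> expR (t * c) <= 1 - t + t * expR c.
Proof.
move=> /andP[t0 t1].
have := convex_expR (Itv01 t0 t1) (c : R^o) (0 : R^o).
rewrite !convRE/= mulr0 addr0 expR0 mulr1 /unstable.onem; lra.
Qed.

Lemma expR_ln_ratio m : (0 < m)%N -> expR (ln m.+1%:R - ln (m%:R : R)) = 1 + m%:R^-1.
Proof.
move=> m0; have m0' : 0 < m%:R :> R by rewrite ltr0n.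
by rewrite expRB !lnK ?posrE ?ltr0n// -addn1 natrD mulrDl divff ?gt_eqF// mul1r.
Qed.

(** Bernoulli's inequality [(1 + 1/m)^t <= 1 + t/m], from the convexity of
    the exponential on the segment from [0] to [ln (1 + 1/m)]. *)
Lemma bernoulli_le t m : 0 <= t <= 1 -> (0 < m)%N ->
  m%:R * expR (t * (ln m.+1%:R - ln (m%:R : R))) <= m%:R + t.
Proof.
move=> t01 m0; have m0' : 0 < m%:R :> R by rewrite ltr0n.
have := expR_chord (ln m.+1%:R - ln m%:R) t01.
rewrite expR_ln_ratio// -(ler_pM2l m0') => /le_trans; apply.
have -> // : m%:R * (1 - t + t * (1 + m%:R^-1)) = m%:R + t by field; rewrite gt_eqF.
Qed.

Lemma bernoulli_ge x m : 1 <= x -> (0 < m)%N ->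
  m%:R + x <= m%:R * expR (x * (ln m.+1%:R - ln (m%:R : R))).
Proof.
move=> x1 m0; have m0' : 0 < m%:R :> R by rewrite ltr0n.
have x0 : 0 < x by lra.
have t01 : 0 <= x^-1 <= 1 by rewrite invr_ge0 ltW//= invf_le1.
have := expR_chord (x * (ln m.+1%:R - ln m%:R)) t01.
rewrite mulKf ?gt_eqF// expR_ln_ratio// -lerBlDl => h.
have {}h : x * (1 + m%:R^-1 - (1 - x^-1)) <= expR (x * (ln m.+1%:R - ln m%:R)).
  by move: h; rewrite -(ler_pM2l x0) mulrA divff ?gt_eqF// mul1r.
apply: le_trans (_ : m%:R * (x * (1 + m%:R^-1 - (1 - x^-1))) <= _); last by rewrite ler_pM2l.
have -> : m%:R * (x * (1 + m%:R^-1 - (1 - x^-1))) = x + m%:R :> R.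
  by field; rewrite !gt_eqF.
by rewrite addrC.
Qed.

(** By induction, multiplying Bernoulli's inequalities.  This bound and the
    next one stand in for Stirling's formula on the real axis. *)
Lemma euler_prod_ge t n : 0 <= t <= 1 ->
  n.+1`!%:R * expR (t * ln n.+2%:R) <= \prod_(k < n.+1) (1 + t + k%:R : R).
Proof.
move=> t01; elim: n => [|n IH].
  rewrite big_ord1 factS fact0 muln1 addr0 mul1r.
  have := bernoulli_le t01 (ltn0Sn 0).
  by rewrite ln1 subr0 mul1r.
rewrite big_ord_recr/= factS natrM.
have -> : t * ln n.+3%:R = t * ln n.+2%:R + t * (ln n.+3%:R - ln n.+2%:R) by ring.
rewrite expRD [n.+2%:R * _]mulrC mulrACA.
apply: ler_pM => //; rewrite ?mulr_ge0 ?expR_ge0//.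
apply: (le_trans (bernoulli_le t01 (ltn0Sn n.+1))).
by rewrite -[n.+2]addn1 natrD; move: (n.+1%:R) => m; lra.
Qed.

Lemma euler_prod_le x n : 1 <= x ->
  \prod_(k < n.+1) (x + k%:R : R) <= x * n`!%:R * expR (x * ln n.+1%:R).
Proof.
move=> x1; elim: n => [|n IH].
  by rewrite big_ord1 fact0 addr0 ln1 mulr0 expR0 !mulr1.
rewrite big_ord_recr/= factS natrM.
have -> : x * ln n.+2%:R = x * ln n.+1%:R + x * (ln n.+2%:R - ln n.+1%:R) by ring.
rewrite expRD.
have -> : x * (n.+1%:R * n`!%:R) * (expR (x * ln n.+1%:R) * expR (x * (ln n.+2%:R - ln n.+1%:R)))
  = (x * n`!%:R * expR (x * ln n.+1%:R)) * (n.+1%:R * expR (x * (ln n.+2%:R - ln n.+1%:R))).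
  by ring.
apply: ler_pM => //.
- by apply: prodr_ge0 => k _; rewrite addr_ge0//; lra.
- by rewrite addr_ge0//; lra.
- by rewrite addrC bernoulli_ge.
Qed.

(** Partial products of the product for [sinh (pi y) / (pi y)]. *)
Definition sinhprod n y : R := \prod_(k < n) (1 + y ^+ 2 / k.+1%:R ^+ 2).

Lemma sinhprod_gt0 n y : 0 < sinhprod n y.
Proof.
by apply: prodr_gt0 => k _; rewrite (lt_le_trans ltr01)// lerDl divr_ge0 ?sqr_ge0.
Qed.

(** A primitive of [ln (1 + y^2 / u^2)] in the variable [u]. *)
Definition atanPhi y u : R := u * (ln (u ^+ 2 + y ^+ 2) - 2 * ln u) + 2 * y * atan (u / y).

Lemma is_derive_atanPhi y (u : R) : 0 < y -> 0 < u ->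
  is_derive u (1:R) (atanPhi y) (ln (u ^+ 2 + y ^+ 2) - 2 * ln u).
Proof.
move=> y0 u0.
have p0 : 0 < u ^+ 2 + y ^+ 2 by rewrite addr_gt0 ?exprn_gt0.
have d1 : is_derive u (1:R) (fun v => v ^+ 2 + y ^+ 2) (2 * u).
  apply: rder_eq (rderD (rderM (rder_id u) (rder_id u)) (rder_cst (y ^+ 2) u)) _; ring.
have d2 := @rder_comp _ (fun v => v ^+ 2 + y ^+ 2) _ _ _ (is_derive1_ln p0) d1.
have d3 := rderZ 2 (is_derive1_ln u0).
have d5 := @rder_comp _ (fun v => v * y^-1) _ _ _ (is_derive1_atan (u * y^-1)) (rderM (rder_id u) (rder_cst y^-1 u)).
apply: rder_eq (rderD (rderM (rder_id u) (rderB d2 d3)) (rderZ (2 * y) d5)) _.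
field.
by rewrite !gt_eqF// addr_gt0 ?exprn_gt0.
Qed.

Lemma lnE_ratio y (u : R) : 0 < u -> ln (u ^+ 2 + y ^+ 2) - 2 * ln u = ln (1 + y ^+ 2 / u ^+ 2).
Proof.
move=> u0; have u2 : 0 < u ^+ 2 by rewrite exprn_gt0.
have -> : 2 * ln u = ln (u ^+ 2) by rewrite lnXn// mulr_natl.
rewrite -ln_div ?posrE//; last by rewrite ltr_wpDr ?sqr_ge0.
by rewrite mulrDl divff ?gt_eqF.
Qed.

(** The derivative of [atanPhi y] decreases, so by the mean value theorem its
    increment lies between the values of the derivative at the end points. *)
Lemma atanPhi_step y (n : nat) : 0 < y -> (0 < n)%N ->
  ln (1 + y ^+ 2 / n.+1%:R ^+ 2) <= atanPhi y n.+1%:R - atanPhi y n%:R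
    <= ln (1 + y ^+ 2 / n%:R ^+ 2).
Proof.
move=> y0 n0; have n0' : 0 < n%:R :> R by rewrite ltr0n.
have nn : n%:R < n.+1%:R :> R by rewrite ltr_nat.
have [||c cab ->] := @MVT _ (atanPhi y) (fun u => ln (u ^+ 2 + y ^+ 2) - 2 * ln u) _ _ nn.
- move=> u /[!in_itv]/= /andP[nu _]; apply: is_derive_atanPhi => //.
  exact: lt_trans nu.
- apply: derivable_within_continuous => u /[!in_itv]/= /andP[nu _].
  by have [] := is_derive_atanPhi y0 (lt_le_trans n0' nu).
move: cab; rewrite in_itv/= => /andP[nc cn].
have c0 : 0 < c by apply: lt_trans nc.
have -> : n.+1%:R - n%:R = 1 :> R by rewrite -addn1 natrD addrC addKr.
rewrite mulr1 lnE_ratio//.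
have p u : 0 < 1 + y ^+ 2 / u ^+ 2 by rewrite (lt_le_trans ltr01)// lerDl divr_ge0 ?sqr_ge0.
rewrite !ler_ln ?posrE// !lerD2l; apply/andP; split; rewrite ler_wpM2l ?sqr_ge0//.
- by rewrite lef_pV2 ?posrE ?exprn_gt0 ?ltr0n// lerXn2r ?nnegrE ?ltW.
- by rewrite lef_pV2 ?posrE ?exprn_gt0 ?ltr0n// lerXn2r ?nnegrE ?ltW.
Qed.

Lemma ln_sinhprod n y : ln (sinhprod n y) = \sum_(k < n) ln (1 + y ^+ 2 / k.+1%:R ^+ 2).
Proof.
elim: n => [|n IH]; first by rewrite /sinhprod !big_ord0 ln1.
rewrite /sinhprod !big_ord_recr/= lnM ?posrE ?sinhprod_gt0// ?IH//.
by rewrite (lt_le_trans ltr01)// lerDl divr_ge0 ?sqr_ge0.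
Qed.

Lemma atan_le x : 0 <= x -> atan x <= x.
Proof.
move=> x0; have := @MVT_le _ atan (fun x => (1 + x ^+ 2)^-1) 1 0 x (@is_derive1_atan R).
rewrite atan0 !subr0 mul1r => h.
apply: (le_trans (ler_norm _)); rewrite -[leRHS]ger0_norm//; apply: h => u _.
have : 0 <= u ^+ 2 by rewrite sqr_ge0.
move=> u2; rewrite ger0_norm ?invr_ge0 ?invf_le1; lra.
Qed.

(** The sum of the logarithms is at most [atanPhi y n], where the arc tangent
    is below [pi / 2]. *)
Lemma sinhprod_le y n : 0 < y -> (0 < n)%N ->
  sinhprod n y <= expR (pi * y + y ^+ 2 / n%:R).
Proof.
move=> y0; case: n => // n _.
rewrite -(@ler_ln _ _ (expR _)) ?posrE ?sinhprod_gt0 ?expR_gt0// expRK ln_sinhprod.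
have h m : \sum_(k < m.+1) ln (1 + y ^+ 2 / k.+1%:R ^+ 2) <= atanPhi y m.+1%:R.
  elim: m => [|m IH].
    rewrite big_ord1 /atanPhi lnE_ratio// mul1r lerDl mulr_ge0//; first lra.
    by rewrite -(@atan0 R) ltW// lt_atan// div1r invr_gt0.
  rewrite big_ord_recr/=.
  by have /andP[] := atanPhi_step y0 (ltn0Sn m); move: IH; lra.
apply: (le_trans (h n)); rewrite /atanPhi lnE_ratio ?ltr0n// addrC; apply: lerD.
- by have := atan_ltpi2 (n.+1%:R / y); nra.
- rewrite -ler_pdivlMl ?ltr0n//.
  have := @le_ln1Dx R (y ^+ 2 / n.+1%:R ^+ 2).
  rewrite (lt_le_trans _ (divr_ge0 (sqr_ge0 _) (sqr_ge0 _))) ?ltrN10// => /(_ isT).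
  by move/le_trans; apply; rewrite mulrCA -invfM -expr2.
Qed.

(** As [n] tends to infinity the exponent tends to [pi y - 2]. *)
Lemma sinhprod_ge y n : 0 < y ->
  expR (2 * y * atan (n.+1%:R / y) - 2) <= (1 + y ^+ 2) * sinhprod n y.
Proof.
move=> y0.
have y1 : 0 < 1 + y ^+ 2 by rewrite ltr_wpDr ?sqr_ge0.
rewrite -(@ler_ln _ (expR _)) ?posrE ?mulr_gt0 ?sinhprod_gt0 ?expR_gt0// expRK.
rewrite lnM ?posrE ?sinhprod_gt0// ln_sinhprod.
have h m : atanPhi y m.+1%:R - atanPhi y 1 <= \sum_(k < m) ln (1 + y ^+ 2 / k.+1%:R ^+ 2).
  elim: m => [|m IH]; first by rewrite big_ord0 subrr.
  rewrite big_ord_recr/=.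
  by have /andP[_] := atanPhi_step y0 (ltn0Sn m); move: IH; lra.
have := h n; rewrite /atanPhi !lnE_ratio ?ltr0n// mul1r expr1n divr1.
have a1 : 2 * y * atan (1 / y) <= 2.
  have iy0 : 0 <= 1 / y by rewrite divr_ge0// ltW.
  have y2 : 0 < 2 * y by rewrite mulr_gt0.
  have := atan_le iy0; rewrite -(ler_pM2l y2) => /le_trans; apply.
  by rewrite mul1r mulfK ?gt_eqF.
have : 0 <= n.+1%:R * ln (1 + y ^+ 2 / n.+1%:R ^+ 2).
  by rewrite mulr_ge0// ln_ge0// lerDl divr_ge0 ?sqr_ge0.
move: (n.+1%:R * _) => a; move: (2 * y * atan (n.+1%:R / y)) => b.
move: (\sum_(_ < _) _) => c; lra.
Qed.

Lemma normc_lin x k y : normc ((x +i* y) + k%:R) = Num.sqrt ((x + k%:R) ^+ 2 + y ^+ 2).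
Proof. by rewrite normcE2 !reimE/= addr0. Qed.

Lemma normc_eulerG x y n :
  normc (eulerG n (x +i* y)) =
  n`!%:R * expR (x * ln n%:R) / \prod_(k < n.+1) normc ((x +i* y) + k%:R).
Proof. by rewrite /eulerG !normcM normcV normc_prod normc_nat normc_cpow. Qed.

(** The modulus of [z + k] is [x + k] times the square root of
    [1 + y^2 / (x + k)^2], and [x + k <= k + 2] since [x <= 2]: up to the first
    factor of [sinhprod], which gives the right-hand side, the product is at least
    a product for [sinh], and on the real axis [euler_prod_ge] applies. *)
Lemma eulerG_upper x y n : 1 <= x <= 2 -> (0 < n)%N ->
  normc (eulerG n (x +i* y)) ^+ 2 * sinhprod n.+2 y <= 1 + y ^+ 2.
Proof.
move=> /andP[x1 x2] n0; rewrite normc_eulerG.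
have n0' : 0 < n%:R :> R by rewrite ltr0n.
have f0 : 0 < n`!%:R :> R by rewrite ltr0n fact_gt0.
set P := \prod_(k < n.+1) _.
pose Q : R := \prod_(k < n.+1) (x + k%:R).
have xk k : 0 < x + k%:R :> R by rewrite (lt_le_trans (_ : 0 < x))// ?lerDl//; lra.
have Q0 : 0 < Q by apply: prodr_gt0.
have P2 : P ^+ 2 = Q ^+ 2 * \prod_(k < n.+1) (1 + y ^+ 2 / (x + k%:R) ^+ 2).
  rewrite -!prodrXl -big_split/=; apply: eq_bigr => k _.
  rewrite normc_lin sqr_sqrtr ?addr_ge0 ?sqr_ge0// mulrDr mulr1 mulrCA divff ?mulr1//.
  by rewrite expf_eq0/= gt_eqF.
have SP : sinhprod n.+2 y <= (1 + y ^+ 2) * \prod_(k < n.+1) (1 + y ^+ 2 / (x + k%:R) ^+ 2).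
  rewrite /sinhprod big_ord_recl/= expr1n divr1 ler_pM2l; last by rewrite ltr_wpDr ?sqr_ge0.
  apply: ler_prod => k _; rewrite addr_ge0 ?divr_ge0 ?sqr_ge0//= lerD2l.
  rewrite ler_wpM2l ?sqr_ge0// lef_pV2 ?posrE ?exprn_gt0// lerXn2r ?nnegrE ?(ltW (xk _))//.
  have -> : (bump 0 k).+1%:R = k%:R + 2 :> R by rewrite /bump/= add1n -natrD addn2.
  by rewrite addrC lerD2l.
have gQ : n`!%:R * expR (x * ln n%:R) <= Q.
  have t01 : 0 <= x - 1 <= 1 by lra.
  have := euler_prod_ge n t01; rewrite [1 + _]addrC subrK; apply: le_trans.
  have -> : x * ln n%:R = (x - 1) * ln n%:R + ln n%:R by ring.
  rewrite expRD lnK ?posrE// [expR _ * _]mulrC mulrA.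
  apply: ler_pM; rewrite ?mulr_ge0 ?expR_ge0//.
  - by rewrite factS natrM mulrC ler_pM2r// ler_nat.
  - rewrite ler_expR ler_wpM2l//; first lra.
    by rewrite ler_ln ?posrE ?ltr0n// ler_nat -addn2 leq_addr.
have Pgt : 0 < P by rewrite /P; apply: prodr_gt0 => k _; rewrite normc_lin sqrtr_gt0 ltr_wpDr ?sqr_ge0// exprn_gt0.
rewrite exprMn exprVn mulrAC ler_pdivrMr ?exprn_gt0// P2 mulrCA.
apply: ler_pM => //; rewrite ?sqr_ge0 ?(ltW (sinhprod_gt0 _ _))//.
by rewrite lerXn2r ?nnegrE ?(ltW Q0)// mulr_ge0 ?expR_ge0.
Qed.
End GammaGrowth.

(** * Gamma and its reciprocal on vertical strips *)

Section GammaStrips.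
Context {R : realType}.
Local Notation C := R[i].
Implicit Types (x y e B : R) (z w s : C).

Lemma sinhprod_norm n y : sinhprod n `|y| = sinhprod n y.
Proof. by apply: eq_bigr => k _; rewrite real_normK ?num_real. Qed.

Lemma cvg_atan_nat y : 0 < y -> atan (n.+3%:R / y) @[n --> \oo] --> (pi / 2 : R).
Proof.
move=> y0; apply: (cvg_comp _ _ _ (@cvgy_atan R)).
have h : (n.+3%:R : R) @[n --> \oo] --> +oo.
  by have := @cvgr_idn R; rewrite -(cvg_shiftn 3); under eq_fun do rewrite addn3.
apply/cvgryPge => A; move/cvgryPge : h => /(_ (A * y)); apply: filterS => n.
by rewrite ler_pdivlMr.
Qed.

(** The limit of [eulerG_upper], where [sinhprod_ge] bounds the product from
    below. *)
Lemma Gamma_le_strip12 z : 1 <= Re z <= 2 -> Im z != 0 ->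
  normc (Gamma z) <= (1 + Im z ^+ 2) * expR (1 - pi / 2 * `|Im z|).
Proof.
case: z => x y/= x12 y0; have ny0 : 0 < `|y| by rewrite normr_gt0.
have y1 : 0 < 1 + y ^+ 2 by rewrite ltr_wpDr ?sqr_ge0.
pose E n := expR (2 * `|y| * atan (n.+3%:R / `|y|) - 2).
have gE n : (0 < n)%N -> normc (eulerG n (x +i* y)) ^+ 2 * E n <= (1 + y ^+ 2) ^+ 2.
  move=> n0; have := eulerG_upper y x12 n0.
  rewrite -(ler_pM2l y1) -expr2; apply: le_trans.
  rewrite mulrCA ler_wpM2l ?sqr_ge0//.
  by have := sinhprod_ge n.+2 ny0; rewrite sinhprod_norm real_normK ?num_real.
have lim : normc (Gamma (x +i* y)) ^+ 2 * expR (2 * `|y| * (pi / 2) - 2) <= (1 + y ^+ 2) ^+ 2.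
  have c : normc (eulerG n (x +i* y)) ^+ 2 * E n @[n --> \oo] -->
      normc (Gamma (x +i* y)) ^+ 2 * expR (2 * `|y| * (pi / 2) - 2).
    apply: cvgM.
      rewrite expr2; under eq_fun do rewrite expr2.
      by apply: cvgM; apply: ccvg_normc; exact: eulerG_cvg.
    apply: (cvg_comp (fun n => 2 * `|y| * atan (n.+3%:R / `|y|) - 2)); last exact: continuous_expR.
    by apply: cvgB; [apply: cvgMr; exact: cvg_atan_nat|exact: cvg_cst].
  apply: (@ler_cvg_to _ _ _ _ _ (fun=> (1 + y ^+ 2) ^+ 2) _ _ c (cvg_cst _)).
  by near=> n; apply: gE; near: n; exact: nbhs_infty_gt.
rewrite -(@ler_pXn2r _ 2) ?nnegrE ?normc_ge0 ?mulr_ge0 ?expR_ge0 ?(ltW y1)//.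
rewrite exprMn -expRM_natl -ler_pdivrMr ?expR_gt0// -expRN.
by apply: le_trans lim; rewrite le_eqVlt; apply/orP; left; apply/eqP; congr (_ * expR _); lra.
Unshelve. all: by end_near. Qed.

(** Here [x + k >= k + 1], hence the modulus of [z + k] is at most [x + k]
    times the square root of a factor of [sinhprod]; then [n] tends to infinity. *)
Lemma GammaV_le_ge1 z : 1 <= Re z ->
  normc (Gamma z)^-1 <= Re z * expR (Re z) * expR (pi / 2 * `|Im z|).
Proof.
case: z => x y/= x1; have x0 : 0 < x by lra.
pose E n := (x * expR x) ^+ 2 * expR (pi * `|y| + y ^+ 2 / n.+1%:R).
have gE n : (0 < n)%N -> normc (eulerG n (x +i* y))^-1 ^+ 2 <= E n.
  move=> n0; rewrite normcV normc_eulerG.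
  have f0 : 0 < n`!%:R :> R by rewrite ltr0n fact_gt0.
  set P := \prod_(k < n.+1) _.
  pose Q : R := \prod_(k < n.+1) (x + k%:R).
  have xk k : 0 < x + k%:R :> R by rewrite (lt_le_trans x0)// lerDl.
  have Q0 : 0 < Q by apply: prodr_gt0.
  have P2 : P ^+ 2 <= Q ^+ 2 * sinhprod n.+1 y.
    rewrite -!prodrXl /sinhprod -big_split/=; apply: ler_prod => k _.
    rewrite sqr_ge0/= normc_lin sqr_sqrtr ?addr_ge0 ?sqr_ge0// mulrDr mulr1 lerD2l.
    rewrite mulrCA ler_peMr ?sqr_ge0// ler_pdivlMr ?exprn_gt0 ?ltr0n// mul1r.
    by rewrite lerXn2r ?nnegrE ?(ltW (xk _))// -addn1 natrD addrC lerD2r.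
  have Qle : Q <= x * n`!%:R * expR (x * ln n%:R) * expR x.
    apply: (le_trans (euler_prod_le n x1)); rewrite -[leRHS]mulrA -expRD.
    rewrite ler_wpM2l ?mulr_ge0 ?(ltW x0)// ler_expR.
    have h : ln n.+1%:R <= ln n%:R + 1 :> R.
      have /andP[+ _] := @ln_gap R n n0.
      have : n%:R^-1 <= 1 :> R by rewrite invf_le1 ?ltr0n// ler1n.
      move: (ln n.+1%:R) (ln n%:R) (n%:R^-1) => a b c; lra.
    by have := ler_wpM2l (ltW x0) h; rewrite mulrDr mulr1.
  have Ssh : sinhprod n.+1 y <= expR (pi * `|y| + y ^+ 2 / n.+1%:R).
    have [->|y0] := eqVneq y 0.
      rewrite /sinhprod normr0 mulr0 expr0n/= mul0r addr0 expR0.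
      by rewrite big1// => k _; rewrite mul0r addr0.
    rewrite -sinhprod_norm -[y ^+ 2]real_normK ?num_real//.
    by apply: sinhprod_le => //; rewrite normr_gt0.
  rewrite invfM invrK exprMn exprVn mulrC ler_pdivrMr ?exprn_gt0 ?mulr_gt0 ?expR_gt0//.
  apply: (le_trans P2); rewrite /E [leRHS]mulrAC; apply: ler_pM => //; rewrite ?sqr_ge0 ?(ltW (sinhprod_gt0 _ _))//.
  rewrite -exprMn lerXn2r ?nnegrE ?(ltW Q0)//.
    by rewrite !mulr_ge0 ?expR_ge0// ltW.
  by apply: (le_trans Qle); rewrite le_eqVlt; apply/orP; left; apply/eqP; ring.
have lim : normc (Gamma (x +i* y))^-1 ^+ 2 <= (x * expR x) ^+ 2 * expR (pi * `|y| + y ^+ 2 * 0).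
  have c : normc (eulerG n (x +i* y))^-1 ^+ 2 @[n --> \oo] --> normc (Gamma (x +i* y))^-1 ^+ 2.
    rewrite expr2; under eq_fun do rewrite expr2.
    by apply: cvgM; apply: ccvg_normc; exact: eulerGV_cvg.
  have cE : E n @[n --> \oo] --> (x * expR x) ^+ 2 * expR (pi * `|y| + y ^+ 2 * 0).
    apply: cvgMr; apply: (cvg_comp (fun n => pi * `|y| + y ^+ 2 / n.+1%:R)); last exact: continuous_expR.
    by apply: cvgD; [exact: cvg_cst|apply: cvgMr; exact: cvg_harmonic].
  apply: (ler_cvg_to c cE).
  by near=> n; apply: gE; near: n; exact: nbhs_infty_gt.
rewrite -(@ler_pXn2r _ 2) ?nnegrE ?normc_ge0 ?mulr_ge0 ?expR_ge0 ?(ltW x0)//.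
apply: (le_trans lim); rewrite mulr0 addr0 [leRHS]exprMn -[expR (pi / 2 * _) ^+ 2]expRM_natl.
by rewrite le_eqVlt; apply/orP; left; apply/eqP; congr (_ * expR _); lra.
Unshelve. all: by end_near. Qed.

(** The recurrence is stated for the reciprocal because it then holds at the
    poles of Gamma as well. *)
Lemma GammaV_step z : (Gamma z)^-1 = z * (Gamma (z + 1))^-1.
Proof.
have step n : (0 < n)%N ->
    (eulerG n z)^-1 * (1 + (z + 1) * (n%:R^-1 : R)%:C) = z * (eulerG n (z + 1))^-1.
  move=> n0; have n0' : n%:R != 0 :> C by rewrite pnatr_eq0 -lt0n.
  rewrite /eulerG cpowD cpow1 ?ltr0n// !invfM !invrK.
  have -> : (n%:R^-1 : R)%:C = n%:R^-1 :> C by rewrite natrC fmorphV.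
  rewrite -natrC.
  have PP : \prod_(k < n.+1) (z + 1 + k%:R) * z = \prod_(k < n.+1) (z + k%:R) * (z + n.+1%:R).
    transitivity (\prod_(k < n.+2) (z + k%:R)); last by rewrite big_ord_recr.
    rewrite [RHS]big_ord_recl/= addr0 [LHS]mulrC; congr (_ * _).
    by apply: eq_bigr => k _; rewrite /bump leq0n natrD addrA.
  have -> : 1 + (z + 1) * n%:R^-1 = (z + n.+1%:R) * n%:R^-1.
    by rewrite -[n.+1]addn1 natrD -{1}(divff n0') -mulrDl; congr (_ * _); ring.
  move: (n`!%:R^-1) (cpow n%:R z)^-1 (n%:R^-1 : C) => u v w.
  rewrite [LHS]mulrCA !mulrA [LHS](_ : _ = u * v * w * (\prod_(k < n.+1) (z + k%:R) * (z + n.+1%:R))); last by ring.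
  by rewrite -PP; ring.
apply: ccvg_unique (ccvgM (ccvg_cst (F := \oo) z) (eulerGV_cvg (z + 1))).
have c1 : ccvg \oo (fun n => 1 + (z + 1) * (n%:R^-1 : R)%:C) 1.
  rewrite -[X in ccvg _ _ X]addr0 -(mulr0 (z + 1)).
  apply: ccvgD; first exact: ccvg_cst.
  apply: ccvgM; first exact: ccvg_cst.
  apply: ccvg_real; apply/gtr0_cvgV0; last exact: cvgr_idn.
  by near=> n; rewrite ltr0n; near: n; exact: nbhs_infty_gt.
have h : ccvg \oo (fun n => (eulerG n z)^-1 * (1 + (z + 1) * (n%:R^-1 : R)%:C)) (Gamma z)^-1.
  by rewrite -[X in ccvg _ _ X]mulr1; apply: ccvgM c1; exact: eulerGV_cvg.
apply: ccvg_near h.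
by near=> n; apply: step; near: n; exact: nbhs_infty_gt.
Unshelve. all: by end_near. Qed.

Lemma Gamma_step z : z != 0 -> Gamma (z + 1) = z * Gamma z.
Proof.
move=> z0; rewrite -[Gamma z]invrK GammaV_step invfM invrK.
by rewrite mulrA divff// mul1r.
Qed.

Lemma lin_le_expR (a e : R) : 0 <= a -> 0 < e ->
  exists2 D, 0 <= D & forall y, a + `|y| <= D * expR (e * `|y|).
Proof.
move=> a0 e0; exists (a + e^-1); first by rewrite addr_ge0 ?invr_ge0 ?(ltW e0).
move=> y; have h := expR_ge1Dx (e * `|y|).
have p : 0 <= e * `|y| by rewrite mulr_ge0// ltW.
rewrite mulrDl; apply: lerD; first by rewrite ler_peMr//; lra.
by rewrite ler_pdivlMl//; lra.
Qed.

(** Each use of the recurrence [Gamma z = (z - 1) Gamma (z - 1)] costs a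
    polynomial factor, which is absorbed by [exp (e / 2 |Im z|)]. *)
Lemma Gamma_decay_right (m : nat) e : 0 < e -> exists2 D, 0 <= D &
  forall z, 1 <= Re z <= m%:R + 2 -> Im z != 0 ->
  normc (Gamma z) <= D * expR ((e - pi / 2) * `|Im z|).
Proof.
elim: m e => [|m IH] e e0.
  have [D D0 hD] := @lin_le_expR 1 (e / 2) ler01 (divr_gt0 e0 (ltr0n _ 2)).
  exists (D ^+ 2 * expR 1) => [|z]; first by rewrite mulr_ge0 ?sqr_ge0 ?expR_ge0.
  rewrite add0r => z12 z0; apply: (le_trans (Gamma_le_strip12 z12 z0)).
  have -> : D ^+ 2 * expR 1 * expR ((e - pi / 2) * `|Im z|) =
    (D * expR (e / 2 * `|Im z|)) ^+ 2 * expR (1 - pi / 2 * `|Im z|).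
    rewrite exprMn -[expR (_ * `|_|) ^+ 2]expRM_natl -[LHS]mulrA -[RHS]mulrA -!expRD.
    by congr (_ * expR _); field.
  rewrite ler_pM2r ?expR_gt0//; apply: (@le_trans _ _ ((1 + `|Im z|) ^+ 2)).
    by rewrite -[Im z ^+ 2]real_normK ?num_real//; have := normr_ge0 (Im z); rewrite !expr2; nra.
  by rewrite lerXn2r ?nnegrE ?mulr_ge0 ?expR_ge0 ?addr_ge0.
have e20 : 0 < e / 2 by rewrite divr_gt0.
have [D D0 hD] := IH _ e20.
have [D' D'0 hD'] := @lin_le_expR (m%:R + 2) (e / 2) (addr_ge0 (ler0n _ _) (ler0n _ _)) e20.
exists (D' * D + D) => [|z /andP[z1 zm] z0]; first by rewrite addr_ge0 ?mulr_ge0.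
have [z2|z2] := leP (Re z) 2.
  apply: (@le_trans _ _ (D * expR ((e / 2 - pi / 2) * `|Im z|))).
    by apply: hD => //; rewrite z1/= (le_trans z2)// lerDr.
  apply: ler_pM; rewrite ?expR_ge0 ?lerDr ?mulr_ge0// ler_expR ler_wpM2r//; lra.
have w0 : z - 1 != 0 by apply: contra_neq z0 => /(congr1 (@complex.Im R)); rewrite !reimE subr0.
have -> : Gamma z = (z - 1) * Gamma (z - 1) by rewrite -Gamma_step// subrK.
rewrite normcM.
have n1 : normc (z - 1) <= D' * expR (e / 2 * `|Im z|).
  apply: le_trans (hD' _); apply: (le_trans (normc_le_ReIm _)).
  rewrite !reimE subr0 lerD2r ger0_norm; last lra.
  by move: zm; rewrite -addn1 natrD; lra.
have n2 : normc (Gamma (z - 1)) <= D * expR ((e / 2 - pi / 2) * `|Im z|).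
  have := hD (z - 1); rewrite !reimE subr0; apply=> //.
  by apply/andP; split; [lra|move: zm; rewrite -addn1 natrD; lra].
apply: (@le_trans _ _ (D' * D * expR ((e - pi / 2) * `|Im z|))).
  have -> : D' * D * expR ((e - pi / 2) * `|Im z|) = (D' * expR (e / 2 * `|Im z|)) * (D * expR ((e / 2 - pi / 2) * `|Im z|)).
    by rewrite mulrACA -expRD; congr (_ * expR _); field.
  exact: (ler_pM (normc_ge0 _) (normc_ge0 _) n1 n2).
by rewrite ler_wpM2r ?expR_ge0// lerDl.
Qed.

(** Moving to the left costs nothing: [Gamma z = Gamma (z + 1) / z] and
    [|z| >= 1]. *)
Lemma Gamma_decay B e : 0 < e -> exists2 D, 0 <= D &
  forall z, `|Re z| <= B -> 1 <= `|Im z| ->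
  normc (Gamma z) <= D * expR ((e - pi / 2) * `|Im z|).
Proof.
move=> e0; pose M := (Num.truncn B).+1.
have [D D0 hD] := Gamma_decay_right M e0; exists D => // z zB z1.
have BM : B < M%:R by exact: truncnS_gt.
have {zB}[zl zu] : - M%:R <= Re z /\ Re z <= M%:R.
  by apply/andP; rewrite -ler_norml (le_trans zB)// ltW.
have shift j w : Im w = Im z -> 1 <= Re w + j%:R -> Re w <= M%:R + 2 ->
    normc (Gamma w) <= D * expR ((e - pi / 2) * `|Im z|).
  elim: j w => [|j IH] w wz w1 wM.
    rewrite -wz; apply: hD; rewrite ?wM ?andbT; first lra.
    by rewrite wz -normr_gt0; lra.
  have [w1'|w1'] := leP 1 (Re w).
    rewrite -wz; apply: hD; rewrite ?wM ?w1'//.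
    by rewrite wz -normr_gt0; lra.
  have nw : 1 <= normc w by apply: (le_trans z1); rewrite -wz ler_Im.
  have w0 : w != 0 by rewrite -normc_gt0; lra.
  apply: (@le_trans _ _ (normc (Gamma (w + 1)))).
    by rewrite Gamma_step// normcM ler_peMl ?normc_ge0.
  have M0 : 0 <= M%:R :> R by [].
  apply: IH; rewrite !reimE ?addr0//; last lra.
  by move: w1; rewrite -addn1 natrD; lra.
apply: (shift M.+1) => //; last lra.
by rewrite -addn1 natrD; lra.
Qed.

(** To the left of the line [Re z = 1] the recurrence costs a polynomial
    factor, absorbed as in the decay of Gamma. *)
Lemma GammaV_growth B e : 0 < e -> exists2 D, 0 <= D &
  forall z, `|Re z| <= B -> normc (Gamma z)^-1 <= D * expR ((e + pi / 2) * `|Im z|).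
Proof.
move=> e0; pose M := (Num.truncn B).+2.
(* With [M >= 2] the shift by [1] keeps [Re z] in [- M, M] while [Re z < 1]. *)
have BM : B < M%:R by rewrite (lt_trans (truncnS_gt _))// ltr_nat.
have shift j : forall e, 0 < e -> exists2 D, 0 <= D &
  forall z, 1 <= Re z + j%:R -> `|Re z| <= M%:R -> normc (Gamma z)^-1 <= D * expR ((e + pi / 2) * `|Im z|).
  elim: j => [|j IH] {}e {}e0.
    exists (M%:R * expR M%:R) => [|z z1 zM]; first by rewrite mulr_ge0 ?expR_ge0.
    rewrite addr0 in z1; apply: (le_trans (GammaV_le_ge1 z1)).
    have zM' := le_trans (ler_norm _) zM.
    apply: ler_pM; rewrite ?mulr_ge0 ?expR_ge0//; first lra.
      apply: ler_pM => //; rewrite ?expR_ge0 ?ler_expR//; lra.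
    by rewrite ler_expR ler_wpM2r//; lra.
  have e20 : 0 < e / 2 by rewrite divr_gt0.
  have [D D0 hD] := IH _ e20.
  have [D' D'0 hD'] := @lin_le_expR M%:R (e / 2) (ler0n _ _) e20.
  pose D'' := M%:R * expR (M%:R : R).
  have D''0 : 0 <= D'' by rewrite mulr_ge0 ?expR_ge0.
  exists (D' * D + D'') => [|z z1 zM]; first by rewrite addr_ge0 ?mulr_ge0.
  have zM' := le_trans (ler_norm _) zM.
  have [z1'|z1'] := leP 1 (Re z).
    apply: (le_trans (GammaV_le_ge1 z1')); apply: ler_pM; rewrite ?mulr_ge0 ?expR_ge0//; first lra.
      apply: (@le_trans _ _ D''); last by rewrite lerDr mulr_ge0.
      apply: ler_pM => //; rewrite ?expR_ge0 ?ler_expR//; lra.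
    by rewrite ler_expR ler_wpM2r//; lra.
  rewrite GammaV_step normcM.
  have n1 : normc z <= D' * expR (e / 2 * `|Im z|).
    apply: le_trans (hD' _); apply: (le_trans (normc_le_ReIm _)).
    by rewrite lerD2r.
  have n2 : normc (Gamma (z + 1))^-1 <= D * expR ((e / 2 + pi / 2) * `|Im z|).
    have := hD (z + 1); rewrite !reimE addr0; apply.
      by move: z1; rewrite -addn1 natrD; lra.
    have M1 : 2 <= M%:R :> R by rewrite ler_nat.
    by move: zM; rewrite !ler_norml => /andP[? ?]; apply/andP; split; lra.
  apply: (@le_trans _ _ (D' * D * expR ((e + pi / 2) * `|Im z|))).
    have -> : D' * D * expR ((e + pi / 2) * `|Im z|) = (D' * expR (e / 2 * `|Im z|)) * (D * expR ((e / 2 + pi / 2) * `|Im z|)).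
      by rewrite mulrACA -expRD; congr (_ * expR _); field.
    exact: (ler_pM (normc_ge0 _) (normc_ge0 _) n1 n2).
  by rewrite ler_wpM2r ?expR_ge0// lerDl.
have [D D0 hD] := shift M.+1 e e0; exists D => // z zB; apply: hD; last first.
  by rewrite (le_trans zB)// ltW.
have : - Re z <= B by rewrite (le_trans _ zB)// -normrN ler_norm.
by rewrite -addn1 natrD; lra.
Qed.

End GammaStrips.

(** * Integrals of complex functions of a real variable *)

Section ComplexMeasurable.
Context {R : realType} {dsp : measure_display} {T : measurableType dsp}.
Local Notation C := R[i].
Implicit Types (D : set T) (f g : T -> C) (c : C).

Definition cmeas D f : Prop :=
  measurable_fun D (fun y => Re (f y)) /\ measurable_fun D (fun y => Im (f y)).

Lemma cmeas_real D (r : T -> R) : measurable_fun D r -> cmeas D (fun y => (r y)%:C).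
Proof. by move=> mr; split => //=; exact: measurable_cst. Qed.
Lemma cmeas_cst D c : cmeas D (fun=> c).
Proof. by split; exact: measurable_cst. Qed.
Lemma cmeasM D f g : cmeas D f -> cmeas D g -> cmeas D (fun y => f y * g y).
Proof.
move=> [f1 f2] [g1 g2]; split.
- by under eq_fun do rewrite ReM; apply: measurable_funB; exact: measurable_funM.
- by under eq_fun do rewrite ImM; apply: measurable_funD; exact: measurable_funM.
Qed.
Lemma cmeas_cexp D f : cmeas D f -> cmeas D (fun y => cexp (f y)).
Proof.
move=> [f1 f2]; split; apply: measurable_funM.
- by apply: measurableT_comp f1; exact: measurable_expR.
- by apply: measurableT_comp f2; exact: (continuous_measurable_fun (@continuous_cos R)).
- by apply: measurableT_comp f1; exact: measurable_expR.
- by apply: measurableT_comp f2; exact: (continuous_measurable_fun (@continuous_sin R)).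
Qed.
Lemma cmeas_cvg D (f_ : nat -> T -> C) f : (forall n, cmeas D (f_ n)) ->
  (forall y, D y -> ccvg \oo (f_ ^~ y) (f y)) -> cmeas D f.
Proof.
move=> mf cf; split.
- by apply: (measurable_fun_cvg (fun n => (mf n).1)) => y Dy; have [] := cf y Dy.
- by apply: (measurable_fun_cvg (fun n => (mf n).2)) => y Dy; have [] := cf y Dy.
Qed.
End ComplexMeasurable.

Section ComplexIntegral.
Context {R : realType}.
Local Notation C := R[i].
Local Notation mu := (@lebesgue_measure R).
Implicit Types (D : set R) (f g : R -> C) (c : C).

Definition cintg D f : Prop :=
  mu.-integrable D (fun y => (Re (f y))%:E) /\ mu.-integrable D (fun y => (Im (f y))%:E).

Definition cint D f : C :=
  (\int[mu]_(y in D) Re (f y)) +i* (\int[mu]_(y in D) Im (f y)).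

Lemma cintg_cmeas D f : cintg D f -> cmeas D f.
Proof. by move=> [f1 f2]; split; apply/measurable_EFinP; [exact: measurable_int f1|exact: measurable_int f2]. Qed.

Lemma cintg_le D f (g : R -> R) : measurable D -> cmeas D f ->
  mu.-integrable D (EFin \o g) -> (forall y, D y -> normc (f y) <= g y) -> cintg D f.
Proof.
move=> mD [f1 f2] ig fg; split.
- apply: (@le_integrable _ _ _ mu D mD _ (EFin \o g)) => //; first exact/measurable_EFinP.
  move=> y Dy; rewrite /= lee_fin (le_trans (ler_Re _))// (le_trans (fg _ Dy))//.
  exact: ler_norm.
- apply: (@le_integrable _ _ _ mu D mD _ (EFin \o g)) => //; first exact/measurable_EFinP.
  move=> y Dy; rewrite /= lee_fin (le_trans (ler_Im _))// (le_trans (fg _ Dy))//.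
  exact: ler_norm.
Qed.

Lemma cintg_normc D f : measurable D -> cintg D f -> mu.-integrable D (fun y => (normc (f y))%:E).
Proof.
move=> mD fi; have [m1 m2] := cintg_cmeas fi; have [f1 f2] := fi.
have h1 : mu.-integrable D (EFin \o (fun y => `|Re (f y)|)) by apply: integrable_norm.
have h2 : mu.-integrable D (EFin \o (fun y => `|Im (f y)|)) by apply: integrable_norm.
have h : mu.-integrable D (fun y => (`|Re (f y)|)%:E + (`|Im (f y)|)%:E)%E by exact: integrableD.
apply: le_integrable h => //.
  apply/measurable_EFinP.
  under eq_fun do rewrite normcE2.
  have m : measurable_fun D (fun y => Re (f y) ^+ 2 + Im (f y) ^+ 2).
    by apply: measurable_funD; apply: measurable_funX.
  apply: measurableT_comp m.
  by apply: continuous_measurable_fun; exact: sqrt_continuous.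
move=> y Dy /=; rewrite lee_fin ger0_norm ?normc_ge0//.
by rewrite ger0_norm ?addr_ge0// normc_le_ReIm.
Qed.

(** The real and imaginary parts are estimated separately, hence the factor
    [2]. *)
Lemma cint_normc_le D f (g : R -> R) : measurable D -> cmeas D f ->
  mu.-integrable D (EFin \o g) -> (forall y, D y -> normc (f y) <= g y) ->
  normc (cint D f) <= 2 * \int[mu]_(y in D) g y.
Proof.
move=> mD mf ig fg; have [f1 f2] := cintg_le mD mf ig fg.
apply: (le_trans (normc_le_ReIm _)); rewrite mulr_natl mulr2n; apply: lerD => /=.
- apply: le_trans; first exact: le_normr_Rintegral.
  apply: le_Rintegral => //; first exact: integrable_norm.
  by move=> y Dy; rewrite (le_trans (ler_Re _))// fg.
- apply: le_trans; first exact: le_normr_Rintegral.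
  apply: le_Rintegral => //; first exact: integrable_norm.
  by move=> y Dy; rewrite (le_trans (ler_Im _))// fg.
Qed.

Lemma cintgD D f g : measurable D -> cintg D f -> cintg D g -> cintg D (fun y => f y + g y).
Proof.
move=> mD [f1 f2] [g1 g2]; split.
- under eq_fun do rewrite ReD EFinD; exact: integrableD.
- under eq_fun do rewrite ImD EFinD; exact: integrableD.
Qed.

Lemma cintgZ D f c : measurable D -> cintg D f -> cintg D (fun y => c * f y).
Proof.
move=> mD [f1 f2]; split.
- under eq_fun do rewrite ReM EFinB !EFinM; apply: integrableB => //; exact: integrableZl.
- under eq_fun do rewrite ImM EFinD !EFinM; apply: integrableD => //; exact: integrableZl.
Qed.

Lemma cintgN D f : measurable D -> cintg D f -> cintg D (fun y => - f y).
Proof. by move=> mD fi; under eq_fun do rewrite -mulN1r; exact: cintgZ. Qed.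

Lemma cintD D f g : measurable D -> cintg D f -> cintg D g ->
  cint D (fun y => f y + g y) = cint D f + cint D g.
Proof.
move=> mD [f1 f2] [g1 g2]; apply: complex_ext; rewrite ?(ReD, ImD) /=.
- by rewrite -RintegralD//; apply: eq_Rintegral => y _; rewrite ReD.
- by rewrite -RintegralD//; apply: eq_Rintegral => y _; rewrite ImD.
Qed.

Lemma cintZ D f c : measurable D -> cintg D f -> cint D (fun y => c * f y) = c * cint D f.
Proof.
move=> mD [f1 f2]; apply: complex_ext; rewrite ?(ReM, ImM) /=.
- rewrite -!RintegralZl// -RintegralB//.
  + by apply: eq_Rintegral => y _; rewrite ReM.
  + by rewrite /comp; under eq_fun do rewrite EFinM; exact: integrableZl.
  + by rewrite /comp; under eq_fun do rewrite EFinM; exact: integrableZl.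
- rewrite -!RintegralZl// -RintegralD//.
  + by apply: eq_Rintegral => y _; rewrite ImM.
  + by rewrite /comp; under eq_fun do rewrite EFinM; exact: integrableZl.
  + by rewrite /comp; under eq_fun do rewrite EFinM; exact: integrableZl.
Qed.

Lemma cintB D f g : measurable D -> cintg D f -> cintg D g ->
  cint D (fun y => f y - g y) = cint D f - cint D g.
Proof.
move=> mD fi gi; rewrite cintD//; last exact: cintgN.
congr (_ + _); rewrite -mulN1r -cintZ//; congr cint.
by apply/funext => y; rewrite mulN1r.
Qed.

Lemma eq_cint D f g : (forall y, D y -> f y = g y) -> cint D f = cint D g.
Proof.
move=> fg; apply: complex_ext => /=;
  by apply: eq_Rintegral => y; rewrite inE => Dy; rewrite fg.
Qed.

Lemma eq_cintg D f g : measurable D -> (forall y, D y -> f y = g y) -> cintg D f -> cintg D g.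
Proof.
move=> mD fg [f1 f2]; split.
- by apply: eq_integrable f1 => // y; rewrite inE => Dy; rewrite fg.
- by apply: eq_integrable f2 => // y; rewrite inE => Dy; rewrite fg.
Qed.

Lemma Rintegral_dct D (f_ : nat -> R -> R) (f g : R -> R) : measurable D ->
  (forall n, measurable_fun D (f_ n)) ->
  (forall y, D y -> f_ n y @[n --> \oo] --> f y) ->
  mu.-integrable D (EFin \o g) ->
  (forall n y, D y -> `|f_ n y| <= g y) ->
  (\int[mu]_(y in D) f_ n y) @[n --> \oo] --> \int[mu]_(y in D) f y.
Proof.
move=> mD mf cf ig fg.
have mlim : measurable_fun D f by exact: (measurable_fun_cvg mf).
have [||||||i1 _ i3] := @dominated_convergence _ _ _ mu D _ (fun n x => (f_ n x)%:E)
  (EFin \o f) (EFin \o g).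
- by [].
- by move=> n; apply/measurable_EFinP; exact: mf.
- exact/measurable_EFinP.
- by apply: aeW => y Dy; apply: cvg_EFin; [exact: nearW|exact: cf].
- by [].
- by apply: aeW => y n Dy; rewrite lee_fin fg.
apply: fine_cvg; rewrite /Rintegral fineK; first exact: i3.
exact: integrable_fin_num.
Qed.

Lemma cint_dct D (f_ : nat -> R -> C) f (g : R -> R) : measurable D ->
  (forall n, cmeas D (f_ n)) ->
  (forall y, D y -> ccvg \oo (f_ ^~ y) (f y)) ->
  mu.-integrable D (EFin \o g) ->
  (forall n y, D y -> normc (f_ n y) <= g y) ->
  ccvg \oo (fun n => cint D (f_ n)) (cint D f).
Proof.
move=> mD mf cf ig fg; split => /=.
- apply: (@Rintegral_dct D (fun n y => Re (f_ n y)) (fun y => Re (f y)) g) => //.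
  + by move=> n; have [] := mf n.
  + by move=> y Dy; have [] := cf y Dy.
  + by move=> n y Dy; rewrite (le_trans (ler_Re _))// fg.
- apply: (@Rintegral_dct D (fun n y => Im (f_ n y)) (fun y => Im (f y)) g) => //.
  + by move=> n; have [] := mf n.
  + by move=> y Dy; have [] := cf y Dy.
  + by move=> n y Dy; rewrite (le_trans (ler_Im _))// fg.
Qed.

End ComplexIntegral.

(** * Complex differentiability *)

Section Holomorphic.
Context {R : realType}.
Local Notation C := R[i].
Local Notation mu := (@lebesgue_measure R).
Implicit Types (z w d : C) (f g : C -> C).

(** Quantifying over filters makes the composition with paths, and with
    functions of several variables, immediate. *)
Definition pcont g z : Prop :=
  forall (T : Type) (F : set_system T), Filter F -> forall p : T -> C,
  ccvg F p z -> ccvg F (fun t => g (p t)) (g z).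

(** Caratheodory's form of complex differentiability: increments factor
    through a function that is continuous at the point, so that the rules of
    differentiation involve no division. *)
Definition cara f z d : Prop := exists phi : C -> C,
  [/\ phi z = d, pcont phi z &
    forall (T : Type) (F : set_system T), Filter F -> forall p : T -> C, ccvg F p z ->
    \forall t \near F, f (p t) - f z = phi (p t) * (p t - z)].

(** The derivative is required to be continuous, as differentiation under the
    integral sign will need. *)
Definition holo (U : set C) f : Prop := exists f' : C -> C,
  forall z, U z -> cara f z (f' z) /\ pcont f' z.

Lemma pcont_cst c z : pcont (fun=> c) z.
Proof. by move=> T F FF p pz; exact: ccvg_cst. Qed.
Lemma pcont_id z : pcont id z. Proof. by []. Qed.
Lemma pcontD f g z : pcont f z -> pcont g z -> pcont (fun w => f w + g w) z.
Proof. by move=> cf cg T F FF p pz; apply: ccvgD; [exact: cf|exact: cg]. Qed.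
Lemma pcontN f z : pcont f z -> pcont (fun w => - f w) z.
Proof. by move=> cf T F FF p pz; apply: ccvgN; exact: cf. Qed.
Lemma pcontM f g z : pcont f z -> pcont g z -> pcont (fun w => f w * g w) z.
Proof. by move=> cf cg T F FF p pz; apply: ccvgM; [exact: cf|exact: cg]. Qed.
Lemma pcontV f z : f z != 0 -> pcont f z -> pcont (fun w => (f w)^-1) z.
Proof. by move=> f0 cf T F FF p pz; apply: ccvgV => //; exact: cf. Qed.
Lemma pcont_cexp f z : pcont f z -> pcont (fun w => cexp (f w)) z.
Proof. by move=> cf T F FF p pz; apply: ccvg_cexp; exact: cf. Qed.
Lemma pcont_affine a b z : pcont (fun w => a * w + b) z.
Proof. by apply: pcontD; [apply: pcontM; [exact: pcont_cst|]|exact: pcont_cst]. Qed.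
Lemma pcont_comp f g z : pcont g z -> pcont f (g z) -> pcont (fun w => f (g w)) z.
Proof. by move=> cg cf T F FF p pz; apply: cf; exact: cg. Qed.

Lemma cara_pcont f z d : cara f z d -> pcont f z.
Proof.
move=> [phi [phiz cphi nphi]] T F FF p pz.
have h : ccvg F (fun t => phi (p t) * (p t - z) + f z) (phi z * (z - z) + f z).
  apply: ccvgD; last exact: ccvg_cst.
  by apply: ccvgM; [exact: cphi|apply: ccvgB => //; exact: ccvg_cst].
rewrite subrr mulr0 add0r in h; apply: ccvg_near h.
by have := nphi T F FF p pz; apply: filterS => t <-; rewrite subrK.
Qed.

Lemma cara_cst c z : cara (fun=> c) z 0.
Proof.
exists (fun=> 0); split=> //; first exact: pcont_cst.
by move=> T F FF p pz; apply: nearW => t; rewrite subrr mul0r.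
Qed.

Lemma cara_affine a b z : cara (fun w => a * w + b) z a.
Proof.
exists (fun=> a); split=> //; first exact: pcont_cst.
by move=> T F FF p pz; apply: nearW => t; ring.
Qed.

Lemma caraM f g z d e : cara f z d -> cara g z e ->
  cara (fun w => f w * g w) z (d * g z + f z * e).
Proof.
move=> cf cg; have gc := cara_pcont cg.
case: cf => [phi [phiz cphi nphi]]; case: cg => [psi [psiz cpsi npsi]].
exists (fun w => phi w * g w + f z * psi w); split; first by rewrite phiz psiz.
- by apply: pcontD; apply: pcontM => //; exact: pcont_cst.
- move=> T F FF p pz; have h1 := nphi T F FF p pz; have h2 := npsi T F FF p pz.
  refine (filterS2 _ _ h1 h2) => t {}h1 {}h2.
  have -> : f (p t) * g (p t) - f z * g z = (f (p t) - f z) * g (p t) + f z * (g (p t) - g z) by ring.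
  by rewrite h1 h2; ring.
Qed.

Lemma caraB f g z d e : cara f z d -> cara g z e ->
  cara (fun w => f w - g w) z (d - e).
Proof.
case=> [phi [phiz cphi nphi]]; case=> [psi [psiz cpsi npsi]].
exists (fun w => phi w - psi w); split; first by rewrite phiz psiz.
- by apply: pcontD => //; exact: pcontN.
- move=> T F FF p pz; have h1 := nphi T F FF p pz; have h2 := npsi T F FF p pz.
  refine (filterS2 _ _ h1 h2) => t {}h1 {}h2.
  have -> : f (p t) - g (p t) - (f z - g z) = (f (p t) - f z) - (g (p t) - g z) by ring.
  by rewrite h1 h2; ring.
Qed.

Lemma caraV f z d : f z != 0 -> cara f z d ->
  cara (fun w => (f w)^-1) z (- (d / f z ^+ 2)).
Proof.
move=> f0 cf; have fc := cara_pcont cf.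
case: cf => [phi [phiz cphi nphi]].
exists (fun w => - (phi w / (f w * f z))); split; first by rewrite phiz expr2.
- apply: pcontN; apply: pcontM => //; apply: pcontV; first by rewrite mulf_neq0.
  by apply: pcontM => //; exact: pcont_cst.
- move=> T F FF p pz; have h1 := nphi T F FF p pz.
  have h2 : \forall t \near F, f (p t) != 0 by exact: ccvg_near_neq0 f0 (fc T F FF p pz).
  refine (filterS2 _ _ h1 h2) => t {}h1 {}h2.
  have -> : (f (p t))^-1 - (f z)^-1 = - ((f (p t) - f z) / (f (p t) * f z)).
    by field; rewrite h2 f0.
  by rewrite h1; ring.
Qed.

Lemma cara_comp_affine f a b z d : cara f (a * z + b) d ->
  cara (fun w => f (a * w + b)) z (d * a).
Proof.
case=> [phi [phiz cphi nphi]].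
exists (fun w => phi (a * w + b) * a); split; first by rewrite phiz.
- apply: pcontM; last exact: pcont_cst.
  by apply: (@pcont_comp phi (fun w => a * w + b)) => //; exact: pcont_affine.
- move=> T F FF p pz.
  have h1 := nphi T F FF (fun t => a * p t + b) (pcont_affine a b FF pz).
  by apply: filterS h1 => t ->; ring.
Qed.

Lemma cara_near f g z d :
  (forall (T : Type) (F : set_system T), Filter F -> forall p : T -> C, ccvg F p z ->
    \forall t \near F, f (p t) = g (p t)) -> f z = g z ->
  cara f z d -> cara g z d.
Proof.
move=> fg fgz [phi [phiz cphi nphi]]; exists phi; split=> // T F FF p pz.
have h1 := nphi T F FF p pz; have h2 := fg T F FF p pz.
by apply: filterS2 h1 h2 => t h1 h2; rewrite -fgz -h2.
Qed.

Lemma pcont_near f g z :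
  (forall (T : Type) (F : set_system T), Filter F -> forall p : T -> C, ccvg F p z ->
    \forall t \near F, f (p t) = g (p t)) -> f z = g z ->
  pcont f z -> pcont g z.
Proof.
move=> fg fgz cf T F FF p pz; rewrite -fgz.
by apply: ccvg_near (cf T F FF p pz); exact: fg.
Qed.

Lemma cara_cexp z : cara cexp z (cexp z).
Proof.
exists (fun w => if w == z then cexp z else (cexp w - cexp z) / (w - z)); split.
- by rewrite eqxx.
- move=> T F FF p pz; rewrite eqxx.
  have hz : ccvg F (fun t => p t - z) 0.
    by rewrite -(subrr z); apply: ccvgB => //; exact: ccvg_cst.
  have hn : normc (p t - z) @[t --> F] --> (0 : R) by rewrite -(normc0 R); exact: ccvg_normc.
  apply: (@ccvg_of_normc _ _ _ _ _ _ (fun t => normc (cexp z) * 9 * normc (p t - z))); last first.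
    by rewrite -(mulr0 (normc (cexp z) * 9)); apply: cvgMr.
  have h2 : \forall t \near F, `|normc (p t - z)| <= 2^-1.
    by apply: cvgr0_norm_le => //; rewrite invr_gt0.
  apply: filterS h2 => t; rewrite ger0_norm ?normc_ge0// => pt2.
  case: eqVneq => [->|pz0]; first by rewrite !subrr normc0 mulr0.
  have d0 : p t - z != 0 by rewrite subr_eq0.
  have -> : (cexp (p t) - cexp z) / (p t - z) - cexp z =
      cexp z * ((cexp (p t - z) - 1 - (p t - z)) / (p t - z)).
    have -> : cexp (p t) = cexp (p t - z) * cexp z by rewrite -cexpD subrK.
    by move: (cexp (p t - z)) => u; field.
  rewrite normcM -mulrA ler_wpM2l ?normc_ge0// normcM normcV ler_pdivrMr ?normc_gt0//.
  by rewrite -mulrA -expr2; exact: cexp_quad.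
- move=> T F FF p pz; apply: nearW => t.
  by case: eqVneq => [->|pz0]; rewrite ?subrr ?mulr0// divfK// subr_eq0.
Qed.

Lemma holo_cst U c : holo U (fun=> c).
Proof. by exists (fun=> 0) => z _; split; [exact: cara_cst|exact: pcont_cst]. Qed.
Lemma holo_affine U a b : holo U (fun w => a * w + b).
Proof. by exists (fun=> a) => z _; split; [exact: cara_affine|exact: pcont_cst]. Qed.
Lemma holo_cexp_affine U a b : holo U (fun w => cexp (a * w + b)).
Proof.
exists (fun w => cexp (a * w + b) * a) => z _; split.
- by apply: cara_comp_affine; exact: cara_cexp.
- by apply: pcontM; [apply: pcont_cexp; exact: pcont_affine|exact: pcont_cst].
Qed.
Lemma holoM U f g : holo U f -> holo U g -> holo U (fun w => f w * g w).
Proof.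
move=> [f' hf] [g' hg]; exists (fun w => f' w * g w + f w * g' w) => z Uz.
have [cf pf] := hf z Uz; have [cg pg] := hg z Uz; split; first exact: caraM.
by apply: pcontD; apply: pcontM => //; [exact: cara_pcont cg|exact: cara_pcont cf].
Qed.
Lemma holoB U f g : holo U f -> holo U g -> holo U (fun w => f w - g w).
Proof.
move=> [f' hf] [g' hg]; exists (fun w => f' w - g' w) => z Uz.
have [cf pf] := hf z Uz; have [cg pg] := hg z Uz; split; first exact: caraB.
by apply: pcontD => //; exact: pcontN.
Qed.
Lemma holoV U f : (forall z, U z -> f z != 0) -> holo U f -> holo U (fun w => (f w)^-1).
Proof.
move=> f0 [f' hf]; exists (fun w => - (f' w / f w ^+ 2)) => z Uz.
have [cf pf] := hf z Uz; split; first by apply: caraV => //; exact: f0.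
apply: pcontN; apply: pcontM => //; apply: pcontV; first by rewrite expf_eq0/= f0.
by rewrite /GRing.exp/=; apply: pcontM; exact: cara_pcont cf.
Qed.
Lemma holo_prod U n (f_ : nat -> C -> C) : (forall k, holo U (f_ k)) ->
  holo U (fun w => \prod_(k < n) f_ k w).
Proof.
move=> hf; elim: n => [|n IH].
  by under eq_fun do rewrite big_ord0; exact: holo_cst.
by under eq_fun do rewrite big_ord_recr/=; exact: holoM.
Qed.
Lemma holoS U V f : U `<=` V -> holo V f -> holo U f.
Proof. by move=> UV [f' hf]; exists f' => z /UV; exact: hf. Qed.
Lemma holo_pcont U f z : holo U f -> U z -> pcont f z.
Proof. by move=> [f' hf] /hf[cf _]; exact: cara_pcont cf. Qed.

Definition cdiff (p : R -> C) (y : R) (e : C) : Prop :=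
  is_derive y (1:R) (fun t => Re (p t)) (Re e) /\
  is_derive y (1:R) (fun t => Im (p t)) (Im e).

Lemma is_derive_quot (f : R -> R) (x a : R) : is_derive x (1:R) f a <->
  h^-1 * (f (h + x) - f x) @[h --> (0:R)^'] --> a.
Proof.
have E : (fun h : R => h^-1 *: ((f \o shift x) (h *: (1:R)) - f x)) =
    (fun h => h^-1 * (f (h + x) - f x)).
  by apply/funext => h; rewrite /GRing.scale/= mulr1.
split.
- move=> [df fa]; move: df; rewrite /derivable E => /cvg_ex[l hl].
  suff -> : a = l by [].
  by rewrite -fa /derive E; exact: cvg_lim hl.
- move=> h; apply: DeriveDef; first by apply/cvg_ex; exists a; rewrite E.
  by rewrite /derive E; exact: cvg_lim h.
Qed.

Lemma cdiff_quot (p : R -> C) (y : R) (e : C) : cdiff p y e <->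
  ccvg (0:R)^' (fun h => (h^-1)%:C * (p (h + y) - p y)) e.
Proof.
have E h : Re ((h^-1)%:C * (p (h + y) - p y)) = h^-1 * (Re (p (h + y)) - Re (p y)).
  by rewrite !reimE/=; ring.
have F h : Im ((h^-1)%:C * (p (h + y) - p y)) = h^-1 * (Im (p (h + y)) - Im (p y)).
  by rewrite !reimE/=; ring.
rewrite /ccvg; under eq_fun do rewrite E; under [in X in _ /\ X]eq_fun do rewrite F.
split=> [[h1 h2]|[h1 h2]]; split.
- by move/is_derive_quot : h1.
- by move/is_derive_quot : h2.
- by apply/is_derive_quot.
- by apply/is_derive_quot.
Qed.

Lemma cdiff_ccvg (p : R -> C) (y : R) (e : C) : cdiff p y e ->
  ccvg (0:R)^' (fun h => p (h + y)) (p y).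
Proof.
move/cdiff_quot => h.
have h0 : ccvg (0:R)^' (fun t : R => t%:C) 0.
  by apply: ccvg_real; exact: cvg_within_filter.
have h1 : ccvg (0:R)^' (fun t : R => t%:C * ((t^-1)%:C * (p (t + y) - p y)) + p y) (p y).
  rewrite -[X in ccvg _ _ X]add0r -(mul0r e).
  by apply: ccvgD; [exact: ccvgM|exact: ccvg_cst].
apply: ccvg_near h1.
near=> t; have t0 : t != 0 by near: t; exact: nbhs_dnbhs_neq.
rewrite mulrA -rmorphM/= divff// mul1r subrK.
by [].
Unshelve. all: by end_near. Qed.

Lemma cara_chain f (p : R -> C) (y : R) d e : cara f (p y) d -> cdiff p y e ->
  cdiff (fun t => f (p t)) y (d * e).
Proof.
move=> [phi [phiz cphi nphi]] pe.
have pc := cdiff_ccvg pe; move/cdiff_quot : pe => pe; apply/cdiff_quot.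
have h1 : ccvg (0:R)^' (fun h => phi (p (h + y)) * ((h^-1)%:C * (p (h + y) - p y))) (d * e).
  by rewrite -phiz; apply: ccvgM pe; exact: cphi.
apply: ccvg_near h1.
have h2 : \forall h \near (0:R)^', f (p (h + y)) - f (p y) =
    phi (p (h + y)) * (p (h + y) - p y) by exact: nphi.
apply: filterS h2 => h ->.
by rewrite mulrCA.
Qed.

Lemma cdiffM (p q : R -> C) (y : R) d e : cdiff p y d -> cdiff q y e ->
  cdiff (fun t => p t * q t) y (d * q y + p y * e).
Proof.
move=> [p1 p2] [q1 q2]; split.
- under eq_fun do rewrite ReM.
  apply: rder_eq (rderB (rderM p1 q1) (rderM p2 q2)) _; rewrite !reimE; ring.
- under eq_fun do rewrite ImM.
  apply: rder_eq (rderD (rderM p1 q2) (rderM p2 q1)) _; rewrite !reimE; ring.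
Qed.

Lemma cdiff_real (r : R -> R) (y a : R) : is_derive y (1:R) r a -> cdiff (fun t => (r t)%:C) y a%:C.
Proof. by move=> ra; split => //=; exact: rder_cst. Qed.

End Holomorphic.

(** * Cauchy's theorem for swept regions *)

Section CauchyTheorem.
Context {R : realType}.
Local Notation C := R[i].
Local Notation mu := (@lebesgue_measure R).
Implicit Types (a b x y l : R).

(** Composing with this retraction turns a function on a segment into one on
    the whole line, whose continuity is a pointwise matter. *)
Definition clip a b y : R := Num.max a (Num.min b y).

Lemma clip_in a b y : a <= b -> a <= clip a b y <= b.
Proof.
by move=> ab; rewrite /clip le_max lexx/= ge_max ab/= ge_min lexx.
Qed.
Lemma clip_id a b y : a <= y <= b -> clip a b y = y.
Proof. by move=> /andP[ay yb]; rewrite /clip min_r// max_r. Qed.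
Lemma clip_cvg a b y : clip a b t @[t --> y] --> clip a b y.
Proof.
apply: (@continuous_max _ R (fun=> a) (fun t => Num.min b t)); first exact: cvg_cst.
by apply: (@continuous_min _ R (fun=> b) id); [exact: cvg_cst|exact: cvg_id].
Qed.

Lemma clip_cvg_comp T (F : set_system T) (p : T -> R) a b y : p t @[t --> F] --> y ->
  clip a b (p t) @[t --> F] --> clip a b y.
Proof. by move=> py; apply: cvg_comp py _; exact: clip_cvg. Qed.

(** Continuity of [u] on the segment from [a] to [b]. *)
Definition seg_cont a b (u : R -> C) : Prop :=
  forall y, ccvg (nbhs y) (fun t => u (clip a b t)) (u (clip a b y)).

Lemma seg_cont_continuous a b (u : R -> C) : seg_cont a b u ->
  continuous (fun t => Re (u (clip a b t))) /\ continuous (fun t => Im (u (clip a b t))).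
Proof. by move=> cu; split => y; have [] := cu y. Qed.

Lemma seg_cont_within a b (u : R -> C) : seg_cont a b u ->
  {within `[a, b], continuous (fun y => Re (u y))} /\
  {within `[a, b], continuous (fun y => Im (u y))}.
Proof.
move=> /seg_cont_continuous[c1 c2]; split.
- apply: (subspace_eq_continuous (f := fun t => Re (u (clip a b t)))).
    by move=> y; rewrite inE/= in_itv/= => yab; rewrite clip_id.
  exact: continuous_subspaceT.
- apply: (subspace_eq_continuous (f := fun t => Im (u (clip a b t)))).
    by move=> y; rewrite inE/= in_itv/= => yab; rewrite clip_id.
  exact: continuous_subspaceT.
Qed.

Lemma seg_cintg a b (u : R -> C) : seg_cont a b u -> cintg `[a, b] u.
Proof.
move=> /seg_cont_within[c1 c2]; split.
- by apply: continuous_compact_integrable => //; exact: segment_compact.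
- by apply: continuous_compact_integrable => //; exact: segment_compact.
Qed.

Lemma rect_bounded (q : R -> R -> C) a b c d :
  (forall s : R * R, ccvg (nbhs s) (fun t => q (clip a b t.1) (clip c d t.2))
     (q (clip a b s.1) (clip c d s.2))) ->
  exists2 M, 0 <= M & forall l y, a <= l <= b -> c <= y <= d -> normc (q l y) <= M.
Proof.
move=> cq; pose h (t : R * R) : R^o := normc (q (clip a b t.1) (clip c d t.2)).
have ch : continuous h by move=> s; apply: ccvg_normc; exact: cq.
have cK : compact (`[a, b]%classic `*` `[c, d]%classic : set (R * R)%type).
  by apply: compact_setX; exact: segment_compact.
have cI : compact [set h t | t in (`[a, b]%classic `*` `[c, d]%classic : set (R * R)%type)].
  by apply: continuous_compact => //; exact: continuous_subspaceT.
have [M M0 hM] := pinfty_ex_gt0 (compact_bounded cI).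
exists M; first exact: ltW.
move=> l y lab ycd; have := hM (h (l, y)).
rewrite /h/= !clip_id// ger0_norm ?normc_ge0//; apply.
by exists (l, y); [split; rewrite /= in_itv|rewrite /h/= !clip_id].
Qed.

(** The Newton-Leibniz formula. *)
Lemma cint_FTC a b (F f : R -> C) : a < b -> seg_cont a b f -> seg_cont a b F ->
  (forall y, a < y < b -> cdiff F y (f y)) -> cint `[a, b] f = F b - F a.
Proof.
move=> ab cf cF dF.
have [f1 f2] := seg_cont_within cf; have [F1 F2] := seg_cont_within cF.
have E (g G : R -> R) : {within `[a, b], continuous g} -> {within `[a, b], continuous G} ->
    (forall y, a < y < b -> is_derive y (1:R) G (g y)) ->
    \int[mu]_(y in `[a, b]) g y = G b - G a.
  move=> cg cG dG; rewrite /Rintegral (@continuous_FTC2 _ g G)//.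
  - have [h1 h2 h3] := (continuous_within_itvP G ab).1 cG.
    split=> // y; rewrite in_itv/= => yab.
    by have [] := dG y yab.
  - by move=> y; rewrite in_itv/= => yab; rewrite derive1E; have [_ ->] := dG y yab.
apply: complex_ext; rewrite ?(ReD, ImD, ReN, ImN)/=.
- by apply: (E (fun y => Re (f y)) (fun y => Re (F y))) => // y yab; have [] := dF y yab.
- by apply: (E (fun y => Im (f y)) (fun y => Im (F y))) => // y yab; have [] := dF y yab.
Qed.

Lemma cdiff_under_integral (g g' : R -> R -> C) (u v y0 M : R) : u < y0 < v ->
  (forall y, u < y < v -> cintg `[0, 1] (g y)) ->
  (forall y l, u < y < v -> 0 <= l <= 1 -> cdiff (g ^~ l) y (g' y l)) ->
  (forall y l, u < y < v -> 0 <= l <= 1 -> normc (g' y l) <= M) ->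
  cdiff (fun y => cint `[0, 1] (g y)) y0 (cint `[0, 1] (g' y0)).
Proof.
move=> uyv ig dg gM.
have M0 : 0 <= M by apply: le_trans (normc_ge0 _) (gM y0 0 uyv _); rewrite lexx ler01.
have E (f f' : R -> R -> R) :
    (forall y, u < y < v -> mu.-integrable `[0, 1] (fun l => (f y l)%:E)) ->
    (forall y l, u < y < v -> 0 <= l <= 1 -> is_derive y (1:R) (f ^~ l) (f' y l)) ->
    (forall y l, u < y < v -> 0 <= l <= 1 -> `|f' y l| <= M) ->
    is_derive y0 (1:R) (fun y => \int[mu]_(l in `[0, 1]) f y l) (\int[mu]_(l in `[0, 1]) f' y0 l).
  move=> int df fM.
  have I0 : `]u, v[%classic y0 by rewrite /= in_itv.
  have i1 x : `]u, v[%classic x -> mu.-integrable `[0, 1] (EFin \o f x).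
    by rewrite /= in_itv/=; exact: int.
  have i2 x l : `]u, v[%classic x -> `[0, 1]%classic l -> derivable (f ^~ l) x 1.
    by rewrite /= !in_itv/= => xuv l01; have [] := df x l xuv l01.
  have i3 : mu.-integrable `[0, 1] (EFin \o cst M).
    apply: continuous_compact_integrable; first exact: segment_compact.
    by apply: continuous_subspaceT => x; exact: cvg_cst.
  have i4 x l : `]u, v[%classic x -> `[0, 1]%classic l -> `|partial1of2 f x l| <= cst M l.
    rewrite /= !in_itv/= => xuv l01; rewrite partial1of2E.
    by have [_ ->] := df x l xuv l01; exact: fM.
  apply: DeriveDef.
  - by apply: (@derivable_under_integral _ _ _ mu f `[0, 1] _ y0 u v I0 i1 i2 (cst M)).
  - rewrite -derive1E (@differentiation_under_integral _ _ _ mu f `[0, 1] _ y0 u v I0 i1 i2 (cst M))//.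
    apply: eq_Rintegral => l; rewrite inE/= in_itv/= => l01.
    by rewrite partial1of2E; have [_ ->] := df y0 l uyv l01.
split => /=.
- apply: (E (fun y l => Re (g y l)) (fun y l => Re (g' y l))).
  + by move=> y /ig[].
  + by move=> y l yuv l01; have [] := dg y l yuv l01.
  + by move=> y l yuv l01; apply: (le_trans (ler_Re _)); exact: gM.
- apply: (E (fun y l => Im (g y l)) (fun y l => Im (g' y l))).
  + by move=> y /ig[].
  + by move=> y l yuv l01; have [] := dg y l yuv l01.
  + by move=> y l yuv l01; apply: (le_trans (ler_Im _)); exact: gM.
Qed.

Lemma seg_cont_under_integral (g : R -> R -> C) a b M : a <= b ->
  (forall y, a <= y <= b -> cintg `[0, 1] (g y)) ->
  (forall l, 0 <= l <= 1 -> seg_cont a b (g ^~ l)) ->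
  (forall y l, a <= y <= b -> 0 <= l <= 1 -> normc (g y l) <= M) ->
  seg_cont a b (fun y => cint `[0, 1] (g y)).
Proof.
move=> ab ig cg gM y0.
have E (f : R -> R -> R) :
    (forall y, a <= y <= b -> mu.-integrable `[0, 1] (fun l => (f y l)%:E)) ->
    (forall l, 0 <= l <= 1 -> continuous (fun y => f (clip a b y) l)) ->
    (forall y l, a <= y <= b -> 0 <= l <= 1 -> `|f y l| <= M) ->
    (\int[mu]_(l in `[0, 1]) f (clip a b y) l) @[y --> y0] -->
      \int[mu]_(l in `[0, 1]) f (clip a b y0) l.
  move=> int cf fM.
  apply: (@continuity_under_integral _ _ _ mu (fun y l => f (clip a b y) l) `[0, 1] _
    (y0 - 1) (y0 + 1) _ _ (cst M)) => //.
  - by move=> x _; apply: int; exact: clip_in.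
  - by apply: aeW => l; rewrite /= in_itv/= => l01 x _; exact: cf.
  - apply: continuous_compact_integrable; first exact: segment_compact.
    by apply: continuous_subspaceT => x; exact: cvg_cst.
  - by move=> x _; apply: aeW => l; rewrite /= in_itv/= => l01; apply: fM => //; exact: clip_in.
  - by rewrite inE/= in_itv/=; apply/andP; split; lra.
split => /=.
- apply: (E (fun y l => Re (g y l))).
  + by move=> y /ig[].
  + by move=> l l01; have [] := seg_cont_continuous (cg l l01).
  + by move=> y l yab l01; apply: (le_trans (ler_Re _)); exact: gM.
- apply: (E (fun y l => Im (g y l))).
  + by move=> y /ig[].
  + by move=> l l01; have [] := seg_cont_continuous (cg l l01).
  + by move=> y l yab l01; apply: (le_trans (ler_Im _)); exact: gM.
Qed.

Section Strip.
Variables (f f' : C -> C) (sigma sigma' : R -> R) (x0 a b : R).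
Hypothesis ab : a < b.
Hypothesis dsigma : forall y, is_derive y (1:R) sigma (sigma' y).
Hypothesis csigma' : continuous sigma'.

(** The point at height [y] which is a fraction [l] of the way from the line
    [Re s = x0] to the curve [Re s = sigma (Im s)]. *)
Definition sweep l y : C := (x0 + l * (sigma y - x0)) +i* y.

Hypothesis fin : forall l y, 0 <= l <= 1 -> a < y < b ->
  cara f (sweep l y) (f' (sweep l y)) /\ pcont f' (sweep l y).
Hypothesis fcl : forall l y, 0 <= l <= 1 -> a <= y <= b -> pcont f (sweep l y).

Let csigma : continuous sigma.
Proof.
by move=> y; apply: differentiable_continuous; apply/derivable1_diffP; have [] := dsigma y.
Qed.

Lemma sweep_ccvg T (F : set_system T) {FF : Filter F} (p q : T -> R) l y :
  p t @[t --> F] --> l -> q t @[t --> F] --> y ->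
  ccvg F (fun t => sweep (p t) (q t)) (sweep l y).
Proof.
move=> pl qy; apply: ccvg_reim => //; apply: cvgD; first exact: cvg_cst.
apply: cvgM => //; apply: cvgB; last exact: cvg_cst.
by apply: cvg_comp qy _; exact: csigma.
Qed.

Let g y l : C := f (sweep l y) * (sigma y - x0)%:C.
Let g' y l : C := f' (sweep l y) * ((l * sigma' y) +i* 1) * (sigma y - x0)%:C +
  f (sweep l y) * (sigma' y)%:C.

Let gcv T (F : set_system T) (FF : Filter F) (p q : T -> R) l y :
  0 <= l <= 1 -> a <= y <= b ->
  p t @[t --> F] --> l -> q t @[t --> F] --> y ->
  ccvg F (fun t => g (q t) (p t)) (g y l).
Proof.
move=> l01 yab pl qy; apply: ccvgM; first by apply: fcl => //; exact: sweep_ccvg.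
apply: ccvg_real; apply: cvgB; last exact: cvg_cst.
by apply: cvg_comp qy _; exact: csigma.
Qed.

Let g'cv T (F : set_system T) (FF : Filter F) (p q : T -> R) l y :
  0 <= l <= 1 -> a < y < b ->
  p t @[t --> F] --> l -> q t @[t --> F] --> y ->
  ccvg F (fun t => g' (q t) (p t)) (g' y l).
Proof.
move=> l01 yab pl qy; have [fc f'c] := fin l01 yab.
have sq : sigma (q t) @[t --> F] --> sigma y by apply: cvg_comp qy _; exact: csigma.
have s'q : sigma' (q t) @[t --> F] --> sigma' y by apply: cvg_comp qy _; exact: csigma'.
apply: ccvgD.
- apply: ccvgM; last by apply: ccvg_real; apply: cvgB => //; exact: cvg_cst.
  apply: ccvgM; first by apply: f'c; exact: sweep_ccvg.
  by apply: ccvg_reim; [exact: cvgM|exact: cvg_cst].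
- apply: ccvgM; first by apply: (cara_pcont fc); exact: sweep_ccvg.
  exact: ccvg_real.
Qed.

Let in01 l : 0 <= clip 0 1 l <= 1. Proof. exact: clip_in ler01. Qed.

Let g_cintg y : a <= y <= b -> cintg `[0, 1] (g y).
Proof.
move=> yab; apply: seg_cintg => l; apply: gcv => //; first exact: clip_cvg.
exact: cvg_cst.
Qed.

Let dg_y y l : a < y < b -> 0 <= l <= 1 -> cdiff (g ^~ l) y (g' y l).
Proof.
move=> yab l01; have [fc _] := fin l01 yab.
have ds : cdiff (sweep l) y ((l * sigma' y) +i* 1).
  split => /=; last exact: rder_id.
  apply: rder_eq (rderD (rder_cst x0 y) (rderZ l (rderB (dsigma y) (rder_cst x0 y)))) _.
  by rewrite add0r subr0.
have dh : cdiff (fun y => (sigma y - x0)%:C) y (sigma' y)%:C.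
  apply: cdiff_real; apply: rder_eq (rderB (dsigma y) (rder_cst x0 y)) _.
  by rewrite subr0.
exact: (cdiffM (cara_chain fc ds) dh).
Qed.

Let dg_l y l : a < y < b -> 0 <= l <= 1 ->
  cdiff (fun l => f (sweep l y) * ((l * sigma' y) +i* 1)) l (g' y l).
Proof.
move=> yab l01; have [fc _] := fin l01 yab.
have ds : cdiff (sweep ^~ y) l (sigma y - x0)%:C.
  split => /=; last exact: rder_cst.
  apply: rder_eq (rderD (rder_cst x0 l) (rderM (rder_id l) (rder_cst (sigma y - x0) l))) _.
  by rewrite add0r mul1r mulr0 addr0.
have dh : cdiff (fun l => (l * sigma' y) +i* 1) l (sigma' y)%:C.
  split => /=; last exact: rder_cst.
  apply: rder_eq (rderM (rder_id l) (rder_cst (sigma' y) l)) _.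
  by rewrite mul1r mulr0 addr0.
have := cdiffM (@cara_chain _ f (sweep ^~ y) l _ _ fc ds) dh.
by rewrite /g' -[f' _ * _ * (_ +i* _)]mulrA [(sigma y - x0)%:C * _]mulrC mulrA.
Qed.

Let k y : C := f (sigma y +i* y) * (sigma' y +i* 1) - f (x0 +i* y) * (0 +i* 1).

Let sweep1 y : sweep 1 y = sigma y +i* y.
Proof. by rewrite /sweep mul1r addrC subrK. Qed.
Let sweep0 y : sweep 0 y = x0 +i* y.
Proof. by rewrite /sweep mul0r addr0. Qed.

Let int_g' y : a < y < b -> cint `[0, 1] (g' y) = k y.
Proof.
move=> yab.
rewrite (@cint_FTC 0 1 (fun l => f (sweep l y) * ((l * sigma' y) +i* 1))) //.
- by rewrite sweep1 sweep0 mul1r mul0r.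
- by move=> l; apply: g'cv => //; [exact: clip_cvg|exact: cvg_cst].
- move=> l; apply: ccvgM.
    have [fc _] := fin (in01 l) yab; apply: (cara_pcont fc).
    by apply: sweep_ccvg; [exact: clip_cvg|exact: cvg_cst].
  apply: ccvg_reim; last exact: cvg_cst.
  by apply: cvgM; [exact: clip_cvg|exact: cvg_cst].
- by move=> l /andP[l0 l1]; apply: dg_l => //; rewrite !ltW.
Qed.

Let B y : C := cint `[0, 1] (g y).

Let dB y : a < y < b -> cdiff B y (k y).
Proof.
move=> /andP[ay yb].
(* Away from the end points, where [f] need only be continuous. *)
pose u := (a + y) / 2; pose v := (y + b) / 2.
have [au uy yv vb] : [/\ a < u, u < y, y < v & v < b].
  by rewrite /u /v; split; lra.
have uv : u <= v by lra.
have [|M M0 hM] := @rect_bounded (fun y l => g' y l) u v 0 1.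
  move=> s; have /andP[s1 s2] := clip_in s.1 uv.
  apply: g'cv => //; first by apply/andP; split; lra.
  - by apply: clip_cvg_comp; exact: cvg_snd.
  - by apply: clip_cvg_comp; exact: cvg_fst.
rewrite -int_g' ?ay//; apply: (@cdiff_under_integral g g' u v y M).
- by rewrite uy yv.
- by move=> z /andP[uz zv]; apply: g_cintg; apply/andP; split; lra.
- by move=> z l /andP[uz zv] l01; apply: dg_y => //; apply/andP; split; lra.
- by move=> z l /andP[uz zv] l01; apply: hM => //; apply/andP; split; lra.
Qed.

Let cB : seg_cont a b B.
Proof.
have [|M M0 hM] := @rect_bounded (fun y l => g y l) a b 0 1.
  move=> s; apply: gcv => //; first exact: clip_in (ltW ab).
  - by apply: clip_cvg_comp; exact: cvg_snd.
  - by apply: clip_cvg_comp; exact: cvg_fst.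
apply: (@seg_cont_under_integral g a b M) => //; first exact: ltW.
move=> l l01 y; apply: gcv => //; first exact: clip_in (ltW ab).
- exact: cvg_cst.
- exact: clip_cvg.
Qed.

Let in_ab y : a <= clip a b y <= b. Proof. exact: clip_in (ltW ab). Qed.

Let fsw l y : 0 <= l <= 1 ->
  ccvg (nbhs y) (fun t => f (sweep l (clip a b t))) (f (sweep l (clip a b y))).
Proof.
move=> l01; apply: fcl => //; apply: sweep_ccvg; [exact: cvg_cst|exact: clip_cvg].
Qed.

Let ck1 : seg_cont a b (fun y => f (sigma y +i* y) * (sigma' y +i* 1)).
Proof.
move=> y; apply: ccvgM.
  by under eq_fun do rewrite -sweep1; rewrite -sweep1; apply: fsw; rewrite ler01 lexx.
apply: ccvg_reim; last exact: cvg_cst.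
by have h := clip_cvg (a:=a) (b:=b) (y:=y); apply: cvg_comp h _; exact: csigma'.
Qed.

Let ck0 : seg_cont a b (fun y => f (x0 +i* y) * (0 +i* 1)).
Proof.
move=> y; apply: ccvgM; last exact: ccvg_cst.
by under eq_fun do rewrite -sweep0; rewrite -sweep0; apply: fsw; rewrite ler01 lexx.
Qed.

(** Cauchy's theorem for the region between the line [Re s = x0] and the
    curve [Re s = sigma (Im s)].  Let [B y] be the integral of [f] along the
    horizontal segment at height [y].  By the chain rule the derivative in [y] of
    its integrand is the derivative in [l] of [f (sweep l y)] times the derivative
    of [sweep] in [y]; therefore [B' y] is the difference [k y] of the two
    integrands on the left-hand side.  Integrate [B']. *)
Lemma cauchy_sweep :
  cint `[a, b] (fun y => f (sigma y +i* y) * (sigma' y +i* 1)) -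
  cint `[a, b] (fun y => f (x0 +i* y) * (0 +i* 1)) =
  cint `[0, 1] (fun l => f (sweep l b) * (sigma b - x0)%:C) -
  cint `[0, 1] (fun l => f (sweep l a) * (sigma a - x0)%:C).
Proof.
rewrite -cintB//; [|exact: seg_cintg ck1|exact: seg_cintg ck0].
apply: (@cint_FTC a b B) => //.
move=> y; apply: ccvgB; [exact: ck1|exact: ck0].
Qed.

End Strip.
End CauchyTheorem.

(** * The kernel of the H-function *)

Section Kernel.
Context {R : realType}.
Local Notation C := R[i].
Variables (p rho kap gam : R).
Hypotheses (p0 : 0 < p) (rho0 : 0 <= rho) (kap0 : 0 <= kap).
Hypothesis rate0 : 0 < 2 * p + 1 - 2 * rho - kap.
Implicit Types (s z : C) (G : C -> C).

(** The kernel of the H-function, with [p] for [1 / alpha] and [kap] for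
    [mu / alpha]; [G] is Gamma or a term of Euler's sequence. *)
Definition kern G s : C :=
  (G (1 + p%:C * s) * G (1 + s) * G (- (p%:C * s))) /
  (G (- (rho%:C * s)) * G (gam%:C + kap%:C * s) * G (1 + rho%:C * s)).

(** Off the real axis, or in the strip between the two families of poles: no
    Gamma function in the numerator has a pole there. *)
Definition pole_free s : Prop :=
  Im s != 0 \/ [/\ -1 < Re s, -1 < p * Re s & Re s < 0].

Lemma holo_eulerG_affine U n (a b : C) :
  (forall s, U s -> forall k : nat, a * s + b + k%:R != 0) ->
  holo U (fun s => eulerG n (a * s + b)).
Proof.
move=> U0; rewrite /eulerG; apply: holoM.
- apply: holoM; first exact: holo_cst.
  have -> : (fun s => cpow n%:R (a * s + b)) =
    (fun s => cexp (a * (ln n%:R)%:C * s + b * (ln n%:R)%:C)).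
    by apply/funext => s; rewrite /cpow; congr cexp; ring.
  exact: holo_cexp_affine.
- apply: holoV => [s Us|].
    by apply/prodf_neq0 => k _; exact: U0.
  apply: (@holo_prod _ U n.+1 (fun k s => a * s + b + k%:R)) => k.
  have -> : (fun s => a * s + b + k%:R) = (fun s => a * s + (b + k%:R)).
    by apply/funext => s; rewrite addrA.
  exact: holo_affine.
Qed.

Lemma holo_eulerGV_affine U n (a b : C) : holo U (fun s => (eulerG n (a * s + b))^-1).
Proof.
have -> : (fun s => (eulerG n (a * s + b))^-1) =
    (fun s => (n`!%:R^-1 * cexp (- a * (ln n%:R)%:C * s - b * (ln n%:R)%:C)) *
       \prod_(k < n.+1) (a * s + b + k%:R)).
  apply/funext => s; rewrite /eulerG !invfM invrK; congr (_ * _ * _).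
  by rewrite /cpow -cexpN; congr cexp; ring.
apply: holoM.
- by apply: holoM; [exact: holo_cst|exact: holo_cexp_affine].
- apply: (@holo_prod _ U n.+1 (fun k s => a * s + b + k%:R)) => k.
  have -> : (fun s => a * s + b + k%:R) = (fun s => a * s + (b + k%:R)).
    by apply/funext => s; rewrite addrA.
  exact: holo_affine.
Qed.

Lemma kern_affine G s : kern G s =
  G (p%:C * s + 1) * G (1 * s + 1) * G (- p%:C * s + 0) *
  (G (- rho%:C * s + 0))^-1 * (G (kap%:C * s + gam%:C))^-1 * (G (rho%:C * s + 1))^-1.
Proof.
rewrite /kern !invfM !mulrA !addr0 !mul1r !mulNr.
by rewrite ![1 + _]addrC [gam%:C + _]addrC.
Qed.

(** A term of Euler's sequence is an exponential divided by a polynomial whose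
    zeros are among the poles of Gamma. *)
Lemma holo_kern n : holo pole_free (kern (eulerG n)).
Proof.
have -> : kern (eulerG n) = fun s => kern (eulerG n) s by [].
under eq_fun do rewrite kern_affine.
have nz (r c : R) s (k : nat) : (Im s = 0 -> r * Re s + c + k%:R != 0) -> r != 0 ->
    r%:C * s + c%:C + k%:R != 0.
  move=> h r0; apply/eqP => /[dup] /(congr1 (@complex.Re R)) + /(congr1 (@complex.Im R)).
  rewrite !reimE/= !mul0r !addr0 subr0 => hr /eqP; rewrite mulf_eq0 (negbTE r0)/= => /eqP s0.
  by move: (h s0); rewrite hr eqxx.
apply: holoM; last exact: holo_eulerGV_affine.
apply: holoM; last exact: holo_eulerGV_affine.
apply: holoM; last exact: holo_eulerGV_affine.
apply: holoM; [apply: holoM|]; apply: holo_eulerG_affine => s Us k.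
- apply: (nz p 1) => [s0|]; last by rewrite gt_eqF.
  case: Us => [|[_ h _]]; first by rewrite s0 eqxx.
  by rewrite gt_eqF// (@lt_le_trans _ _ (p * Re s + 1))// ?lerDl//; lra.
- apply: (nz 1 1) => [s0|]; last by rewrite oner_neq0.
  case: Us => [|[h _ _]]; first by rewrite s0 eqxx.
  by rewrite gt_eqF// (@lt_le_trans _ _ (1 * Re s + 1))// ?lerDl//; lra.
- rewrite -rmorphN/=; apply: (nz (- p) 0) => [s0|]; last by rewrite oppr_eq0 gt_eqF.
  case: Us => [|[_ _ h]]; first by rewrite s0 eqxx.
  by rewrite gt_eqF// (@lt_le_trans _ _ (- p * Re s + 0))// ?lerDl// addr0 mulNr oppr_gt0 pmulr_rlt0.
Qed.

Lemma kern_cvg s : ccvg \oo (fun n => kern (eulerG n) s) (kern Gamma s).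
Proof.
rewrite kern_affine; under eq_fun do rewrite kern_affine.
do 3 (apply: ccvgM; last exact: eulerGV_cvg).
do 2 (apply: ccvgM; last exact: eulerG_cvg).
exact: eulerG_cvg.
Qed.

(** A bound for the arguments of the six Gamma functions on the disc of
    radius [B]. *)
Definition argbound (B : R) : R := (p + 1 + rho + kap) * B + 1 + `|gam|.

Lemma normc_affine_le (r c : R) s (B : R) : normc s <= B -> normc (r%:C * s + c%:C) <= `|r| * B + `|c|.
Proof.
move=> sB; apply: (le_trans (le_normcD _ _)); rewrite normcM !normc_real lerD2r.
by rewrite ler_wpM2l.
Qed.

Lemma ler_pM6 (x1 x2 x3 x4 x5 x6 y1 y2 y3 y4 y5 y6 : R) :
  0 <= x1 -> 0 <= x2 -> 0 <= x3 -> 0 <= x4 -> 0 <= x5 -> 0 <= x6 ->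
  x1 <= y1 -> x2 <= y2 -> x3 <= y3 -> x4 <= y4 -> x5 <= y5 -> x6 <= y6 ->
  x1 * x2 * x3 * x4 * x5 * x6 <= y1 * y2 * y3 * y4 * y5 * y6.
Proof. by move=> *; do 5 (apply: ler_pM; rewrite ?mulr_ge0//). Qed.

Lemma normcM6 (x1 x2 x3 x4 x5 x6 : C) : normc (x1 * x2 * x3 * x4 * x5 * x6) =
  normc x1 * normc x2 * normc x3 * normc x4 * normc x5 * normc x6.
Proof. by rewrite !normcM. Qed.

(** The domination of late terms of Euler's sequence, for each of the six
    factors. *)
Lemma kern_le (B : R) N n s : normc s <= B -> (eulerN (argbound B) <= N)%N -> (N <= n)%N ->
  normc (kern (eulerG n) s) <=
    expR (2 * eulerD (argbound B)) ^+ 6 * normc (kern (eulerG N) s).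
Proof.
move=> sB BN Nn; have B0 := le_trans (normc_ge0 _) sB.
have pB : 0 <= p * B by rewrite mulr_ge0// ltW.
have rB : 0 <= rho * B by rewrite mulr_ge0.
have kB : 0 <= kap * B by rewrite mulr_ge0.
have g0 := normr_ge0 gam.
have arg (r c : R) : `|r| * B + `|c| <= argbound B -> normc (r%:C * s + c%:C) <= argbound B.
  by apply: le_trans; exact: normc_affine_le.
have a1 : normc (p%:C * s + 1) <= argbound B.
  by apply: (arg p 1); rewrite normr1 ger0_norm ?(ltW p0)// /argbound; lra.
have a2 : normc (1 * s + 1) <= argbound B.
  by apply: (arg 1 1); rewrite normr1 /argbound; lra.
have a3 : normc (- p%:C * s + 0) <= argbound B.
  by rewrite -rmorphN/=; apply: (arg (- p) 0); rewrite normr0 normrN ger0_norm ?(ltW p0)// /argbound; lra.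
have a4 : normc (- rho%:C * s + 0) <= argbound B.
  by rewrite -rmorphN/=; apply: (arg (- rho) 0); rewrite normr0 normrN ger0_norm// /argbound; lra.
have a5 : normc (kap%:C * s + gam%:C) <= argbound B.
  by apply: arg; rewrite [`|kap|]ger0_norm// /argbound; lra.
have a6 : normc (rho%:C * s + 1) <= argbound B.
  by apply: (arg rho 1); rewrite normr1 ger0_norm// /argbound; lra.
set E := expR _.
have E0 : 0 <= E by exact: expR_ge0.
rewrite !kern_affine !normcM6.
have -> (x1 x2 x3 x4 x5 x6 : R) : E ^+ 6 * (x1 * x2 * x3 * x4 * x5 * x6) =
  (E * x1) * (E * x2) * (E * x3) * (E * x4) * (E * x5) * (E * x6) by ring.
by apply: ler_pM6; rewrite ?normc_ge0//; do ?[exact: eulerG_le|exact: eulerGV_le].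
Qed.

Lemma kern_Gamma_le (B : R) N s : normc s <= B -> (eulerN (argbound B) <= N)%N ->
  normc (kern Gamma s) <=
    expR (2 * eulerD (argbound B)) ^+ 6 * normc (kern (eulerG N) s).
Proof.
move=> sB BN.
have c : normc (kern (eulerG n) s) @[n --> \oo] --> normc (kern Gamma s).
  by apply: ccvg_normc; exact: kern_cvg.
apply: (@ler_cvg_to _ _ _ _ _ (fun=> expR (2 * eulerD (argbound B)) ^+ 6 * normc (kern (eulerG N) s)) _ _ c (cvg_cst _)).
by exists N => // n /= Nn; exact: kern_le.
Qed.

(** Each Gamma function in the numerator contributes the decay rate [pi / 2]
    times the modulus of its slope, each one in the denominator the opposite, up to
    [e] times the slopes; [e] is chosen so small that half of the total rate, which
    is positive, remains. *)
Lemma kern_decay (B : R) : exists D e T, [/\ 0 <= D, 0 < e, 0 < T &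
  forall s, `|Re s| <= B -> T <= `|Im s| -> normc (kern Gamma s) <= D * expR (- (e * `|Im s|))].
Proof.
pose q := 2 * p + 1 + 2 * rho + kap.
have pi0 : 0 < pi :> R := pi_gt0 R.
have q0 : 0 < q by rewrite /q; move: p0 rho0 kap0; lra.
pose r := pi / 2 * (2 * p + 1 - 2 * rho - kap).
have r0 : 0 < r by rewrite /r !mulr_gt0.
pose e := r / (2 * q).
have e0 : 0 < e by rewrite /e divr_gt0// mulr_gt0.
pose B' := argbound `|B|.
have [D1 D10 h1] := @Gamma_decay R B' e e0.
have [D2 D20 h2] := @GammaV_growth R B' e e0.
(* From this height on, the imaginary parts [y] and [p * y] are at least [1]. *)
exists (D1 ^+ 3 * D2 ^+ 3), (r / 2), (1 + p^-1).
split; [by rewrite mulr_ge0 ?exprn_ge0|by rewrite divr_gt0|by rewrite addr_gt0 ?invr_gt0|].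
move=> s sB Ts.
have {}sB : `|Re s| <= `|B| := le_trans sB (ler_norm _).
set y := `|Im s| in Ts *.
have y1 : 1 <= y by apply: le_trans Ts; rewrite lerDl invr_ge0 ltW.
have py : 1 <= p * y.
  by rewrite -ler_pdivrMl// mulr1; apply: le_trans Ts; rewrite lerDr.
have B0 := normr_ge0 B.
have pB : 0 <= p * `|B| by rewrite mulr_ge0// ltW.
have rB : 0 <= rho * `|B| by rewrite mulr_ge0.
have kB : 0 <= kap * `|B| by rewrite mulr_ge0.
have g0 := normr_ge0 gam.
have re (u c : R) : `|u| * `|B| + `|c| <= B' -> `|Re (u%:C * s + c%:C)| <= B'.
  apply: le_trans; rewrite !reimE/= mul0r subr0 (le_trans (ler_normD _ _))// lerD2r normrM.
  by rewrite ler_wpM2l.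
have im (u c : R) : `|Im (u%:C * s + c%:C)| = `|u| * y.
  by rewrite !reimE/= mul0r !addr0 normrM.
have G (u c : R) : `|u| * `|B| + `|c| <= B' -> 1 <= `|u| * y ->
    normc (Gamma (u%:C * s + c%:C)) <= D1 * expR ((e - pi / 2) * (`|u| * y)).
  by move=> ub u1; rewrite -(im u c); apply: h1; [exact: re|rewrite im].
have V (u c : R) : `|u| * `|B| + `|c| <= B' ->
    normc (Gamma (u%:C * s + c%:C))^-1 <= D2 * expR ((e + pi / 2) * (`|u| * y)).
  by move=> ub; rewrite -(im u c); apply: h2; exact: re.
have np : `|p| = p by rewrite gtr0_norm.
have nrho : `|rho| = rho by rewrite ger0_norm.
have nkap : `|kap| = kap by rewrite ger0_norm.
have a1 := G p 1; rewrite np normr1 in a1.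
have a2 := G 1 1; rewrite normr1 !mul1r in a2.
have a3 := G (- p) 0; rewrite normrN np normr0 rmorphN in a3.
have a4 := V (- rho) 0; rewrite normrN nrho normr0 rmorphN in a4.
have a5 := V kap gam; rewrite nkap in a5.
have a6 := V rho 1; rewrite nrho normr1 in a6.
rewrite kern_affine normcM6.
apply: (@le_trans _ _ (D1 * expR ((e - pi / 2) * (p * y)) * (D1 * expR ((e - pi / 2) * y)) *
  (D1 * expR ((e - pi / 2) * (p * y))) * (D2 * expR ((e + pi / 2) * (rho * y))) *
  (D2 * expR ((e + pi / 2) * (kap * y))) * (D2 * expR ((e + pi / 2) * (rho * y))))).
  apply: ler_pM6; rewrite ?normc_ge0//.
  - by apply: a1; rewrite /B' /argbound; lra.
  - by rewrite mul1r; apply: a2; rewrite /B' /argbound; lra.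
  - by apply: a3; rewrite /B' /argbound; lra.
  - by apply: a4; rewrite /B' /argbound; lra.
  - by apply: a5; rewrite /B' /argbound; lra.
  - by apply: a6; rewrite /B' /argbound; lra.
rewrite [leLHS](_ : _ = D1 ^+ 3 * D2 ^+ 3 * expR (- ((r - e * q) * y))); last first.
  have -> : - ((r - e * q) * y) = (e - pi / 2) * (p * y) + (e - pi / 2) * y + (e - pi / 2) * (p * y)
    + (e + pi / 2) * (rho * y) + (e + pi / 2) * (kap * y) + (e + pi / 2) * (rho * y).
    by rewrite /r /q; field.
  by rewrite !expRD; ring.
have -> : e * q = r / 2 by rewrite /e; field; rewrite gt_eqF.
by rewrite (_ : r - r / 2 = r / 2)//; lra.
Qed.

End Kernel.

(** * Improper integrals and powers *)

Section ImproperIntegrals.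
Context {R : realType}.
Local Notation C := R[i].
Local Notation mu := (@lebesgue_measure R).
Implicit Types (D : set R) (f : R -> C) (u v lam q : R) (z : C).

(** Monotone convergence. *)
Lemma integrable_exhaust (D_ : nat -> set R) (h : R -> R) (B : R) N :
  nondecreasing_seq D_ -> (forall n, measurable (D_ n)) ->
  measurable_fun (\bigcup_n D_ n) h ->
  (forall n x, D_ n x -> 0 <= h x) ->
  (forall n, mu.-integrable (D_ n) (EFin \o h)) ->
  (forall n, (N <= n)%N -> \int[mu]_(x in D_ n) h x <= B) ->
  mu.-integrable (\bigcup_n D_ n) (EFin \o h).
Proof.
move=> ndD mD mh h0 ih hB; apply/integrableP; split; first exact/measurable_EFinP.
apply: (@le_lt_trans _ _ B%:E); last exact: ltry.
rewrite (_ : \int[mu]_(x in \bigcup_n D_ n) `|(EFin \o h) x| =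
             \int[mu]_(x in \bigcup_n D_ n) (EFin \o h) x)%E; last first.
  by apply: eq_integral => x; rewrite inE => -[n _ Dx]; rewrite /= ger0_norm// (h0 n).
have c : (\int[mu]_(x in D_ n) (EFin \o h) x)%E @[n --> \oo] -->
    (\int[mu]_(x in \bigcup_n D_ n) (EFin \o h) x)%E.
  apply: ge0_nondecreasing_set_cvg_integral => //.
  by move=> n; exact: measurable_int (ih n).
apply: (@cvge_le _ \oo _ _ _ _ _ _ c).
exists N => // n /= Nn.
have hn := hB n Nn; rewrite -lee_fin /Rintegral fineK in hn; first exact: hn.
by apply: integrable_fin_num; [exact: mD|exact: ih].
Qed.

Lemma cint_indic A D f : A `<=` D ->
  cint A f = cint D (fun x => (\1_A x)%:C * f x).
Proof.
move=> AD; have DI : A = D `&` A by apply/esym/setIidPr.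
apply: complex_ext => /=.
- rewrite {1}DI Rintegral_mkcondr; apply: eq_Rintegral => x _.
  by rewrite patchE indicE ReM/= mul0r subr0; case: ifP => _; rewrite ?mul1r ?mul0r.
- rewrite {1}DI Rintegral_mkcondr; apply: eq_Rintegral => x _.
  by rewrite patchE indicE ImM/= mul0r addr0; case: ifP => _; rewrite ?mul1r ?mul0r.
Qed.

Lemma cintg_indic D f : measurable D ->
  cintg D f <-> cintg setT (fun x => (\1_D x)%:C * f x).
Proof.
move=> mD.
have E (g : R -> R) : mu.-integrable D (EFin \o g) <->
    mu.-integrable setT (EFin \o (fun x => \1_D x * g x)).
  have h := @integrable_mkcond _ _ _ mu D (EFin \o g) mD.
  have e : ((EFin \o g) \_ D) = EFin \o (fun x => \1_D x * g x).
    by apply/funext => x; rewrite patchE /= indicE; case: ifP => _; rewrite ?mul1r ?mul0r.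
  by rewrite e in h.
rewrite /cintg; under [in X in _ <-> X]eq_fun do rewrite ReM/= mul0r subr0.
under [in X in _ <-> (_ /\ X)]eq_fun do rewrite ImM/= mul0r addr0.
by split=> -[h1 h2]; split; apply/E.
Qed.

Lemma cint_exhaust (D_ : nat -> set R) f :
  nondecreasing_seq D_ -> (forall n, measurable (D_ n)) ->
  cintg (\bigcup_n D_ n) f ->
  ccvg \oo (fun n => cint (D_ n) f) (cint (\bigcup_n D_ n) f).
Proof.
move=> ndD mD fi; set D := \bigcup_n D_ n.
have mDD : measurable D by exact: bigcup_measurable.
have mf := cintg_cmeas fi.
have E n : cint (D_ n) f = cint D (fun x => (\1_(D_ n) x)%:C * f x).
  by apply: cint_indic; exact: bigcup_sup.
under eq_fun do rewrite E.
apply: (@cint_dct _ D _ f (fun x => normc (f x))) => //.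
- move=> n; apply: cmeasM => //; apply: cmeas_real; exact: measurable_indic.
- move=> x [N _ Nx].
  apply: (ccvg_near (u := fun=> f x)); last exact: ccvg_cst.
  exists N => // n /= Nn; rewrite indicE mem_set ?mul1r//.
  by have := ndD N n Nn; rewrite subsetEset; exact.
- exact: cintg_normc.
- move=> n x _; rewrite normcM normc_real ler_piMl ?normc_ge0// ger0_norm indicE//.
  by case: (_ \in _).
Qed.

Lemma bigcup_segT : \bigcup_n `[- n%:R, n%:R]%classic = [set: R].
Proof. exact: bigcup_itvT. Qed.

Lemma nondecreasing_seg : nondecreasing_seq (fun n => `[- n%:R, n%:R]%classic : set R).
Proof.
move=> m n mn; rewrite subsetEset; apply: subset_itv; rewrite leBSide/= ?lerN2 ler_nat//.
Qed.

Lemma cint_lim_seg f : cintg setT f ->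
  ccvg \oo (fun n => cint `[- n%:R, n%:R] f) (cint setT f).
Proof.
rewrite -bigcup_segT => fi; apply: cint_exhaust => //; first exact: nondecreasing_seg.
Qed.

Lemma integrable_oneDsqrV : mu.-integrable setT (EFin \o (fun y : R => (1 + y ^+ 2)^-1)).
Proof.
have pos (y : R) : 0 < 1 + y ^+ 2 by rewrite ltr_wpDr ?sqr_ge0.
have sc a b : seg_cont a b (fun y : R => ((1 + y ^+ 2)^-1)%:C : C).
  move=> y; apply: ccvg_real; apply: cvgV; first by rewrite gt_eqF.
  by apply: cvgD; [exact: cvg_cst|rewrite expr2; apply: cvgM; exact: clip_cvg].
rewrite -bigcup_segT; apply: (@integrable_exhaust _ _ pi 1).
- exact: nondecreasing_seg.
- by move=> n.
- rewrite bigcup_segT; apply: continuous_measurable_fun => y.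
  apply: cvgV; first by rewrite gt_eqF.
  by apply: cvgD; [exact: cvg_cst|rewrite expr2; apply: cvgM; exact: cvg_id].
- by move=> n x _; rewrite invr_ge0 ltW.
- by move=> n; have [] := seg_cintg (sc (- n%:R) n%:R).
- move=> n n1; have nn : - n%:R < n%:R :> R by rewrite gtrN ?ltr0n.
  have FT : cint `[- n%:R, n%:R] (fun y : R => ((1 + y ^+ 2)^-1)%:C) = (atan n%:R)%:C - (atan (- n%:R))%:C :> C.
    apply: (@cint_FTC R (- n%:R) n%:R (fun y => (atan y)%:C)) => // [y|y _].
    + by apply: ccvg_real; apply: cvg_comp (@clip_cvg R _ _ _) _; exact: continuous_atan.
    + by apply: cdiff_real; exact: is_derive1_atan.
  move/(congr1 (@complex.Re R)) : FT => /= ->.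
  by have := atan_ltpi2 (n%:R : R); rewrite atanN opprK; lra.
Qed.

(** The exponential dominates [1 + y^2], whose reciprocal has a bounded
    primitive. *)
Lemma integrable_expdecay (e : R) : 0 < e ->
  mu.-integrable setT (EFin \o (fun y : R => expR (- (e * `|y|)))).
Proof.
move=> e0; have [D D0 hD] := @lin_le_expR R 1 (e / 2) ler01 (divr_gt0 e0 (ltr0n _ 2)).
have pos (y : R) : 0 < 1 + y ^+ 2 by rewrite ltr_wpDr ?sqr_ge0.
have i : mu.-integrable setT (EFin \o (fun y : R => D ^+ 2 * (1 + y ^+ 2)^-1)).
  rewrite /comp; under eq_fun do rewrite EFinM; apply: integrableZl => //.
  exact: integrable_oneDsqrV.
apply: le_integrable i => //.
  apply/measurable_EFinP; apply: measurableT_comp; first exact: measurable_expR.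
  by apply: measurable_funN; apply: measurable_funM => //; exact: normr_measurable.
move=> y _ /=; rewrite lee_fin ger0_norm ?expR_ge0//.
apply: le_trans (ler_norm _); rewrite ler_pdivlMr// mulrC.
have h : (1 + `|y|) ^+ 2 <= (D * expR (e / 2 * `|y|)) ^+ 2.
  by rewrite lerXn2r ?nnegrE ?addr_ge0 ?mulr_ge0 ?expR_ge0.
have h2 : (D * expR (e / 2 * `|y|)) ^+ 2 = D ^+ 2 * expR (e * `|y|).
  by rewrite exprMn -expRM_natl; congr (_ * expR _); field.
have -> : D ^+ 2 = D ^+ 2 * expR (e * `|y|) * expR (- (e * `|y|)).
  by rewrite -mulrA expRxMexpNx_1 mulr1.
rewrite -h2.
rewrite ler_wpM2r ?expR_ge0//; apply: le_trans h.
by rewrite -[y ^+ 2]real_normK ?num_real// sqrrD expr1n mul1r lerD2r lerDl mulrn_wge0.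
Qed.

Lemma cdiff_cpow z (x : R) : z != 0 -> 0 < x ->
  cdiff (fun x => cpow x z * z^-1) x (cpow x (z - 1)).
Proof.
move=> z0 x0.
have dp : cdiff (fun x : R => z * (ln x)%:C) x (0 * (ln x)%:C + z * (x^-1)%:C).
  apply: cdiffM; last by apply: cdiff_real; exact: is_derive1_ln.
  by split; exact: rder_cst.
have d1 := @cara_chain R cexp (fun x => z * (ln x)%:C) x _ _ (@cara_cexp R _) dp.
have dc : cdiff (fun=> z^-1) x (0 : C) by split; exact: rder_cst.
have := cdiffM d1 dc; rewrite mulr0 addr0 mul0r add0r.
rewrite cpowD cpowN cpow1//.
have -> : cexp (z * (ln x)%:C) * (z * (x^-1)%:C) * z^-1 = cpow x z * (x%:C)^-1.
  by rewrite /cpow fmorphV/=; field; rewrite z0 andbT -[0]/((0 : R)%:C); apply/eqP => -[]; lra.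
by [].
Qed.

Lemma seg_cont_cpow u v z : 0 < u -> seg_cont u v (fun x => cpow x z).
Proof.
move=> u0 y; apply: ccvg_cexp; apply: ccvgM; first exact: ccvg_cst.
apply: ccvg_real; apply: (cvg_comp _ _ (@clip_cvg R _ _ _)).
by apply: continuous_ln; rewrite (lt_le_trans u0)// /clip le_max lexx.
Qed.

Lemma cint_cpow u v z : z != 0 -> 0 < u -> u < v ->
  cint `[u, v] (fun x => cpow x (z - 1)) = (cpow v z - cpow u z) / z.
Proof.
move=> z0 u0 uv; rewrite (@cint_FTC R u v (fun x => cpow x z * z^-1)) ?mulrBl//.
- exact: seg_cont_cpow.
- by move=> y; apply: ccvgM; [exact: seg_cont_cpow|exact: ccvg_cst].
- by move=> x /andP[ux _]; apply: cdiff_cpow => //; exact: lt_trans ux.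
Qed.

Let normpow q (x : R) : Re (cpow x (q%:C - 1)) = expR ((q - 1) * ln x).
Proof. by rewrite /cpow Re_cexp !reimE/= !(subr0, mul0r, mulr0, addr0, cos0, mulr1, oppr0). Qed.

Let Rint_pow u v q : q != 0 -> 0 < u -> u < v ->
  \int[mu]_(x in `[u, v]) expR ((q - 1) * ln x) = (expR (q * ln v) - expR (q * ln u)) / q.
Proof.
move=> q0 u0 uv.
have q0' : q%:C != 0 :> C by apply/eqP => -[] /eqP; rewrite (negbTE q0).
transitivity (Re (cint `[u, v] (fun x => cpow x (q%:C - 1)))).
  by apply: eq_Rintegral => x _; rewrite normpow.
rewrite cint_cpow//.
have E (x : R) : cpow x q%:C = (expR (q * ln x))%:C by rewrite /cpow -rmorphM cexp_real.
by rewrite !E -rmorphB -fmorphV -rmorphM.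
Qed.

Lemma meas_pow D q : measurable_fun D (fun x : R => expR ((q - 1) * ln x)).
Proof.
apply: measurableT_comp; first exact: measurable_expR.
by apply: measurable_funM => //; apply: measurable_funTS; exact: measurable_ln.
Qed.

Lemma cmeas_cpow D z : cmeas D (fun x => cpow x z).
Proof.
apply: cmeas_cexp; apply: cmeasM; first exact: cmeas_cst.
by apply: cmeas_real; apply: measurable_funTS; exact: measurable_ln.
Qed.

Lemma cintg_cpow_of D z : measurable D ->
  mu.-integrable D (EFin \o (fun x : R => expR ((Re z - 1) * ln x))) ->
  cintg D (fun x => cpow x (z - 1)).
Proof.
move=> mD i; apply: (cintg_le mD _ i) => //; first exact: cmeas_cpow.
by move=> x _; rewrite normc_cpow !reimE.
Qed.

Let int_seg_pow u v q : 0 < u -> mu.-integrable `[u, v] (EFin \o (fun x : R => expR ((q - 1) * ln x))).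
Proof.
move=> u0; have [i _] := seg_cintg (@seg_cont_cpow u v (q%:C - 1) u0).
by apply: eq_integrable i => // x _; rewrite normpow.
Qed.

Lemma integrable_pow0 lam q : 0 < lam -> 0 < q ->
  mu.-integrable `]0, lam] (EFin \o (fun x : R => expR ((q - 1) * ln x))).
Proof.
move=> l0 q0; rewrite (itv_open_bnd_bigcup false lam 0).
have [N _ HN] : \forall n \near \oo, n.+1%:R^-1 < lam.
  have := @cvg_harmonic R => /cvgrPdist_lt /(_ lam l0); apply: filterS => n.
  by rewrite sub0r normrN ger0_norm ?invr_ge0.
apply: (@integrable_exhaust _ _ (expR (q * ln lam) / q) N).
- move=> m n mn; rewrite subsetEset; apply: subset_itv; rewrite leBSide//= !add0r.
  by rewrite lef_pV2 ?posrE ?ltr0n// ler_nat.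
- by move=> n.
- exact: meas_pow.
- by move=> n x _; exact: expR_ge0.
- by move=> n; apply: int_seg_pow; rewrite add0r invr_gt0.
- move=> n Nn; have nl : n.+1%:R^-1 < lam by exact: HN.
  rewrite add0r Rint_pow ?gt_eqF ?invr_gt0//.
  by rewrite ler_pM2r ?invr_gt0// gerBl expR_ge0.
Qed.

Lemma integrable_powy lam q : 0 < lam -> q < 0 ->
  mu.-integrable `[lam, +oo[ (EFin \o (fun x : R => expR ((q - 1) * ln x))).
Proof.
move=> l0 q0; rewrite (itv_bndy_bigcup_BRight true lam).
apply: (@integrable_exhaust _ _ (expR (q * ln lam) / - q) 1).
- move=> m n mn; rewrite subsetEset; apply: subset_itv; rewrite leBSide//= lerD2l ler_nat//.
- by move=> n.
- exact: meas_pow.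
- by move=> n x _; exact: expR_ge0.
- by move=> n; exact: int_seg_pow.
- move=> n n1; rewrite Rint_pow ?lt_eqF// ?ltrDl ?ltr0n//.
  rewrite -subr_ge0; have := expR_ge0 (q * ln (lam + n%:R)).
  move: (expR (q * ln (lam + n%:R))) (expR (q * ln lam)) => a b a0.
  have -> : b / - q - (a - b) / q = a / - q by field; rewrite lt_eqF.
  by rewrite divr_ge0// oppr_ge0 ltW.
Qed.

Lemma cint_cpow0 lam z : 0 < lam -> 0 < Re z ->
  cint `]0, lam] (fun x => cpow x (z - 1)) = cpow lam z / z.
Proof.
move=> l0 q0.
have z0 : z != 0 by apply: contraTneq q0 => ->; rewrite ltxx.
have fi : cintg `]0, lam] (fun x => cpow x (z - 1)).
  by apply: cintg_cpow_of => //; exact: integrable_pow0.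
rewrite (itv_open_bnd_bigcup false lam 0) in fi *.
have ndD : nondecreasing_seq (fun n => [set` Interval (BLeft (0 + n.+1%:R^-1)) (BSide false lam)] : set R).
  move=> m n mn; rewrite subsetEset; apply: subset_itv; rewrite leBSide//= !add0r.
  by rewrite lef_pV2 ?posrE ?ltr0n// ler_nat.
have c := cint_exhaust ndD (fun n => measurable_itv _) fi.
apply: (ccvg_unique c).
have c2 : ccvg \oo (fun n => (cpow lam z - cpow n.+1%:R^-1 z) / z) ((cpow lam z - 0) / z).
  apply: ccvgM; last exact: ccvg_cst.
  apply: ccvgB; first exact: ccvg_cst.
  apply: (@ccvg_of_normc _ _ _ _ _ _ (fun n => normc (cpow (n.+1%:R^-1 : R) z))).
    by apply: nearW => n; rewrite subr0.
  under eq_fun do rewrite normc_cpow lnV ?posrE ?ltr0n// mulrN.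
  apply: (cvg_comp _ _ _ (@cvgr_expR R)).
  apply/cvgryPge => A; near=> n; rewrite mulrC -ler_pdivrMr//.
  rewrite -[leLHS]expRK ler_ln ?posrE ?expR_gt0 ?ltr0n//.
  apply: (@le_trans _ _ n%:R); last by rewrite ler_nat.
  near: n; exact: nbhs_infty_ger.
rewrite subr0 in c2; apply: ccvg_near c2.
have := @cvg_harmonic R => /cvgrPdist_lt /(_ lam l0); apply: filterS => n.
rewrite sub0r normrN ger0_norm ?invr_ge0// => nl.
by rewrite -cint_cpow ?invr_gt0// add0r.
Unshelve. all: by end_near. Qed.

Lemma cint_cpowy lam z : 0 < lam -> Re z < 0 ->
  cint `[lam, +oo[ (fun x => cpow x (z - 1)) = - (cpow lam z / z).
Proof.
move=> l0 q0.
have z0 : z != 0 by apply: contraTneq q0 => ->; rewrite ltxx.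
have fi : cintg `[lam, +oo[ (fun x => cpow x (z - 1)).
  by apply: cintg_cpow_of => //; exact: integrable_powy.
rewrite (itv_bndy_bigcup_BRight true lam) in fi *.
have ndD : nondecreasing_seq (fun n => [set` Interval (BSide true lam) (BRight (lam + n%:R))] : set R).
  by move=> m n mn; rewrite subsetEset; apply: subset_itv; rewrite leBSide//= lerD2l ler_nat.
have c := cint_exhaust ndD (fun n => measurable_itv _) fi.
apply: (ccvg_unique c).
have c2 : ccvg \oo (fun n => (cpow (lam + n%:R) z - cpow lam z) / z) ((0 - cpow lam z) / z).
  apply: ccvgM; last exact: ccvg_cst.
  apply: ccvgB; last exact: ccvg_cst.
  apply: (@ccvg_of_normc _ _ _ _ _ _ (fun n => normc (cpow (lam + n%:R) z))).
    by apply: nearW => n; rewrite subr0.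
  have E n : normc (cpow (lam + n%:R) z) = expR (- (- Re z * ln (lam + n%:R))).
    by rewrite normc_cpow mulNr opprK.
  under eq_fun do rewrite E.
  apply: (cvg_comp _ _ _ (@cvgr_expR R)).
  have q0' : 0 < - Re z by rewrite oppr_gt0.
  apply/cvgryPge => A; near=> n; rewrite mulrC -ler_pdivrMr//.
  rewrite -[leLHS]expRK ler_ln ?posrE ?expR_gt0 ?ltr_pwDl//.
  apply: (@le_trans _ _ n%:R); last by rewrite lerDr ltW.
  near: n; exact: nbhs_infty_ger.
rewrite sub0r mulNr in c2; apply: ccvg_near c2.
near=> n; rewrite -cint_cpow// ltrDl ltr0n; near: n; exact: nbhs_infty_gt.
Unshelve. all: by end_near. Qed.

End ImproperIntegrals.

(** * Fubini's theorem and even functions *)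

Section FubiniParity.
Context {R : realType}.
Local Notation C := R[i].
Local Notation mu := (@lebesgue_measure R).
Implicit Types (D : set R) (f : R -> C).

Lemma real_Fubini (G : R -> R -> R) (a b : R -> R) :
  measurable_fun setT (fun t : measurableTypeR R * measurableTypeR R => G t.1 t.2) ->
  mu.-integrable setT (EFin \o a) -> mu.-integrable setT (EFin \o b) ->
  (forall x, 0 <= a x) -> (forall y, 0 <= b y) ->
  (forall x y, `|G x y| <= a x * b y) ->
  mu.-integrable setT (fun x => (\int[mu]_y G x y)%:E) /\
  \int[mu]_x (\int[mu]_y G x y) = \int[mu]_y (\int[mu]_x G x y).
Proof.
move=> mG ia ib a0 b0 Gab.
have mGx x : measurable_fun setT (G x).
  exact: (measurableT_comp mG (pair1_measurable x)).
have mGy y : measurable_fun setT (G ^~ y).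
  exact: (measurableT_comp mG (pair2_measurable y)).
have iGx x : mu.-integrable setT (fun y => (G x y)%:E).
  have i : mu.-integrable setT (EFin \o (fun y => a x * b y)).
    by rewrite /comp; under eq_fun do rewrite EFinM; exact: integrableZl.
  apply: le_integrable i => //; first by apply/measurable_EFinP; exact: mGx.
  by move=> y _ /=; rewrite lee_fin (le_trans (Gab x y))// ler_norm.
have iGy y : mu.-integrable setT (fun x => (G x y)%:E).
  have i : mu.-integrable setT (EFin \o (fun x => b y * a x)).
    by rewrite /comp; under eq_fun do rewrite EFinM; exact: integrableZl.
  apply: le_integrable i => //; first by apply/measurable_EFinP; exact: mGy.
  by move=> x _ /=; rewrite lee_fin (le_trans (Gab x y))// mulrC ler_norm.
pose g (t : measurableTypeR R * measurableTypeR R) := (G t.1 t.2)%:E.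
have mg : measurable_fun setT g by apply/measurable_EFinP.
have ig : (mu \x mu)%E.-integrable setT g.
  apply/(integrable12ltyP mu mu mg).
  apply: (@le_lt_trans _ _ (\int[mu]_x ((a x)%:E * (\int[mu]_y b y)%:E))%E).
    apply: ge0_le_integral => //.
    - by move=> x _; exact: integral_ge0.
    - apply: (measurable_fun_fubini_tonelli_F (m2 := mu) (abse \o g)) => //=.
      exact: measurableT_comp.
    - by apply: emeasurable_funM => //; exact: (measurable_int mu ia).
    - move=> x _.
      apply: (@le_trans _ _ (\int[mu]_y ((a x)%:E * (b y)%:E))%E).
        apply: ge0_le_integral => //.
        + by apply: measurableT_comp => //; apply/measurable_EFinP; exact: mGx.
        + by apply: emeasurable_funM => //; exact: (measurable_int mu ib).
        + by move=> y _; rewrite /= -EFinM lee_fin.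
      rewrite ge0_integralZl//; last 3 first.
      + exact: (measurable_int mu ib).
      + by move=> y _; rewrite lee_fin.
      + by rewrite lee_fin.
      rewrite /Rintegral fineK//; exact: integrable_fin_num.
  rewrite ge0_integralZr//; last 3 first.
  - exact: (measurable_int mu ia).
  - by move=> x _; rewrite lee_fin.
  - by rewrite lee_fin Rintegral_ge0.
  have fa : (\int[mu]_x (a x)%:E)%E \is a fin_num by exact: integrable_fin_num.
  by rewrite -(fineK fa) -EFinM ltry.
have EF x : (\int[mu]_y g (x, y))%E = (\int[mu]_y G x y)%:E.
  by rewrite /Rintegral fineK//; exact: integrable_fin_num.
have EG y : (\int[mu]_x g (x, y))%E = (\int[mu]_x G x y)%:E.
  by rewrite /Rintegral fineK//; exact: integrable_fin_num.
split.
- have := integrable_fubini_F ig; apply: eq_integrable => // x _.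
  exact: EF.
- have h := Fubini ig; rewrite /Rintegral.
  under eq_integral do rewrite -EF.
  by under [in RHS]eq_integral do rewrite -EG; rewrite h.
Qed.

(** The domination by a product makes the integrand integrable for the product
    measure. *)
Lemma cint_Fubini (F : R -> R -> C) (a b : R -> R) :
  measurable_fun setT (fun t : measurableTypeR R * measurableTypeR R => Re (F t.1 t.2)) ->
  measurable_fun setT (fun t : measurableTypeR R * measurableTypeR R => Im (F t.1 t.2)) ->
  mu.-integrable setT (EFin \o a) -> mu.-integrable setT (EFin \o b) ->
  (forall x, 0 <= a x) -> (forall y, 0 <= b y) ->
  (forall x y, normc (F x y) <= a x * b y) ->
  cintg setT (fun x => cint setT (F x)) /\
  cint setT (fun x => cint setT (F x)) = cint setT (fun y => cint setT (F ^~ y)).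
Proof.
move=> mr mi ia ib a0 b0 Fab.
have [i1 e1] := @real_Fubini (fun x y => Re (F x y)) a b mr ia ib a0 b0
  (fun x y => le_trans (ler_Re _) (Fab x y)).
have [i2 e2] := @real_Fubini (fun x y => Im (F x y)) a b mi ia ib a0 b0
  (fun x y => le_trans (ler_Im _) (Fab x y)).
by split; [split|apply: complex_ext].
Qed.

Lemma ge0_even_integral (g : R -> \bar R) : measurable_fun setT g ->
  (forall x, 0 <= g x)%E -> (forall x, g (- x) = g x) ->
  (\int[mu]_x g x = \int[mu]_(x in `[0%R, +oo[) g x + \int[mu]_(x in `[0%R, +oo[) g x)%E.
Proof.
move=> mg g0 eg.
have -> : [set: R] = `]-oo, 0%R] `|` `]0%R, +oo[.
  by apply/seteqP; split => // x _ /=; rewrite !in_itv/= andbT; case: (leP x 0) => h; [left|right].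
rewrite ge0_integral_setU//=; last 2 first.
- exact: measurable_funTS.
- by apply/disj_setPS => x /=; rewrite !in_itv/= andbT => -[]; lra.
congr (_ + _)%E.
- rewrite ge0_integration_by_substitution0//.
  by apply: eq_integral => x _; rewrite eg.
- by rewrite integral_itv_obnd_cbnd//; exact: measurable_funTS.
Qed.

Lemma even_integrable (f : R -> R) : measurable_fun setT f -> (forall x, f (- x) = f x) ->
  mu.-integrable `[0, +oo[ (EFin \o f) ->
  mu.-integrable setT (EFin \o f) /\
  \int[mu]_x f x = 2 * \int[mu]_(x in `[0, +oo[) f x.
Proof.
move=> mf ef fi; have mE : measurable_fun setT (EFin \o f) by exact/measurable_EFinP.
have ifin := @integrable_fin_num _ _ _ mu `[0%R, +oo[%classic _ _ fi.
split.
- apply/integrableP; split => //; rewrite ge0_even_integral.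
  + by have /integrableP[_ h] := fi; rewrite lte_add_pinfty.
  + exact: measurableT_comp.
  + by [].
  + by move=> x /=; rewrite ef.
- have mp : measurable_fun setT (EFin \o f)^\+%E by exact: measurable_funepos.
  have mn : measurable_fun setT (EFin \o f)^\-%E by exact: measurable_funeneg.
  have ip := integrable_pos_fin_num _ fi; have inn := integrable_neg_fin_num _ fi.
  rewrite /Rintegral integralE [in RHS]integralE.
  rewrite !ge0_even_integral//; last 2 first.
  + by move=> x; rewrite !funenegE/= ef.
  + by move=> x; rewrite !funeposE/= ef.
  rewrite -(fineK (ip _)) // -(fineK (inn _))//.
  by rewrite -!EFinD/=; ring.
Qed.

(** The positive and negative parts of the real and imaginary parts are even
    too, and for nonnegative functions the substitution of [- x] applies. *)
Lemma even_cint f : cmeas setT f -> (forall x, f (- x) = f x) -> cintg `[0, +oo[ f ->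
  cintg setT f /\ cint setT f = 2 * cint `[0, +oo[ f.
Proof.
move=> [m1 m2] ef [i1 i2].
have [j1 e1] := @even_integrable (fun x => Re (f x)) m1 (fun x => congr1 (@complex.Re R) (ef x)) i1.
have [j2 e2] := @even_integrable (fun x => Im (f x)) m2 (fun x => congr1 (@complex.Im R) (ef x)) i2.
split; first by split.
by rewrite natrC; apply: complex_ext; rewrite ?ReM ?ImM/= ?e1 ?e2 mul0r ?subr0 ?addr0.
Qed.

End FubiniParity.

(** * Straightening the contour *)

Section ContourShift.
Context {R : realType}.
Local Notation C := R[i].
Local Notation mu := (@lebesgue_measure R).
Implicit Types (a b c u y l : R) (s d : C).

Lemma ccvg_shift (v : nat -> C) N d : ccvg \oo (fun n => v (n + N)%N) d -> ccvg \oo v d.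
Proof.
move=> [h1 h2]; split.
- by rewrite -(cvg_shiftn N).
- by rewrite -(cvg_shiftn N).
Qed.

Lemma seg_bounded a b (v : R -> C) : seg_cont a b v ->
  exists2 M, 0 <= M & forall y, a <= y <= b -> normc (v y) <= M.
Proof.
move=> cv; have [|M M0 hM] := @rect_bounded R (fun _ y => v y) 0 0 a b.
  move=> s; have c := cv s.2; split.
  - by apply: (cvg_comp snd (fun t => Re (v (clip a b t)))); [exact: cvg_snd|exact: c.1].
  - by apply: (cvg_comp snd (fun t => Im (v (clip a b t)))); [exact: cvg_snd|exact: c.2].
by exists M => // y; apply: (hM 0); rewrite lexx.
Qed.

Lemma seg_contM a b (v w : R -> C) : seg_cont a b v -> seg_cont a b w ->
  seg_cont a b (fun y => v y * w y).
Proof. by move=> cv cw y; apply: ccvgM; [exact: cv|exact: cw]. Qed.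

Lemma cint_split a b c (f : R -> C) : a <= b -> b <= c -> cintg `[a, c] f ->
  cint `[a, c] f = cint `[a, b] f + cint `[b, c] f.
Proof.
move=> ab bc [f1 f2].
have E (g : R -> R) : mu.-integrable `[a, c] (EFin \o g) ->
    \int[mu]_(y in `[a, c]) g y = \int[mu]_(y in `[a, b]) g y + \int[mu]_(y in `[b, c]) g y.
  move=> ig; rewrite -(@Rintegral_itv_obnd_cbnd _ b).
    rewrite -(@Rintegral_itvB _ g (BLeft a) (BRight c) b ig) ?bnd_simp//.
    by rewrite addrC subrK.
  by apply: integrableS ig => //; apply: subset_itvr; rewrite bnd_simp.
by apply: complex_ext; rewrite ?ReD ?ImD /= E.
Qed.

Variables (p rho kap gam : R).
Hypotheses (p0 : 0 < p) (rho0 : 0 <= rho) (kap0 : 0 <= kap).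
Hypothesis rate0 : 0 < 2 * p + 1 - 2 * rho - kap.

Local Notation K := (kern p rho kap gam Gamma).
Local Notation Kn n := (kern p rho kap gam (eulerG n)).
Local Notation U := (pole_free p).

Lemma kern_seg_cont n a b (g : R -> C) : a <= b -> seg_cont a b g ->
  (forall y, a <= y <= b -> U (g y)) -> seg_cont a b (fun y => Kn n (g y)).
Proof.
move=> ab cg Ug y; apply: (holo_pcont (holo_kern rho kap gam p0 n)); last exact: cg.
by apply: Ug; exact: clip_in.
Qed.

(** Passage to the limit from Euler's sequence to Gamma in an integral over a
    compact piece of a path avoiding the poles: a fixed late term dominates. *)
Lemma kern_seg_limit a b (g m : R -> C) : a <= b -> seg_cont a b g -> seg_cont a b m ->
  (forall y, a <= y <= b -> U (g y)) ->
  cintg `[a, b] (fun y => K (g y) * m y) /\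
  ccvg \oo (fun n => cint `[a, b] (fun y => Kn n (g y) * m y)) (cint `[a, b] (fun y => K (g y) * m y)).
Proof.
move=> ab cg cm Ug; have [B B0 hB] := seg_bounded cg.
pose N := eulerN (argbound p rho kap gam B).
pose D : R := expR (2 * eulerD (argbound p rho kap gam B)) ^+ 6.
pose h y : R := D * normc (Kn N (g y) * m y).
have sc n : seg_cont a b (fun y => Kn n (g y) * m y).
  by apply: seg_contM => //; exact: kern_seg_cont.
have ih : mu.-integrable `[a, b] (EFin \o h).
  have -> : EFin \o h = (fun y => D%:E * (normc (Kn N (g y) * m y))%:E)%E.
    by apply/funext => y; rewrite /= EFinM.
  by apply: integrableZl => //; apply: cintg_normc => //; exact: seg_cintg.
have cv y : ccvg \oo (fun n => Kn (n + N)%N (g y) * m y) (K (g y) * m y).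
  apply: ccvgM; last exact: ccvg_cst.
  have [c1 c2] := kern_cvg p rho kap gam (g y); split.
  - by rewrite (cvg_shiftn N (fun n => Re (Kn n (g y)))).
  - by rewrite (cvg_shiftn N (fun n => Im (Kn n (g y)))).
have mn n : cmeas `[a, b] (fun y => Kn (n + N)%N (g y) * m y).
  by apply: cintg_cmeas; exact: seg_cintg.
have yab y : `[a, b]%classic y -> a <= y <= b by rewrite /= in_itv.
split; last first.
  apply: (@ccvg_shift _ N).
  apply: (@cint_dct _ `[a, b] (fun n y => Kn (n + N)%N (g y) * m y) _ h) => //.
  move=> n y /yab ab'; rewrite /h (normcM (Kn (n + N)%N _)) (normcM (Kn N _)) mulrA ler_wpM2r ?normc_ge0//.
  by apply: kern_le => //; [exact: hB|exact: leq_addl].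
apply: (cintg_le _ _ ih) => //.
  by apply: (cmeas_cvg mn) => y _; exact: cv.
move=> y /yab ab'; rewrite /h (normcM (K _)) (normcM (Kn N _)) mulrA ler_wpM2r ?normc_ge0//.
by apply: kern_Gamma_le => //; exact: hB.
Qed.

Lemma kern_seg_bounded a b (g : R -> C) : a <= b -> seg_cont a b g ->
  (forall y, a <= y <= b -> U (g y)) ->
  exists2 M, 0 <= M & forall y, a <= y <= b -> normc (K (g y)) <= M.
Proof.
move=> ab cg Ug; have [B B0 hB] := seg_bounded cg.
pose N := eulerN (argbound p rho kap gam B).
have [M M0 hM] := seg_bounded (kern_seg_cont N ab cg Ug).
exists (expR (2 * eulerD (argbound p rho kap gam B)) ^+ 6 * M).
  by rewrite mulr_ge0// exprn_ge0// expR_ge0.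
move=> y yab; apply: (le_trans (kern_Gamma_le p0 rho0 kap0 (hB y yab) (leqnn N))).
by rewrite ler_wpM2l ?hM// exprn_ge0// expR_ge0.
Qed.

Lemma kern_path_cmeas D (g : R -> C) :
  (forall y, ccvg (nbhs y) g (g y)) -> (forall y, U (g y)) -> measurable D ->
  cmeas D (fun y => K (g y)).
Proof.
move=> cg Ug mD; apply: (@cmeas_cvg _ _ _ D (fun n y => Kn n (g y))); last first.
  by move=> y _; exact: kern_cvg.
move=> n; have c y : ccvg (nbhs y) (fun t => Kn n (g t)) (Kn n (g y)).
  by apply: (holo_pcont (holo_kern rho kap gam p0 n)).
split; apply: measurable_funTS; apply: continuous_measurable_fun => y.
- exact: (c y).1.
- exact: (c y).2.
Qed.

(** Cauchy's theorem holds for the kernels built from Euler's sequence, and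
    both sides pass to the limit. *)
Lemma kern_sweep u (sigma sigma' : R -> R) (x0 a b : R) : a < b ->
  (forall y, is_derive y (1:R) sigma (sigma' y)) -> continuous sigma' ->
  (forall l y, 0 <= l <= 1 -> U (sweep sigma x0 l y)) ->
  cint `[a, b] (fun y => K (sigma y +i* y) * cpow u (- (sigma y +i* y)) * (sigma' y +i* 1)) -
  cint `[a, b] (fun y => K (x0 +i* y) * cpow u (- (x0 +i* y)) * (0 +i* 1)) =
  cint `[0, 1] (fun l => K (sweep sigma x0 l b) * cpow u (- sweep sigma x0 l b) * (sigma b - x0)%:C) -
  cint `[0, 1] (fun l => K (sweep sigma x0 l a) * cpow u (- sweep sigma x0 l a) * (sigma a - x0)%:C).
Proof.
move=> ab ds cs' Us; have ab' := ltW ab.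
have cs : continuous sigma.
  by move=> y; apply: differentiable_continuous; apply/derivable1_diffP; have [] := ds y.
have cpw T (F : set_system T) (FF : Filter F) (q : T -> C) s : ccvg F q s ->
    ccvg F (fun t => cpow u (- q t)) (cpow u (- s)).
  by move=> qs; apply: ccvg_cexp; apply: ccvgM; [exact: ccvgN|exact: ccvg_cst].
have s1 y : sweep sigma x0 1 y = sigma y +i* y by rewrite /sweep mul1r addrC subrK.
have s0 y : sweep sigma x0 0 y = x0 +i* y by rewrite /sweep mul0r addr0.
have in1 : 0 <= (1:R) <= 1 by rewrite ler01 lexx.
have in0 : 0 <= (0:R) <= 1 by rewrite ler01 lexx.
have cg l : seg_cont a b (sweep sigma x0 l).
  by move=> y; apply: (sweep_ccvg x0 ds); [exact: cvg_cst|exact: clip_cvg].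
have ch y : seg_cont 0 1 (sweep sigma x0 ^~ y).
  by move=> l; apply: (sweep_ccvg x0 ds); [exact: clip_cvg|exact: cvg_cst].
have m1 : seg_cont a b (fun y => cpow u (- sweep sigma x0 1 y) * (sigma' y +i* 1)).
  apply: seg_contM => y; first by apply: cpw; exact: cg.
  apply: ccvg_reim; last exact: cvg_cst.
  by apply: cvg_comp (@clip_cvg R a b y) _; exact: cs'.
have m0 : seg_cont a b (fun y => cpow u (- sweep sigma x0 0 y) * (0 +i* 1)).
  by apply: seg_contM => y; [apply: cpw; exact: cg|exact: ccvg_cst].
have mh y : seg_cont 0 1 (fun l => cpow u (- sweep sigma x0 l y) * (sigma y - x0)%:C).
  by apply: seg_contM => l; [apply: cpw; exact: ch|exact: ccvg_cst].
have Uab l : 0 <= l <= 1 -> forall y, a <= y <= b -> U (sweep sigma x0 l y).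
  by move=> l01 y _; exact: Us.
have U01 y : forall l, 0 <= l <= 1 -> U (sweep sigma x0 l y).
  by move=> l l01; exact: Us.
have [_ c1] := kern_seg_limit ab' (cg 1) m1 (Uab 1 in1).
have [_ c0] := kern_seg_limit ab' (cg 0) m0 (Uab 0 in0).
have [_ hb] := kern_seg_limit ler01 (ch b) (mh b) (U01 b).
have [_ ha] := kern_seg_limit ler01 (ch a) (mh a) (U01 a).
pose proof (ccvgB c1 c0) as L; pose proof (ccvgB hb ha) as Rr.
have E n : cint `[a, b] (fun y => Kn n (sweep sigma x0 1 y) * (cpow u (- sweep sigma x0 1 y) * (sigma' y +i* 1))) -
  cint `[a, b] (fun y => Kn n (sweep sigma x0 0 y) * (cpow u (- sweep sigma x0 0 y) * (0 +i* 1))) =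
  cint `[0, 1] (fun l => Kn n (sweep sigma x0 l b) * (cpow u (- sweep sigma x0 l b) * (sigma b - x0)%:C)) -
  cint `[0, 1] (fun l => Kn n (sweep sigma x0 l a) * (cpow u (- sweep sigma x0 l a) * (sigma a - x0)%:C)).
  have hf : holo U (fun s => Kn n s * cpow u (- s)).
    apply: holoM; first exact: holo_kern.
    have -> : (fun s => cpow u (- s)) = (fun s => cexp (- (ln u)%:C * s + 0)).
      by apply/funext => s; rewrite /cpow addr0 mulNr mulNr mulrC.
    exact: holo_cexp_affine.
  have [f' hf'] := hf.
  have := @cauchy_sweep R (fun s => Kn n s * cpow u (- s)) f' sigma sigma' x0 a b ab ds cs'.
  have X : forall l y, 0 <= l <= 1 -> a < y < b ->
      cara (fun s => Kn n s * cpow u (- s)) (sweep sigma x0 l y) (f' (sweep sigma x0 l y)) /\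
      pcont f' (sweep sigma x0 l y).
    by move=> l y l01 _; apply: hf'; exact: Us.
  have Y : forall l y, 0 <= l <= 1 -> a <= y <= b ->
      pcont (fun s => Kn n s * cpow u (- s)) (sweep sigma x0 l y).
    by move=> l y l01 _; apply: (holo_pcont hf); exact: Us.
  move=> /(_ X Y) e.
  transitivity (cint `[a, b] (fun y => Kn n (sigma y +i* y) * cpow u (- (sigma y +i* y)) * (sigma' y +i* 1)) -
    cint `[a, b] (fun y => Kn n (x0 +i* y) * cpow u (- (x0 +i* y)) * (0 +i* 1))).
    by congr (_ - _); apply: eq_cint => y _; rewrite ?s1 ?s0 mulrA.
  by rewrite e; congr (_ - _); apply: eq_cint => l _; rewrite mulrA.
have {}L : ccvg \oo (fun n => cint `[0, 1] (fun l => Kn n (sweep sigma x0 l b) * (cpow u (- sweep sigma x0 l b) * (sigma b - x0)%:C)) -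
  cint `[0, 1] (fun l => Kn n (sweep sigma x0 l a) * (cpow u (- sweep sigma x0 l a) * (sigma a - x0)%:C)))
   (cint `[a, b] (fun y => K (sweep sigma x0 1 y) * (cpow u (- sweep sigma x0 1 y) * (sigma' y +i* 1))) -
    cint `[a, b] (fun y => K (sweep sigma x0 0 y) * (cpow u (- sweep sigma x0 0 y) * (0 +i* 1)))).
  by apply: (ccvg_near _ L); apply: nearW => n; rewrite E.
have e := ccvg_unique L Rr.
transitivity (cint `[a, b] (fun y => K (sweep sigma x0 1 y) * (cpow u (- sweep sigma x0 1 y) * (sigma' y +i* 1))) -
    cint `[a, b] (fun y => K (sweep sigma x0 0 y) * (cpow u (- sweep sigma x0 0 y) * (0 +i* 1)))).
  by congr (_ - _); apply: eq_cint => y _; rewrite ?s1 ?s0 mulrA.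
by rewrite e; congr (_ - _); apply: eq_cint => l _; rewrite mulrA.
Qed.

Lemma derive_locally_cst (sigma : R -> R) (y s' : R) : is_derive y (1:R) sigma s' ->
  (\forall t \near y, sigma t = sigma y) -> s' = 0.
Proof.
move=> ds sc; have := @near_eq_is_derive _ _ _ sigma (fun=> sigma y) y 1 s' sc ds.
by move=> [_ <-]; rewrite derive_cst.
Qed.

Lemma normc_i1 : normc (0 +i* 1 : C) = 1.
Proof. by rewrite normcE2/= expr0n/= add0r expr1n sqrtr1. Qed.

(** The contour is a compact piece, on which the integrand is bounded, and two
    vertical half-lines, on which the kernel decays exponentially. *)
Lemma kern_contour_cintg u (sigma sigma' : R -> R) (c0 M : R) :
  (forall y, is_derive y (1:R) sigma (sigma' y)) -> continuous sigma' ->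
  (forall y, U (sigma y +i* y)) ->
  (forall y, M <= `|y| -> sigma y = c0) ->
  cintg setT (fun y => K (sigma y +i* y) * cpow u (- (sigma y +i* y)) * (sigma' y +i* 1)).
Proof.
move=> ds cs' Us sM.
have cs : continuous sigma.
  by move=> y; apply: differentiable_continuous; apply/derivable1_diffP; have [] := ds y.
have cg y : ccvg (nbhs y) (fun t => sigma t +i* t) (sigma y +i* y).
  by apply: ccvg_reim; [exact: cs|exact: cvg_id].
have [D [e [T [D0 e0 T0 hD]]]] := kern_decay gam p0 rho0 kap0 rate0 `|c0|.
pose m y := cpow u (- (sigma y +i* y)) * (sigma' y +i* 1).
have cm y : ccvg (nbhs y) m (m y).
  apply: ccvgM.
    by apply: ccvg_cexp; apply: ccvgM; [apply: ccvgN; exact: cg|exact: ccvg_cst].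
  by apply: ccvg_reim; [exact: cs'|exact: cvg_cst].
pose T1 := `|M| + T + 1.
have T10 : 0 <= T1 by rewrite /T1 !addr_ge0// ltW.
have NT1 : - T1 <= T1 by lra.
have clipc a b (v : R -> C) : (forall y, ccvg (nbhs y) v (v y)) -> seg_cont a b v.
  move=> cv y; split.
  - by apply: (cvg_comp (clip a b) (fun t => Re (v t)) (@clip_cvg R a b y)); exact: (cv _).1.
  - by apply: (cvg_comp (clip a b) (fun t => Im (v t)) (@clip_cvg R a b y)); exact: (cv _).2.
have [M1 M10 hM1] := kern_seg_bounded NT1 (clipc _ _ _ cg) (fun y _ => Us y).
have [M2 M20 hM2] := seg_bounded (clipc (- T1) T1 _ cm).
pose E := D * expR (- c0 * ln u) + M1 * M2 * expR (e * T1).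
have E1 : 0 <= D * expR (- c0 * ln u) by rewrite mulr_ge0 ?expR_ge0.
have E2 : 0 <= M1 * M2 * expR (e * T1) by rewrite !mulr_ge0 ?expR_ge0.
have i : mu.-integrable setT (EFin \o (fun y : R => E * expR (- (e * `|y|)))).
  rewrite /comp; under eq_fun do rewrite EFinM; apply: integrableZl => //.
  exact: integrable_expdecay.
apply: (cintg_le _ _ i) => //.
  have -> : (fun y => K (sigma y +i* y) * cpow u (- (sigma y +i* y)) * (sigma' y +i* 1)) =
      (fun y => K (sigma y +i* y) * m y) by apply/funext => y; rewrite mulrA.
  apply: cmeasM; first exact: kern_path_cmeas.
  by split; apply: continuous_measurable_fun => y; [exact: (cm y).1|exact: (cm y).2].
move=> y _; rewrite -mulrA (normcM (K _)) -/(m y).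
have [yT|yT] := leP `|y| T1.
  have yT' : - T1 <= y <= T1 by rewrite -ler_norml.
  apply: (@le_trans _ _ (M1 * M2)); first by apply: ler_pM; rewrite ?normc_ge0 ?hM1 ?hM2.
  apply: (@le_trans _ _ (M1 * M2 * expR (e * T1) * expR (- (e * `|y|)))).
    by rewrite -mulrA -expRD ler_peMr ?mulr_ge0// -expR0 ler_expR -mulrBr mulr_ge0 ?(ltW e0)// subr_ge0.
  by rewrite ler_wpM2r ?expR_ge0// lerDr.
have yM : M < `|y|.
  by apply: le_lt_trans yT; rewrite /T1; have := ler_norm M; lra.
have s'0 : sigma' y = 0.
  apply: derive_locally_cst (ds y) _.
  have : \forall t \near y, M < `|t|.
    have hn : `|t| @[t --> y] --> `|y| by apply: cvg_norm; exact: cvg_id.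
    exact: (cvgr_gt _ hn).
  by apply: filterS => t Mt; rewrite !sM// ltW.
have yT2 : T <= `|y| by rewrite (le_trans _ (ltW yT))// /T1; have := normr_ge0 M; lra.
rewrite /m s'0 (normcM (cpow _ _)) normc_i1 mulr1 normc_cpow !reimE/= (sM y (ltW yM)).
apply: (@le_trans _ _ (D * expR (- (e * `|y|)) * expR (- c0 * ln u))).
  by rewrite ler_wpM2r ?expR_ge0//; apply: hD.
rewrite mulrAC ler_wpM2r ?expR_ge0// lerDl//.
Qed.

Lemma expR_decay_nat (e D : R) : 0 < e -> D * expR (- (e * n%:R)) @[n --> \oo] --> (0 : R).
Proof.
move=> e0; rewrite -(mulr0 D); apply: cvgMr; apply: (cvg_comp _ _ _ (@cvgr_expR R)).
apply/cvgryPge => A; near=> n; rewrite mulrC -ler_pdivrMr//.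
near: n; exact: nbhs_infty_ger.
Unshelve. all: by end_near. Qed.

Lemma cint01_normc_le (f : R -> C) (M : R) : cintg `[0, 1] f ->
  (forall l, 0 <= l <= 1 -> normc (f l) <= M) -> normc (cint `[0, 1] f) <= 2 * M.
Proof.
move=> fi fM.
have i : mu.-integrable `[0, 1] (EFin \o cst M).
  apply: continuous_compact_integrable; first exact: segment_compact.
  by apply: continuous_subspaceT => x; exact: cvg_cst.
have := @cint_normc_le _ `[0, 1] f (cst M) _ (cintg_cmeas fi) i.
have E : mu `[0, 1]%classic = 1%E.
  by rewrite lebesgue_measure_itv/= lte_fin ltr01 oppr0 adde0.
have -> : \int[mu]_(l in `[0, 1]) cst M l = M.
  transitivity (M * fine (mu `[0, 1]%classic)); last by rewrite E mulr1.
  exact: Rintegral_cst.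
exact.
Qed.

(** The horizontal integrals at heights [n] and [- n] tend to [0], so the
    contour may be replaced by any line that can be swept onto it without meeting
    a pole. *)
Lemma kern_contour_shift u (sigma sigma' : R -> R) (c c0 M : R) :
  (forall y, is_derive y (1:R) sigma (sigma' y)) -> continuous sigma' ->
  (forall l y, 0 <= l <= 1 -> U (sweep sigma c l y)) ->
  (forall y, M <= `|y| -> sigma y = c0) ->
  cint setT (fun y => K (sigma y +i* y) * cpow u (- (sigma y +i* y)) * (sigma' y +i* 1)) =
  cint setT (fun y => K (c +i* y) * cpow u (- (c +i* y)) * (0 +i* 1)).
Proof.
move=> ds cs' Us sM.
have s1 y : sweep sigma c 1 y = sigma y +i* y by rewrite /sweep mul1r addrC subrK.
have s0 y : sweep sigma c 0 y = c +i* y by rewrite /sweep mul0r addr0.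
have in1 : 0 <= (1:R) <= 1 by rewrite ler01 lexx.
have in0 : 0 <= (0:R) <= 1 by rewrite ler01 lexx.
have i1 := @kern_contour_cintg u sigma sigma' c0 M ds cs' (fun y => eq_ind _ U (Us 1 y in1) _ (s1 y)) sM.
have i0 : cintg setT (fun y => K (c +i* y) * cpow u (- (c +i* y)) * (0 +i* 1)).
  apply: (@kern_contour_cintg u (fun=> c) (fun=> 0) c 0) => // y.
  - exact: cvg_cst.
  - by rewrite -s0; exact: Us.
have l1 := cint_lim_seg i1; have l0 := cint_lim_seg i0.
pose proof (ccvgB l1 l0) as L.
suff Z : ccvg \oo (fun n : nat => cint `[- n%:R, n%:R] (fun y => K (sigma y +i* y) * cpow u (- (sigma y +i* y)) * (sigma' y +i* 1)) -
   cint `[- n%:R, n%:R] (fun y => K (c +i* y) * cpow u (- (c +i* y)) * (0 +i* 1))) 0.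
  by apply/eqP; rewrite -subr_eq0; apply/eqP; exact: ccvg_unique L Z.
pose B := `|c| + `|c0|.
have [D [e [T [D0 e0 T0 hD]]]] := kern_decay gam p0 rho0 kap0 rate0 B.
pose E := D * expR (B * `|ln u|) * (`|c0| + `|c|).
have ch y : seg_cont 0 1 (sweep sigma c ^~ y).
  by move=> l; apply: (sweep_ccvg c ds); [exact: clip_cvg|exact: cvg_cst].
have hor (y : R) : M <= `|y| -> T <= `|y| ->
   normc (cint `[0, 1] (fun l => K (sweep sigma c l y) * cpow u (- sweep sigma c l y) * (sigma y - c)%:C))
     <= 2 * (E * expR (- (e * `|y|))).
  move=> My Ty; apply: cint01_normc_le.
    have m : seg_cont 0 1 (fun l => cpow u (- sweep sigma c l y) * (sigma y - c)%:C).
      apply: seg_contM => l; last exact: ccvg_cst.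
      by apply: ccvg_cexp; apply: ccvgM; [apply: ccvgN; exact: ch|exact: ccvg_cst].
    have [i _] := kern_seg_limit ler01 (ch y) m (fun l => Us l y).
    by apply: eq_cintg i => // l _; rewrite mulrA.
  move=> l /andP[l0' l1']; rewrite normcM (normcM (K _)) normc_cpow normc_real sM//.
  have rB : `|c + l * (c0 - c)| <= B.
    have -> : c + l * (c0 - c) = (1 - l) * c + l * c0 by ring.
    apply: (le_trans (ler_normD _ _)); rewrite !normrM; apply: lerD.
    - by rewrite ler_piMl// ger0_norm; lra.
    - by rewrite ler_piMl// ger0_norm; lra.
  have -> : E * expR (- (e * `|y|)) = D * expR (- (e * `|y|)) * expR (B * `|ln u|) * (`|c0| + `|c|).
    by rewrite /E; ring.
  apply: ler_pM; rewrite ?mulr_ge0 ?normc_ge0 ?expR_ge0//; last exact: ler_normB.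
  apply: ler_pM; rewrite ?normc_ge0 ?expR_ge0//.
  - by apply: hD; rewrite /sweep/= ?sM.
  - rewrite ler_expR !reimE /sweep/= sM// (le_trans (ler_norm _))// normrM normrN.
    by rewrite ler_wpM2r.
apply: (@ccvg_of_normc _ _ _ _ _ _ (fun n => 4 * E * expR (- (e * n%:R)))); last exact: expR_decay_nat.
near=> n; rewrite subr0.
have nn : - n%:R < n%:R :> R by rewrite gtrN ?ltr0n//; near: n; exact: nbhs_infty_gt.
rewrite kern_sweep//.
have Mn : M <= n%:R.
  by near: n; exact: nbhs_infty_ger.
have Tn : T <= n%:R.
  by near: n; exact: nbhs_infty_ger.
have a1 : `|n%:R : R| = n%:R by rewrite ger0_norm.
have a2 : `|- n%:R : R| = n%:R by rewrite normrN a1.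
have h1 := hor n%:R; have h2 := hor (- n%:R); rewrite a1 in h1; rewrite a2 in h2.
apply: (le_trans (le_normcD _ _)); rewrite normcN.
by have := h1 Mn Tn; have := h2 Mn Tn; lra.
Unshelve. all: by end_near. Qed.

End ContourShift.

(** * Cauchy's integral formula on rectangles *)

Section CauchyFormula.
Context {R : realType}.
Local Notation C := R[i].
Local Notation mu := (@lebesgue_measure R).
Implicit Types (a b c h y l e : R) (s d : C) (f g : C -> C).

Lemma cint_lin D (u v : R -> C) d : measurable D -> cintg D u -> cintg D v ->
  cint D (fun y => u y - d * v y) = cint D u - d * cint D v.
Proof.
move=> mD ui vi; rewrite -cintZ//; apply: cintB => //.
exact: cintgZ.
Qed.

(** The integral of [g s] along the boundary of the rectangle
    [c1 <= Re s <= c2], [a <= Im s <= b], counterclockwise. *)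
Definition rect_int c1 c2 a b g : C :=
  cint `[a, b] (fun y => g (c2 +i* y) * (0 +i* 1)) -
  cint `[a, b] (fun y => g (c1 +i* y) * (0 +i* 1)) -
  (cint `[0, 1] (fun l => g (sweep (fun=> c2) c1 l b) * (c2 - c1)%:C) -
   cint `[0, 1] (fun l => g (sweep (fun=> c2) c1 l a) * (c2 - c1)%:C)).

Definition on_rect c1 c2 a b s : Prop :=
  [/\ c1 <= Re s <= c2, a <= Im s <= b &
    [\/ Re s = c1, Re s = c2, Im s = a | Im s = b]].

Lemma sweep_line_in c1 c2 l y : c1 <= c2 -> 0 <= l <= 1 ->
  c1 <= Re (sweep (fun=> c2) c1 l y) <= c2.
Proof.
move=> c12 /andP[l0 l1] /=; have k : 0 <= c2 - c1 by rewrite subr_ge0.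
rewrite lerDl mulr_ge0//=.
have : l * (c2 - c1) <= 1 * (c2 - c1) by rewrite ler_wpM2r.
lra.
Qed.

Section Rectangle.
Variables (c1 c2 a b : R).
Hypotheses (c12 : c1 <= c2) (ab : a <= b).

Let on1 y : a <= y <= b -> on_rect c1 c2 a b (c1 +i* y).
Proof. by move=> yab; split=> //=; rewrite ?lexx//; constructor 1. Qed.
Let on2 y : a <= y <= b -> on_rect c1 c2 a b (c2 +i* y).
Proof. by move=> yab; split=> //=; rewrite ?lexx ?andbT//; constructor 2. Qed.
Let on3 l : 0 <= l <= 1 -> on_rect c1 c2 a b (sweep (fun=> c2) c1 l a).
Proof. by move=> l01; split; [exact: sweep_line_in|rewrite /= lexx|constructor 3]. Qed.
Let on4 l : 0 <= l <= 1 -> on_rect c1 c2 a b (sweep (fun=> c2) c1 l b).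
Proof. by move=> l01; split; [exact: sweep_line_in|rewrite /= lexx andbT|constructor 4]. Qed.

Lemma eq_rect_int f g : (forall s, on_rect c1 c2 a b s -> f s = g s) ->
  rect_int c1 c2 a b f = rect_int c1 c2 a b g.
Proof.
move=> fg; rewrite /rect_int; congr (_ - _ - (_ - _)); apply: eq_cint => y;
  rewrite /= in_itv/= => hy; congr (_ * _); apply: fg.
- exact: on2.
- exact: on1.
- exact: on4.
- exact: on3.
Qed.

Lemma seg_cont_vertical g c u v : (forall y, u <= y <= v -> pcont g (c +i* y)) -> u <= v ->
  seg_cont u v (fun y => g (c +i* y)).
Proof.
move=> gc uv y; apply: gc; first exact: clip_in.
by apply: ccvg_reim; [exact: cvg_cst|exact: clip_cvg].
Qed.

Lemma seg_cont_horizontal g y : (forall l, 0 <= l <= 1 -> pcont g (sweep (fun=> c2) c1 l y)) ->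
  seg_cont 0 1 (fun l => g (sweep (fun=> c2) c1 l y)).
Proof.
move=> gc l; apply: gc; first exact: (clip_in _ ler01).
by apply: (sweep_ccvg c1 (fun y => rder_cst c2 y)); [exact: clip_cvg|exact: cvg_cst].
Qed.

Let seg_contZ u v (w : R -> C) d : seg_cont u v w -> seg_cont u v (fun y => w y * d).
Proof. by move=> cw; apply: seg_contM => // y; exact: ccvg_cst. Qed.

Lemma rect_int_lin f g d :
  (forall s, on_rect c1 c2 a b s -> pcont f s) ->
  (forall s, on_rect c1 c2 a b s -> pcont g s) ->
  rect_int c1 c2 a b (fun s => f s - d * g s) =
  rect_int c1 c2 a b f - d * rect_int c1 c2 a b g.
Proof.
move=> fc gc.
have V k (kc : forall y, a <= y <= b -> on_rect c1 c2 a b (k +i* y)) :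
    cint `[a, b] (fun y => (f (k +i* y) - d * g (k +i* y)) * (0 +i* 1)) =
    cint `[a, b] (fun y => f (k +i* y) * (0 +i* 1)) - d * cint `[a, b] (fun y => g (k +i* y) * (0 +i* 1)).
  rewrite -cint_lin//.
  - by apply: eq_cint => y _; rewrite mulrBl mulrA.
  - by apply: seg_cintg; apply: seg_contZ; apply: seg_cont_vertical => // y yab; exact/fc/kc.
  - by apply: seg_cintg; apply: seg_contZ; apply: seg_cont_vertical => // y yab; exact/gc/kc.
have H k (kc : forall l, 0 <= l <= 1 -> on_rect c1 c2 a b (sweep (fun=> c2) c1 l k)) :
    cint `[0, 1] (fun l => (f (sweep (fun=> c2) c1 l k) - d * g (sweep (fun=> c2) c1 l k)) * (c2 - c1)%:C) =
    cint `[0, 1] (fun l => f (sweep (fun=> c2) c1 l k) * (c2 - c1)%:C) -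
      d * cint `[0, 1] (fun l => g (sweep (fun=> c2) c1 l k) * (c2 - c1)%:C).
  rewrite -cint_lin//.
  - by apply: eq_cint => y _; rewrite mulrBl mulrA.
  - by apply: seg_cintg; apply: seg_contZ; apply: seg_cont_horizontal => l l01; exact/fc/kc.
  - by apply: seg_cintg; apply: seg_contZ; apply: seg_cont_horizontal => l l01; exact/gc/kc.
by rewrite /rect_int V// V// H// H//; ring.
Qed.

(** Differentiability may fail on the horizontal line of height [h]: the
    theorem is applied below and above that line, up to which [g] is continuous. *)
Lemma rect_int_eq0 g g' h : a < h < b ->
  (forall c y, c1 <= c <= c2 -> a <= y <= b -> pcont g (c +i* y)) ->
  (forall c y, c1 <= c <= c2 -> a < y < b -> y != h ->
     cara g (c +i* y) (g' (c +i* y)) /\ pcont g' (c +i* y)) ->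
  rect_int c1 c2 a b g = 0.
Proof.
move=> /andP[ah hb] gc gd.
have dc y : is_derive y (1:R) (fun=> c2) 0 by exact: rder_cst.
have cc : continuous (fun _ : R => 0 : R) by move=> y; exact: cvg_cst.
have S l y : 0 <= l <= 1 -> c1 <= c1 + l * (c2 - c1) <= c2 by move=> /(sweep_line_in y c12).
have half u v : a <= u -> u < v -> v <= b -> v <= h \/ h <= u ->
    cint `[u, v] (fun y => g (c2 +i* y) * (0 +i* 1)) -
    cint `[u, v] (fun y => g (c1 +i* y) * (0 +i* 1)) =
    cint `[0, 1] (fun l => g (sweep (fun=> c2) c1 l v) * (c2 - c1)%:C) -
    cint `[0, 1] (fun l => g (sweep (fun=> c2) c1 l u) * (c2 - c1)%:C).
  move=> au uv vb uh; apply: (@cauchy_sweep R g g' (fun=> c2) (fun=> 0) c1 u v uv dc cc).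
  - move=> l y l01 /andP[y1 y2]; apply: gd; first exact: (S l y).
    + by apply/andP; split; lra.
    + by case: uh => uh; [rewrite lt_eqF//; lra|rewrite gt_eqF//; lra].
  - move=> l y l01 /andP[y1 y2]; apply: gc; first exact: (S l y).
    by apply/andP; split; lra.
have e1 := half a h (lexx a) ah (ltW hb) (or_introl (lexx h)).
have e2 := half h b (ltW ah) hb (lexx b) (or_intror (lexx h)).
have V k : c1 <= k <= c2 -> cint `[a, b] (fun y => g (k +i* y) * (0 +i* 1)) =
    cint `[a, h] (fun y => g (k +i* y) * (0 +i* 1)) + cint `[h, b] (fun y => g (k +i* y) * (0 +i* 1)).
  move=> k12; apply: cint_split; rewrite ?ltW//.
  by apply: seg_cintg; apply: seg_contZ; apply: seg_cont_vertical => // y yab; exact: gc.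
rewrite /rect_int !V ?lexx ?c12//.
move: e1 e2; set v1 := cint _ _; set v2 := cint _ _; set v3 := cint _ _; set v4 := cint _ _.
move=> e1; set w1 := cint _ _; set w2 := cint _ _; set w3 := cint _ _ => e2.
have -> : v1 + w1 - (v2 + w2) - (w3 - v4) = (v1 - v2) + (w1 - w2) - (w3 - v4) by ring.
by rewrite e1 e2; ring.
Qed.

End Rectangle.

(** The difference quotient of [f] at the point, extended by the derivative,
    is continuous on the rectangle and differentiable off the point, so its
    boundary integral vanishes. *)
Lemma cauchy_rect (U : set C) f c1 c2 a b d : holo U f ->
  (forall s, c1 <= Re s <= c2 -> a <= Im s <= b -> U s) ->
  c1 < Re d < c2 -> a < Im d < b ->
  rect_int c1 c2 a b (fun s => f s * (s - d)^-1) =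
  f d * rect_int c1 c2 a b (fun s => (s - d)^-1).
Proof.
move=> hf Us /andP[d1 d2] /andP[d3 d4].
have c12 : c1 <= c2 by lra. have ab : a <= b by lra.
have Ud : U d by apply: Us; apply/andP; split; lra.
have [f' ff'] := hf.
pose G s := (f s - f d) * (s - d)^-1.
pose V : set C := [set s | U s /\ s != d].
have hG : holo V G.
  apply: holoM.
    by apply: holoB; [apply: (holoS _ hf) => s []|exact: holo_cst].
  apply: holoV; first by move=> s [_ sd]; rewrite subr_eq0.
  have -> : (fun s => s - d) = (fun s => 1 * s + - d) by apply/funext => s; rewrite mul1r.
  exact: holo_affine.
have [G' GG'] := hG.
pose F s := if s == d then f' d else G s.
have FG s : s != d -> F s = G s by rewrite /F => /negbTE ->.
have near_d s : s != d -> forall (T : Type) (FF : set_system T), Filter FF -> forall q : T -> C,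
    ccvg FF q s -> \forall t \near FF, G (q t) = F (q t).
  move=> sd T FF fFF q qs.
  have h : ccvg FF (fun t => q t - d) (s - d) by apply: (ccvgB qs); exact: ccvg_cst.
  have sd0 : s - d != 0 by rewrite subr_eq0.
  have hn : \forall t \near FF, q t - d != 0 by exact: ccvg_near_neq0 sd0 h.
  by apply: filterS hn => t; rewrite subr_eq0 => qd; rewrite FG.
have Fpc s : U s -> pcont F s.
  move=> Us'; have [->|sd] := eqVneq s d.
    move=> T FF fFF q qd; have [[phi [phid cphi nphi]] _] := ff' d Ud.
    have h := cphi T FF fFF q qd; rewrite /F eqxx -phid.
    apply: (ccvg_near _ h); have := nphi T FF fFF q qd; apply: filterS => t e.
    by case: eqVneq => [->//|qd0]; rewrite /G e mulfK// subr_eq0.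
  apply: (pcont_near (near_d s sd)); first by rewrite FG.
  by apply: (holo_pcont hG).
have nd s : on_rect c1 c2 a b s -> s != d.
  by case=> _ _ h; apply/eqP => sd; move: h; rewrite sd => -[]; lra.
have Z : rect_int c1 c2 a b F = 0.
  apply: (@rect_int_eq0 c1 c2 a b c12 ab F G' (Im d)); rewrite ?d3 ?d4//.
  - by move=> c y cc yy; apply: Fpc; exact: Us.
  - move=> c y cc /andP[y1 y2] yd; have sd : c +i* y != d.
      by apply: contra_neq yd => <-.
    have Vs : V (c +i* y) by split=> //; apply: Us => //=; rewrite !ltW.
    have [h1 h2] := GG' _ Vs; split=> //.
    by apply: cara_near h1; [exact: near_d|rewrite FG].
have E : rect_int c1 c2 a b F =
    rect_int c1 c2 a b (fun s => f s * (s - d)^-1 - f d * (s - d)^-1).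
  apply: eq_rect_int => // s /nd sd; rewrite FG// /G mulrBl//.
have qc s : on_rect c1 c2 a b s -> pcont (fun s => (s - d)^-1) s.
  move=> /nd sd; apply: pcontV; first by rewrite subr_eq0.
  by apply: pcontD; [exact: pcont_id|exact: pcont_cst].
move: Z; rewrite E rect_int_lin//; first by move/eqP; rewrite subr_eq0 => /eqP.
move=> s os; apply: pcontM; last exact: qc.
by case: os => o1 o2 _; apply: (holo_pcont hf); exact: Us.
Qed.

End CauchyFormula.

(** * Cauchy's formula for the kernel on a strip *)

Section KernelCauchy.
Context {R : realType}.
Local Notation C := R[i].
Local Notation mu := (@lebesgue_measure R).
Implicit Types (a b c h y l e : R) (s d : C).

Lemma cvgry_affine h e : 0 < e -> (n%:R - h) / e @[n --> \oo] --> +oo.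
Proof.
move=> e0; apply/cvgryPge => A; near=> n.
rewrite ler_pdivlMr// lerBrDr.
near: n; exact: nbhs_infty_ger.
Unshelve. all: by end_near. Qed.

Lemma horizontal_pole_le c1 c2 y d : c1 <= c2 -> `|Im d| < `|y| ->
  normc (cint `[0, 1] (fun l => (sweep (fun=> c2) c1 l y - d)^-1 * (c2 - c1)%:C)) <=
    2 * ((`|y| - `|Im d|)^-1 * (c2 - c1)).
Proof.
move=> c12 yd; have yd0 : 0 < `|y| - `|Im d| by rewrite subr_gt0.
have nl l : `|y| - `|Im d| <= normc (sweep (fun=> c2) c1 l y - d).
  by apply: (le_trans _ (ler_Im _)); rewrite !reimE/= lerB_dist.
have n0 l : sweep (fun=> c2) c1 l y - d != 0.
  by rewrite -normc_gt0 (lt_le_trans yd0).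
apply: cint01_normc_le.
  apply: seg_cintg; apply: seg_contM => l; last exact: ccvg_cst.
  apply: ccvgV => //; apply: ccvgB; last exact: ccvg_cst.
  by apply: (sweep_ccvg c1 (fun y => rder_cst c2 y)); [exact: clip_cvg|exact: cvg_cst].
move=> l _; rewrite normcM normc_real ger0_norm ?subr_ge0// ler_wpM2r ?subr_ge0//.
by rewrite normcV lef_pV2 ?posrE// normc_gt0.
Qed.

(** The integrands on the two lines differ by [2 i e / (e^2 + (y - Im d)^2)],
    the derivative of an arc tangent up to a factor. *)
Lemma vertical_pole a b d e : 0 < e -> a < b ->
  cint `[a, b] (fun y => (((Re d + e) +i* y) - d)^-1 * (0 +i* 1)) -
  cint `[a, b] (fun y => (((Re d - e) +i* y) - d)^-1 * (0 +i* 1)) =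
  0 +i* (2 * atan ((b - Im d) / e) - 2 * atan ((a - Im d) / e)).
Proof.
move=> e0 ab.
have e2 y : 0 < e ^+ 2 + (y - Im d) ^+ 2 by rewrite ltr_pwDl ?sqr_ge0// exprn_gt0.
have n0 k y : k ^+ 2 = e ^+ 2 -> ((Re d + k) +i* y) - d != 0.
  move=> k2; rewrite -normc_gt0 normcE2 sqrtr_gt0 !reimE/=.
  by rewrite [Re d + k]addrC addrK k2.
have sc k : k ^+ 2 = e ^+ 2 -> seg_cont a b (fun y => (((Re d + k) +i* y) - d)^-1 * (0 +i* 1)).
  move=> k2; apply: seg_contM => y; last exact: ccvg_cst.
  apply: ccvgV; first exact: n0.
  apply: ccvgB; last exact: ccvg_cst.
  by apply: ccvg_reim; [exact: cvg_cst|exact: clip_cvg].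
have Ne : (- e) ^+ 2 = e ^+ 2 by rewrite sqrrN.
rewrite -cintB//; [|exact/seg_cintg/sc|exact/seg_cintg/sc].
pose F y : C := 0 +i* (2 * atan ((y - Im d) / e)).
have -> : 0 +i* (2 * atan ((b - Im d) / e) - 2 * atan ((a - Im d) / e)) = F b - F a.
  by apply: complex_ext; rewrite ?reimE/= ?subrr.
apply: cint_FTC => //.
- by move=> y; apply: ccvgB; exact: sc.
- move=> y; apply: ccvg_reim; first exact: cvg_cst.
  apply: cvgMr; have h : (clip a b t - Im d) / e @[t --> y] --> (clip a b y - Im d) / e.
    by apply: cvgMl; apply: cvgB; [exact: clip_cvg|exact: cvg_cst].
  by apply: cvg_comp h _; exact: continuous_atan.
- move=> y _; split => /=.
    rewrite !reimE/=; apply: rder_eq (rder_cst 0 y) _.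
    rewrite !ReV !ImV !reimE/=.
    have -> : Re d + e - Re d = e by ring.
    have -> : Re d - e - Re d = - e by ring.
    by rewrite sqrrN; ring.
  have h : is_derive y (1:R) (fun t => (t - Im d) / e) (e^-1).
    apply: rder_eq (rderM (rderB (rder_id y) (rder_cst (Im d) y)) (rder_cst e^-1 y)) _.
    by ring.
  apply: rder_eq (rderM (rder_cst 2 y) (@rder_comp _ _ (fun t => (t - Im d) / e) _ _ _ (is_derive1_atan _) h)) _.
  rewrite !reimE !ReV !ImV !reimE/=.
  have -> : Re d + e - Re d = e by ring.
  have -> : Re d - e - Re d = - e by ring.
  rewrite sqrrN; have := e2 y; move: (y - Im d) => z z0.
  have z1 : 0 < 1 + (z / e) ^+ 2 by rewrite ltr_pwDl// sqr_ge0.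
  field; rewrite ?gt_eqF//.
Qed.

(** Twice [2 i] times the limit [pi / 2] of the arc tangent; the horizontal
    sides contribute [O(1/n)]. *)
Lemma rect_int_pole d e : 0 < e ->
  ccvg \oo (fun n : nat => rect_int (Re d - e) (Re d + e) (- n%:R) n%:R (fun s => (s - d)^-1))
    (2 * pi%:C * (0 +i* 1)).
Proof.
move=> e0.
have c12 : Re d - e <= Re d + e by lra.
have L h : atan ((n%:R - h) / e) @[n --> \oo] --> (pi / 2 : R).
  exact: (cvg_comp _ _ (cvgry_affine h e0) (@cvgy_atan R)).
have V : ccvg \oo (fun n : nat => cint `[- n%:R, n%:R] (fun y => (((Re d + e) +i* y) - d)^-1 * (0 +i* 1)) -
    cint `[- n%:R, n%:R] (fun y => (((Re d - e) +i* y) - d)^-1 * (0 +i* 1))) (2 * pi%:C * (0 +i* 1)).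
  have -> : 2 * pi%:C * (0 +i* 1) = 0 +i* (2 * (pi / 2) + 2 * (pi / 2)) :> C.
    by rewrite natrC; apply: complex_ext; rewrite ?reimE/=; field.
  have h : ccvg \oo (fun n : nat => 0 +i* (2 * atan ((n%:R - Im d) / e) + 2 * atan ((n%:R - - Im d) / e)) : C)
     (0 +i* (2 * (pi / 2) + 2 * (pi / 2))).
    by apply: ccvg_reim; [exact: cvg_cst|apply: cvgD; apply: cvgMr; exact: L].
  apply: (ccvg_near _ h); near=> n; rewrite vertical_pole//.
    congr (_ +i* (_ + _)); rewrite -mulrN -atanN; congr (2 * atan _).
    by rewrite -mulNr; congr (_ / _); ring.
  by rewrite gtrN ?ltr0n//; near: n; exact: nbhs_infty_gt.
have H (w : nat -> R) : (forall n, `|w n| = n%:R) ->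
  ccvg \oo (fun n => cint `[0, 1] (fun l => (sweep (fun=> Re d + e) (Re d - e) l (w n) - d)^-1 *
     (Re d + e - (Re d - e))%:C)) 0.
  move=> wn.
  have k : ((n%:R - `|Im d|) / 1)^-1 @[n --> \oo] --> (0 : R).
    apply/gtr0_cvgV0; last exact: cvgry_affine.
    near=> n; rewrite divr1 subr_gt0.
    near: n; exact: nbhs_infty_gtr.
  apply: (@ccvg_of_normc _ _ _ _ _ _ (fun n => 2 * (((n%:R - `|Im d|) / 1)^-1 * (Re d + e - (Re d - e))))).
    near=> n; rewrite subr0 divr1 -(wn n); apply: horizontal_pole_le => //.
    rewrite wn; near: n; exact: nbhs_infty_gtr.
  rewrite -(mulr0 2); apply: cvgMr; rewrite -(mul0r (Re d + e - (Re d - e))); exact: cvgMl.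
have h1 := H (fun n => n%:R) (fun n => ger0_norm (ler0n _ n)).
have h2 := H (fun n => - n%:R) (fun n => etrans (normrN _) (ger0_norm (ler0n _ n))).
pose proof (ccvgB V (ccvgB h1 h2)) as Z; rewrite !subr0 in Z.
exact: Z.
Unshelve. all: by end_near. Qed.

Variables (p rho kap gam : R).
Hypotheses (p0 : 0 < p) (rho0 : 0 <= rho) (kap0 : 0 <= kap).
Hypothesis rate0 : 0 < 2 * p + 1 - 2 * rho - kap.

Local Notation K := (kern p rho kap gam Gamma).
Local Notation Kn n := (kern p rho kap gam (eulerG n)).
Local Notation U := (pole_free p).

Lemma kern_seg_limitM u v (g m : R -> C) (k : C) : u <= v -> seg_cont u v g -> seg_cont u v m ->
  (forall y, u <= y <= v -> U (g y)) ->
  ccvg \oo (fun n => cint `[u, v] (fun y => Kn n (g y) * m y * k)) (cint `[u, v] (fun y => K (g y) * m y * k)).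
Proof.
move=> uv cg cm Ug.
have cmk : seg_cont u v (fun y => m y * k) by apply: seg_contM => // y; exact: ccvg_cst.
have [_ l] := kern_seg_limit gam p0 rho0 kap0 uv cg cmk Ug.
have E w : cint `[u, v] (fun y => w (g y) * m y * k) = cint `[u, v] (fun y => w (g y) * (m y * k)).
  by apply: eq_cint => y _; rewrite mulrA.
rewrite (E K).
have -> : (fun n => cint `[u, v] (fun y => Kn n (g y) * m y * k)) =
    (fun n => cint `[u, v] (fun y => Kn n (g y) * (m y * k))).
  by apply/funext => n; exact: (E (Kn n)).
exact: l.
Qed.

(** Cauchy's formula for the kernels built from Euler's sequence, in the
    limit. *)
Lemma kern_rect c1 c2 a b d :
  (forall s, c1 <= Re s <= c2 -> a <= Im s <= b -> U s) ->
  c1 < Re d < c2 -> a < Im d < b ->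
  rect_int c1 c2 a b (fun s => K s * (s - d)^-1) =
  K d * rect_int c1 c2 a b (fun s => (s - d)^-1).
Proof.
move=> Us hd1 hd2; have /andP[d1 d2] := hd1; have /andP[d3 d4] := hd2.
have c12 : c1 <= c2 by lra. have ab : a <= b by lra.
have cv c : seg_cont a b (fun y => c +i* y).
  by move=> y; apply: ccvg_reim; [exact: cvg_cst|exact: clip_cvg].
have ch y : seg_cont 0 1 (sweep (fun=> c2) c1 ^~ y).
  by move=> l; apply: (sweep_ccvg c1 (fun y => rder_cst c2 y)); [exact: clip_cvg|exact: cvg_cst].
have mV u v (g : R -> C) : u <= v -> seg_cont u v g -> (forall y, u <= y <= v -> g y != d) ->
    seg_cont u v (fun y => (g y - d)^-1).
  move=> uv gc gd y; apply: ccvgV; first by rewrite subr_eq0 gd// clip_in.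
  by apply: ccvgB; [exact: gc|exact: ccvg_cst].
have LV c : c1 <= c <= c2 -> c != Re d ->
    ccvg \oo (fun n => cint `[a, b] (fun y => Kn n (c +i* y) * ((c +i* y - d)^-1) * (0 +i* 1)))
     (cint `[a, b] (fun y => K (c +i* y) * ((c +i* y - d)^-1) * (0 +i* 1))).
  move=> cc cd.
  have nd y : a <= y <= b -> c +i* y != d by move=> _; apply: contra_neq cd => <-.
  have Uv y : a <= y <= b -> U (c +i* y) by move=> yab; exact: Us.
  exact: (kern_seg_limitM (0 +i* 1) ab (cv c) (mV _ _ _ ab (cv c) nd) Uv).
have LH y : a <= y <= b -> y != Im d ->
    ccvg \oo (fun n => cint `[0, 1] (fun l => Kn n (sweep (fun=> c2) c1 l y) * ((sweep (fun=> c2) c1 l y - d)^-1) * (c2 - c1)%:C))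
     (cint `[0, 1] (fun l => K (sweep (fun=> c2) c1 l y) * ((sweep (fun=> c2) c1 l y - d)^-1) * (c2 - c1)%:C)).
  move=> yy yd.
  have nd l : 0 <= l <= 1 -> sweep (fun=> c2) c1 l y != d by move=> _; apply: contra_neq yd => <-.
  have Uv l : 0 <= l <= 1 -> U (sweep (fun=> c2) c1 l y) by move=> l01; apply: Us => //; exact: sweep_line_in.
  exact: (kern_seg_limitM (c2 - c1)%:C ler01 (ch y) (mV _ _ _ ler01 (ch y) nd) Uv).
have l1 : ccvg \oo (fun n => rect_int c1 c2 a b (fun s => Kn n s * (s - d)^-1))
    (rect_int c1 c2 a b (fun s => K s * (s - d)^-1)).
  apply: ccvgB; apply: ccvgB.
  - by apply: LV; rewrite ?c12 ?lexx// gt_eqF.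
  - by apply: LV; rewrite ?c12 ?lexx// lt_eqF.
  - by apply: LH; rewrite ?ab ?lexx// gt_eqF.
  - by apply: LH; rewrite ?ab ?lexx// lt_eqF.
have l2 : ccvg \oo (fun n => rect_int c1 c2 a b (fun s => Kn n s * (s - d)^-1))
    (K d * rect_int c1 c2 a b (fun s => (s - d)^-1)).
  have E n : rect_int c1 c2 a b (fun s => Kn n s * (s - d)^-1) =
     Kn n d * rect_int c1 c2 a b (fun s => (s - d)^-1).
    exact: cauchy_rect (holo_kern rho kap gam p0 n) _ hd1 hd2.
  under eq_fun do rewrite E.
  by apply: ccvgM; [exact: kern_cvg|exact: ccvg_cst].
exact: ccvg_unique l1 l2.
Qed.

Lemma kern_line_cintg c : (forall y, U (c +i* y)) -> cintg setT (fun y => K (c +i* y) * (0 +i* 1)).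
Proof.
move=> Uc.
have h : cintg setT (fun y => K (c +i* y) * cpow 1 (- (c +i* y)) * (0 +i* 1)).
  by apply: (@kern_contour_cintg R p rho kap gam p0 rho0 kap0 rate0 1 (fun=> c) (fun=> 0) c 0) => // y; exact: cvg_cst.
by apply: eq_cintg h => // y _; rewrite /cpow ln1 mulr0 cexp0 mulr1.
Qed.

Lemma kern_pole_cintg c d : (forall y, U (c +i* y)) -> c != Re d ->
  cintg setT (fun y => K (c +i* y) * (c +i* y - d)^-1 * (0 +i* 1)).
Proof.
move=> Uc cd; have i := kern_line_cintg Uc.
have n0 y : c +i* y - d != 0 by rewrite subr_eq0; apply: contra_neq cd => <-.
have cd0 : 0 < `|c - Re d| by rewrite normr_gt0 subr_eq0.
have j := cintg_normc measurableT i.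
have j' : mu.-integrable setT (EFin \o (fun y => `|c - Re d|^-1 * normc (K (c +i* y) * (0 +i* 1)))).
  have -> : EFin \o (fun y => `|c - Re d|^-1 * normc (K (c +i* y) * (0 +i* 1))) =
     (fun y => (`|c - Re d|^-1)%:E * (normc (K (c +i* y) * (0 +i* 1)))%:E)%E.
    by apply/funext => y; rewrite /= EFinM.
  exact: integrableZl.
have E y : K (c +i* y) * (c +i* y - d)^-1 * (0 +i* 1) = (c +i* y - d)^-1 * (K (c +i* y) * (0 +i* 1)).
  by rewrite mulrCA mulrA mulrAC.
under eq_fun do rewrite E.
apply: (cintg_le _ _ j') => //.
  apply: cmeasM; last exact: cintg_cmeas.
  have cq y : ccvg (nbhs y) (fun t => (c +i* t - d)^-1) (c +i* y - d)^-1.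
    apply: ccvgV => //; apply: ccvgB; last exact: ccvg_cst.
    by apply: ccvg_reim; [exact: cvg_cst|exact: cvg_id].
  by split; apply: continuous_measurable_fun => y; [exact: (cq y).1|exact: (cq y).2].
move=> y _; rewrite (normcM (c +i* y - d)^-1) ler_wpM2r ?normc_ge0// normcV lef_pV2 ?posrE ?normc_gt0//.
by apply: (le_trans _ (ler_Re _)); rewrite !reimE/=.
Qed.

(** On the rectangles of heights [- n] to [n], the horizontal sides contribute
    nothing in the limit because the kernel decays. *)
Lemma kern_cauchy d e : 0 < e ->
  (forall s, Re d - e <= Re s <= Re d + e -> U s) ->
  cint setT (fun y => K ((Re d + e) +i* y) * ((Re d + e) +i* y - d)^-1 * (0 +i* 1)) -
  cint setT (fun y => K ((Re d - e) +i* y) * ((Re d - e) +i* y - d)^-1 * (0 +i* 1)) =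
  2 * pi%:C * (0 +i* 1) * K d.
Proof.
move=> e0 Us.
have c12 : Re d - e <= Re d + e by lra.
have i2 : cintg setT (fun y => K ((Re d + e) +i* y) * ((Re d + e) +i* y - d)^-1 * (0 +i* 1)).
  by apply: kern_pole_cintg; [move=> y; apply: Us; rewrite /= lexx andbT|rewrite gt_eqF//; lra].
have i1 : cintg setT (fun y => K ((Re d - e) +i* y) * ((Re d - e) +i* y - d)^-1 * (0 +i* 1)).
  by apply: kern_pole_cintg; [move=> y; apply: Us; rewrite /= lexx|rewrite lt_eqF//; lra].
pose B := `|Re d| + e.
have [D [k [T [D0 k0 T0 hD]]]] := kern_decay gam p0 rho0 kap0 rate0 B.
have H (w : nat -> R) : (forall n, `|w n| = n%:R) ->
  ccvg \oo (fun n => cint `[0, 1] (fun l => K (sweep (fun=> Re d + e) (Re d - e) l (w n)) *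
     (sweep (fun=> Re d + e) (Re d - e) l (w n) - d)^-1 * (Re d + e - (Re d - e))%:C)) 0.
  move=> wn.
  apply: (@ccvg_of_normc _ _ _ _ _ _ (fun n => 4 * D * e * expR (- (k * n%:R)))); last exact: expR_decay_nat.
  near=> n; rewrite subr0.
  have Tn : T <= `|w n|.
    rewrite wn; near: n; exact: nbhs_infty_ger.
  have dn : `|Im d| + 1 <= `|w n|.
    rewrite wn; near: n; exact: nbhs_infty_ger.
  have nl l : 1 <= normc (sweep (fun=> Re d + e) (Re d - e) l (w n) - d).
    apply: (le_trans _ (ler_Im _)); rewrite !reimE/=.
    by apply: (le_trans _ (lerB_dist _ _)); lra.
  have n0 l : sweep (fun=> Re d + e) (Re d - e) l (w n) - d != 0.
    by rewrite -normc_gt0 (lt_le_trans _ (nl l)).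
  have ch : seg_cont 0 1 (sweep (fun=> Re d + e) (Re d - e) ^~ (w n)).
    by move=> l; apply: (sweep_ccvg _ (fun y => rder_cst _ y)); [exact: clip_cvg|exact: cvg_cst].
  rewrite (_ : 4 * D * e * expR _ = 2 * (D * expR (- (k * `|w n|)) * 1 * (2 * e))); last by rewrite wn; ring.
  apply: cint01_normc_le.
    have m : seg_cont 0 1 (fun l => (sweep (fun=> Re d + e) (Re d - e) l (w n) - d)^-1 * (Re d + e - (Re d - e))%:C).
      apply: seg_contM => l; last exact: ccvg_cst.
      by apply: ccvgV => //; apply: ccvgB; [exact: ch|exact: ccvg_cst].
    have Uv l : 0 <= l <= 1 -> U (sweep (fun=> Re d + e) (Re d - e) l (w n)).
      by move=> l01; apply: Us; exact: sweep_line_in.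
    have [i _] := kern_seg_limit gam p0 rho0 kap0 ler01 ch m Uv.
    by apply: eq_cintg i => // l _; rewrite mulrA.
  move=> l l01; rewrite normcM (normcM (K _)) normc_real.
  have /andP[s1 s2] := sweep_line_in (w n) c12 l01.
  apply: ler_pM; rewrite ?mulr_ge0 ?normc_ge0//; last by rewrite ger0_norm; lra.
  apply: ler_pM; rewrite ?normc_ge0//.
    apply: hD => //; rewrite ler_norml /B; have := ler_norm (Re d); have := ler_normr (Re d) (- Re d).
    by have := ler_norm (- Re d); rewrite normrN => ? _ ?; apply/andP; split; lra.
  by rewrite normcV invf_le1 ?normc_gt0.
have h1 := H (fun n => n%:R) (fun n => ger0_norm (ler0n _ n)).
have h2 := H (fun n => - n%:R) (fun n => etrans (normrN _) (ger0_norm (ler0n _ n))).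
have l2 := cint_lim_seg i2; have l1 := cint_lim_seg i1.
pose proof (ccvgB (ccvgB l2 l1) (ccvgB h1 h2)) as L; rewrite !subr0 in L.
have l3 := rect_int_pole d e0.
have M : ccvg \oo (fun n : nat => K d * rect_int (Re d - e) (Re d + e) (- n%:R) n%:R (fun s => (s - d)^-1))
    (K d * (2 * pi%:C * (0 +i* 1))) by apply: ccvgM; [exact: ccvg_cst|exact: l3].
rewrite [RHS]mulrC; apply: (ccvg_unique L); apply: (ccvg_near _ M).
near=> n; rewrite -kern_rect//.
- by move=> s sr _; exact: Us.
- by apply/andP; split; lra.
- rewrite -ltr_norml.
  near: n; exact: nbhs_infty_gtr.
Unshelve. all: by end_near. Qed.

End KernelCauchy.

(** * Mellin inversion *)

Section MellinInversion.
Context {R : realType}.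
Local Notation C := R[i].
Local Notation mu := (@lebesgue_measure R).
Implicit Types (c u x y : R) (s d z : C).

Lemma cpow_div x lam z : 0 < x -> 0 < lam -> cpow (x / lam) (- z) = cpow x (- z) * cpow lam z.
Proof.
move=> x0 l0; rewrite /cpow -cexpD ln_div ?posrE//; congr cexp.
by rewrite rmorphB/=; ring.
Qed.

Variables (p rho kap gam : R).
Hypotheses (p0 : 0 < p) (rho0 : 0 <= rho) (kap0 : 0 <= kap).
Hypothesis rate0 : 0 < 2 * p + 1 - 2 * rho - kap.

Local Notation K := (kern p rho kap gam Gamma).
Local Notation U := (pole_free p).

(** The Mellin-Barnes integral along the line [Re s = c]. *)
Definition barnes c u : C :=
  cint setT (fun y => K (c +i* y) * cpow u (- (c +i* y)) * (0 +i* 1)).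

Definition pole_line c d : C :=
  cint setT (fun y => K (c +i* y) * (c +i* y - d)^-1 * (0 +i* 1)).

Lemma barnes_cintg c u : (forall y, U (c +i* y)) ->
  cintg setT (fun y => K (c +i* y) * cpow u (- (c +i* y)) * (0 +i* 1)).
Proof.
move=> Uc.
by apply: (@kern_contour_cintg R p rho kap gam p0 rho0 kap0 rate0 u (fun=> c) (fun=> 0) c 0) => // y; exact: cvg_cst.
Qed.

(** The Mellin transform of the Barnes integral over a piece [D] of the
    half-line on which the modulus of [x^(d - s - 1)] is integrable: Fubini applies
    as that modulus does not depend on the height of [s], and the inner integral is
    a power of [lam] divided by [d - s]. *)
Lemma mellin_barnes_piece (D : set R) (k : C) lam c d : measurable D -> (forall x, D x -> 0 < x) ->
  0 < lam -> (forall y, U (c +i* y)) -> c != Re d ->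
  mu.-integrable D (EFin \o (fun x => expR ((Re d - c - 1) * ln x))) ->
  (forall z, Re z = Re d - c -> cint D (fun x => cpow x (z - 1)) = k * (cpow lam z / z)) ->
  cintg D (fun x => cpow x (d - 1) * barnes c (x / lam)) /\
  cint D (fun x => cpow x (d - 1) * barnes c (x / lam)) = - k * cpow lam d * pole_line c d.
Proof.
move=> mD Dpos l0 Uc cd iD hD.
pose F x y : C := (\1_D x)%:C * (cpow x (d - 1) * (K (c +i* y) * cpow (x / lam) (- (c +i* y)) * (0 +i* 1))).
pose a x : R := \1_D x * expR ((Re d - c - 1) * ln x).
pose b y : R := expR (c * ln lam) * normc (K (c +i* y) * (0 +i* 1)).
have a0 x : 0 <= a x by rewrite /a mulr_ge0 ?expR_ge0// indicE.
have b0 y : 0 <= b y by rewrite /b mulr_ge0 ?expR_ge0// normc_ge0.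
have Fab x y : normc (F x y) <= a x * b y.
  rewrite /F /a normcM normc_real indicE; case: (boolP (x \in D)) => [|_]; last first.
    by rewrite normr0 !mul0r.
  rewrite inE => /Dpos x0; rewrite normr1 !mul1r cpow_div//.
  have -> : cpow x (d - 1) * (K (c +i* y) * (cpow x (- (c +i* y)) * cpow lam (c +i* y)) * (0 +i* 1)) =
      cpow x (d - 1 - (c +i* y)) * (cpow lam (c +i* y) * (K (c +i* y) * (0 +i* 1))).
    by rewrite [cpow x (d - 1 - _)]cpowD; ring.
  rewrite (normcM (cpow x _)) (normcM (cpow lam _)) !normc_cpow !reimE/= /b.
  by rewrite addrAC.
have mF : cmeas setT (fun t : measurableTypeR R * measurableTypeR R => F t.1 t.2).
  apply: cmeasM.
    apply: cmeas_real; apply: measurableT_comp; last exact: measurable_fst.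
    exact: measurable_indic.
  have m1 : measurable_fun setT (fun t : measurableTypeR R * measurableTypeR R => ln t.1).
    by apply: measurableT_comp; [exact: measurable_ln|exact: measurable_fst].
  have m2 : measurable_fun setT (fun t : measurableTypeR R * measurableTypeR R => ln (t.1 / lam)).
    apply: measurableT_comp; first exact: measurable_ln.
    by apply: measurable_funM => //; exact: measurable_fst.
  apply: cmeasM.
    apply: cmeas_cexp; apply: cmeasM; first exact: cmeas_cst.
    exact: cmeas_real.
  apply: cmeasM; last exact: cmeas_cst.
  apply: cmeasM.
    have cg y : ccvg (nbhs y) (fun t => c +i* t) (c +i* y).
      by apply: ccvg_reim; [exact: cvg_cst|exact: cvg_id].
    have [k1 k2] : cmeas setT (fun y : measurableTypeR R => K (c +i* y)).
      exact: (kern_path_cmeas rho kap gam p0 cg Uc measurableT).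
    split.
    - exact: (measurableT_comp k1 measurable_snd).
    - exact: (measurableT_comp k2 measurable_snd).
  apply: cmeas_cexp; apply: cmeasM; last exact: cmeas_real.
  split => /=; first exact: measurable_cst.
  by apply: measurable_funN; exact: measurable_snd.
have ia : mu.-integrable setT (EFin \o a).
  have h := @integrable_mkcond _ _ _ mu D (EFin \o (fun x => expR ((Re d - c - 1) * ln x))) mD.
  move: iD => /h; apply: eq_integrable => // x _.
  by rewrite patchE /= /a indicE; case: ifP => _; rewrite ?mul1r ?mul0r.
have ib : mu.-integrable setT (EFin \o b).
  have -> : EFin \o b = (fun y => (expR (c * ln lam))%:E * (normc (K (c +i* y) * (0 +i* 1)))%:E)%E.
    by apply/funext => y; rewrite /= EFinM.
  apply: integrableZl => //; apply: cintg_normc => //.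
  exact: kern_line_cintg p0 rho0 kap0 rate0 _ Uc.
have [i1 e1] := cint_Fubini mF.1 mF.2 ia ib a0 b0 Fab.
have E1 x : cint setT (F x) = (\1_D x)%:C * (cpow x (d - 1) * barnes c (x / lam)).
  have i := barnes_cintg (x / lam) Uc.
  have -> : F x = (fun y => (\1_D x)%:C * cpow x (d - 1) *
      (K (c +i* y) * cpow (x / lam) (- (c +i* y)) * (0 +i* 1))).
    by apply/funext => y; rewrite /F mulrA.
  by rewrite (cintZ _ measurableT i) mulrA.
have E2 y : cint setT (F ^~ y) = - k * cpow lam d * (K (c +i* y) * (c +i* y - d)^-1 * (0 +i* 1)).
  have -> : cint setT (F ^~ y) = cint D (fun x => cpow x (d - 1) *
      (K (c +i* y) * cpow (x / lam) (- (c +i* y)) * (0 +i* 1))).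
    by rewrite (cint_indic _ (@subsetT _ D)).
  transitivity (cint D (fun x => (K (c +i* y) * cpow lam (c +i* y) * (0 +i* 1)) *
     cpow x (d - (c +i* y) - 1))).
    apply: eq_cint => x /Dpos x0; rewrite (cpow_div _ x0 l0).
    have -> : d - (c +i* y) - 1 = (d - 1) + (- (c +i* y)) by ring.
    by rewrite [cpow x (_ + - (c +i* y))]cpowD; ring.
  have rz : Re (d - (c +i* y)) = Re d - c by rewrite !reimE.
  have iz : cintg D (fun x => cpow x (d - (c +i* y) - 1)).
    by apply: (cintg_cpow_of mD); rewrite rz; exact: iD.
  rewrite (cintZ _ mD iz) (hD _ rz).
  have n0 : c +i* y - d != 0 by rewrite subr_eq0; apply: contra_neq cd => <-.
  have -> : (d - (c +i* y))^-1 = - (c +i* y - d)^-1 by rewrite -invrN opprB.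
  rewrite cpowD cpowN.
  have := cpow_neq0 lam (c +i* y); move: (cpow lam (c +i* y)) => v v0.
  by field; rewrite v0 n0.
have e2 : (fun x => cint setT (F x)) = (fun x => (\1_D x)%:C * (cpow x (d - 1) * barnes c (x / lam))).
  by apply/funext.
rewrite e2 in i1 e1; split; first by apply/cintg_indic.
rewrite (cint_indic _ (@subsetT _ D)) e1.
transitivity (cint setT (fun y => - k * cpow lam d * (K (c +i* y) * (c +i* y - d)^-1 * (0 +i* 1)))).
  by apply: eq_cint => y _; exact: E2.
exact: cintZ measurableT (kern_pole_cintg gam p0 rho0 kap0 rate0 Uc cd).
Qed.

(** Mellin inversion: on the two sides of [lam] use the lines to the left and
    to the right of [d]. *)
Lemma mellin_barnes (H : R -> C) lam d e : 0 < lam -> 0 < e ->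
  (forall s, Re d - e <= Re s <= Re d + e -> U s) ->
  (forall u, H u = barnes (Re d - e) u) -> (forall u, H u = barnes (Re d + e) u) ->
  cintg setT (fun x => (\1_(`]0, +oo[) x)%:C * (cpow x (d - 1) * H (x / lam))) /\
  cint setT (fun x => (\1_(`]0, +oo[) x)%:C * (cpow x (d - 1) * H (x / lam))) =
  2 * pi%:C * (0 +i* 1) * (cpow lam d * K d).
Proof.
move=> l0 e0 Us H1 H2.
have U1 y : U ((Re d - e) +i* y) by apply: Us; rewrite /= lexx/=; lra.
have U2 y : U ((Re d + e) +i* y) by apply: Us; rewrite /= lexx andbT; lra.
have [i1 v1] : cintg `]0, lam] (fun x => cpow x (d - 1) * barnes (Re d - e) (x / lam)) /\
   cint `]0, lam] (fun x => cpow x (d - 1) * barnes (Re d - e) (x / lam)) = - 1 * cpow lam d * pole_line (Re d - e) d.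
  apply: mellin_barnes_piece => //.
  - by move=> x /=; rewrite in_itv/= => /andP[].
  - by rewrite lt_eqF//; lra.
  - by apply: integrable_pow0 => //; lra.
  - by move=> z zd; rewrite mul1r; apply: cint_cpow0 => //; rewrite zd; lra.
have lamS : `]lam, +oo[%classic `<=` `[lam, +oo[%classic by apply: subset_itvr; rewrite bnd_simp.
have [i2 v2] : cintg `]lam, +oo[ (fun x => cpow x (d - 1) * barnes (Re d + e) (x / lam)) /\
   cint `]lam, +oo[ (fun x => cpow x (d - 1) * barnes (Re d + e) (x / lam)) = - - 1 * cpow lam d * pole_line (Re d + e) d.
  apply: mellin_barnes_piece => //.
  - by move=> x /=; rewrite in_itv/= andbT; exact: lt_trans.
  - by rewrite gt_eqF//; lra.
  - apply: (@integrableS _ _ _ mu `[lam, +oo[) => //.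
    by apply: integrable_powy => //; lra.
  - move=> z zd; rewrite mulN1r -cint_cpowy//; last by rewrite zd; lra.
    have zn : Re z < 0 by rewrite zd; lra.
    have [j1 j2] : cintg `]lam, +oo[ (fun x => cpow x (z - 1)).
      apply: cintg_cpow_of => //; apply: (@integrableS _ _ _ mu `[lam, +oo[) => //.
      exact: integrable_powy.
    by apply: complex_ext => /=; exact: Rintegral_itv_obnd_cbnd.
pose f x := cpow x (d - 1) * H (x / lam).
have E x : (\1_(`]0, +oo[%classic) x)%:C * f x =
    (\1_(`]0, lam]%classic) x)%:C * f x + (\1_(`]lam, +oo[%classic) x)%:C * f x.
  rewrite !indicE -mulrDl -rmorphD/=; congr (_%:C * _).
  rewrite -natrD; congr _%:R.
  rewrite !mem_setE !in_itv/= !andbT; case: (ltP lam x) => h; case: (ltP 0 x) => h' //=.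
  by have := lt_trans l0 h; rewrite ltNge h'.
have f1 : cintg setT (fun x => (\1_(`]0, lam]%classic) x)%:C * f x).
  apply/(cintg_indic _ (measurable_itv _)); apply: (eq_cintg (measurable_itv _) _ i1) => x _.
  by rewrite /f H1.
have f2 : cintg setT (fun x => (\1_(`]lam, +oo[%classic) x)%:C * f x).
  apply/(cintg_indic _ (measurable_itv _)); apply: (eq_cintg (measurable_itv _) _ i2) => x _.
  by rewrite /f H2.
have -> : (fun x => (\1_(`]0, +oo[) x)%:C * (cpow x (d - 1) * H (x / lam))) =
   (fun x => (\1_(`]0, lam]%classic) x)%:C * f x + (\1_(`]lam, +oo[%classic) x)%:C * f x).
  by apply/funext => x; exact: E.
split; first exact: cintgD.
rewrite (cintD measurableT f1 f2) -(cint_indic f (@subsetT _ `]0, lam]%classic)) -(cint_indic f (@subsetT _ `]lam, +oo[%classic)).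
have -> : cint `]0, lam] f = - 1 * cpow lam d * pole_line (Re d - e) d.
  by rewrite -v1; apply: eq_cint => x _; rewrite /f H1.
have -> : cint `]lam, +oo[ f = - - 1 * cpow lam d * pole_line (Re d + e) d.
  by rewrite -v2; apply: eq_cint => x _; rewrite /f H2.
have h := kern_cauchy gam p0 rho0 kap0 rate0 e0 Us.
rewrite [RHS]mulrCA -h /pole_line.
by ring.
Qed.

End MellinInversion.

(** * The H-function and its moments *)

Section FoxMoment.
Context {R : realType}.
Local Notation C := R[i].
Local Notation mu := (@lebesgue_measure R).

Lemma foxH_kernel_kern (p rho kap gam : R) (s : C) :
  foxH_kernel 2 1 [:: (1, p); (gam%:C, kap); (1, rho)] [:: (1, p); (1, 1); (1, rho)] s =
  kern p rho kap gam Gamma s.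
Proof.
rewrite /foxH_kernel /kern /= !big_cons !big_nil /=.
rewrite !subrr !sub0r mul1r !mulr1 !mulrA.
by [].
Qed.

(** Only points of the real axis matter, and there the condition is convex. *)
Lemma strip_pole_free (p c y l x : R) : 0 <= l <= 1 -> -1 < c -> -1 < p * c -> c < 0 ->
  (y = 0 -> [/\ -1 < x, -1 < p * x & x < 0]) ->
  pole_free p ((c + l * (x - c)) +i* y).
Proof.
move=> /andP[l0 l1] c1 c2 c3 hx; have [y0|y0] := eqVneq y 0; last by left.
have [x1 x2 x3] := hx y0; right => /=.
have E (u v : R) : u + l * (v - u) = (1 - l) * u + l * v by ring.
have conv (u v w : R) : w < u -> w < v -> w < u + l * (v - u).
  move=> wu wv; rewrite E.
  have [l00|lp] := eqVneq l 0; first by rewrite l00; lra.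
  have lp' : 0 < l by rewrite lt_def lp.
  have a1 : 0 <= (1 - l) * (u - w) by rewrite mulr_ge0; lra.
  have a2 : 0 < l * (v - w) by rewrite mulr_gt0; lra.
  lra.
split; first exact: conv.
- have -> : p * (c + l * (x - c)) = p * c + l * (p * x - p * c) by ring.
  exact: conv.
- have := conv (- c) (- x) 0; rewrite !oppr_gt0 => /(_ c3 x3).
  have -> : - c + l * (- x - - c) = - (c + l * (x - c)) by ring.
  by rewrite oppr_gt0.
Qed.

(** The condition on the contour is used at the first pole of each Gamma
    function of the numerator, [-1], [- 1 / p] and [0]: they bound the point where
    the contour crosses the real axis. *)
Lemma fox_contour_line (p rho kap gam : R) (sigma : R -> R) (c u : R) :
  0 < p -> 0 <= rho -> 0 <= kap -> 0 < 2 * p + 1 - 2 * rho - kap ->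
  let a := [:: (1, p); (gam%:C, kap); (1, rho)] in
  let b := [:: (1, p); (1, 1); (1, rho)] in
  mellin_barnes_contour 2 1 a b sigma ->
  -1 < c -> -1 < p * c -> c < 0 ->
  contour_integral sigma (fun s => foxH_kernel 2 1 a b s * cpow u (- s)) =
  barnes p rho kap gam c u.
Proof.
move=> p0 rho0 kap0 rate0 a b [ds cs [c0 [M sM]] left right] c1 c2 c3.
have x1 : -1 < sigma 0.
  have := left (1, 1) (-1); rewrite /= oppr0; apply; first by rewrite !inE eqxx orbT.
  by exists 0%N; rewrite mulrN1 rmorph1 subrr oppr0.
have x2 : -1 < p * sigma 0.
  have := left (1, p) (- p^-1)%:C; rewrite /= => h.
  rewrite mulrC -ltr_pdivrMr// mulN1r; apply: h; first by rewrite inE eqxx.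
  exists 0%N; rewrite -rmorphM/= mulrN divff ?gt_eqF// rmorphN/=.
  by rewrite subrr oppr0.
have x3 : sigma 0 < 0.
  have := right (1, p) 0; rewrite /=; apply; first by rewrite inE eqxx.
  by exists 0%N; rewrite mulr0 subrr subr0 oppr0.
have dsig y : is_derive y (1:R) sigma (derive1 sigma y).
  by apply: DeriveDef; [exact: ds|rewrite derive1E].
have Us l y : 0 <= l <= 1 -> pole_free p (sweep sigma c l y).
  by move=> l01; apply: strip_pole_free => // ->.
have := @kern_contour_shift R p rho kap gam p0 rho0 kap0 rate0 u sigma (derive1 sigma) c c0 M dsig cs Us sM.
rewrite /barnes => <-.
by apply: eq_cint => y _; rewrite foxH_kernel_kern.
Qed.

(** An even integrand that vanishes at the origin is determined by its values
    on the open half-line. *)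
Lemma even_moment (f : R -> C) : f 0 = 0 -> (forall x, f x = f `|x|) ->
  cintg setT (fun x => (\1_(`]0, +oo[) x)%:C * f x) ->
  cintg setT f /\ cint setT f = 2 * cint setT (fun x => (\1_(`]0, +oo[) x)%:C * f x).
Proof.
move=> f0 fe ig; pose g x := (\1_(`]0, +oo[%classic) x)%:C * f x.
have gf x : 0 <= x -> g x = f x.
  rewrite le_eqVlt => /orP[/eqP <-|x0]; first by rewrite /g f0 mulr0.
  by rewrite /g indicE mem_set ?mul1r//= in_itv/= x0.
have fg x : f x = g `|x| by rewrite gf.
have mf : cmeas setT f.
  have [m1 m2] := cintg_cmeas ig.
  have -> : f = (fun x => g `|x|) by apply/funext.
  split.
  - exact: (measurableT_comp m1 (@normr_measurable R setT)).
  - exact: (measurableT_comp m2 (@normr_measurable R setT)).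
have eg : forall x, `[0, +oo[%classic x -> g x = f x.
  by move=> x /=; rewrite in_itv/= andbT; exact: gf.
have i0 : cintg `[0, +oo[ f.
  apply: (eq_cintg (measurable_itv _) eg).
  by split; apply: (@integrableS _ _ _ mu setT) => //; [exact: ig.1|exact: ig.2].
have [i e] := @even_cint R f mf (fun x => etrans (fe (- x)) (etrans (congr1 f (normrN x)) (esym (fe x)))) i0.
split=> //; rewrite e; congr (2 * _).
rewrite (cint_indic _ (@subsetT _ `[0, +oo[%classic)); apply: eq_cint => x _.
rewrite !indicE; have [x0|x0] := ltP 0 x.
  by rewrite !mem_set//= in_itv/= ?x0 ?ltW.
have [->|xn0] := eqVneq x 0; first by rewrite f0 !mulr0.
rewrite !memNset//= in_itv/= andbT; first by apply/negP; rewrite -leNgt.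
by apply/negP; rewrite -ltNge lt_def eq_sym xn0.
Qed.

End FoxMoment.

Theorem mainTheorem3 (R : realType) (eta t alpha theta mu nu : R)
    (sigma : R -> R) (delta : R[i]) :
  0 < eta -> 0 < t ->
  0 < alpha -> alpha <= 2 -> `|theta| <= Num.min alpha (2 - alpha) ->
  0 < mu -> mu < 1 -> 0 <= nu -> nu <= 1 ->
  let rho : R := (alpha - theta) / (2 * alpha) in
  let gam : R := mu + nu * (1 - mu) in
  let a : seq (R[i] * R) :=
    [:: (1, alpha^-1); (gam%:C, mu / alpha); (1, rho)] in
  let b : seq (R[i] * R) := [:: (1, alpha^-1); (1, 1); (1, rho)] in
  let N : R -> R[i] := fun x =>
    (t `^ (gam - 1) / (alpha * `|x|))%:C *
    foxH 2 1 a b sigma (`|x| / (eta `^ alpha^-1 * t `^ (mu / alpha))) in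
  mellin_barnes_contour 2 1 a b sigma ->
  - Num.min alpha 1 < complex.Re delta -> complex.Re delta < 0 ->
  let moment_integrand : R -> R[i] := fun x => cpow `|x| delta * N x in
  cintegrable moment_integrand /\
  cintegral moment_integrand =
    (2 / alpha)%:C * cpow eta (delta / alpha%:C) *
    cpow t (gam%:C + mu%:C * delta / alpha%:C - 1) *
    ((Gamma (- (delta / alpha%:C)) * Gamma (1 + delta) *
      Gamma (1 + delta / alpha%:C)) /
     (Gamma (- (rho%:C * delta)) * Gamma (gam%:C + mu%:C * delta / alpha%:C) *
      Gamma (1 + rho%:C * delta))).
Proof.
move=> eta0 t0 al0 al2 th mu0 mu1 nu0 nu1 rho gam a b N cont dl d0 f.
pose p := alpha^-1; pose kap := mu / alpha.
pose lam := eta `^ alpha^-1 * t `^ (mu / alpha).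
pose A := t `^ (gam - 1) / alpha.
have p0 : 0 < p by rewrite invr_gt0.
have [th1 th2] : `|theta| <= alpha /\ `|theta| <= 2 - alpha.
  by move: th; rewrite le_min => /andP[].
have {}th1 : - alpha <= theta <= alpha by rewrite -ler_norml.
have {}th2 : - (2 - alpha) <= theta <= 2 - alpha by rewrite -ler_norml.
have rho0 : 0 <= rho by rewrite divr_ge0 ?mulr_ge0 ?(ltW al0)//; lra.
have kap0 : 0 <= kap by rewrite divr_ge0 ?ltW.
have rate0 : 0 < 2 * p + 1 - 2 * rho - kap.
  have -> : 2 * p + 1 - 2 * rho - kap = (2 + theta - mu) / alpha.
    by rewrite /p /rho /kap; field; rewrite gt_eqF.
  by rewrite divr_gt0//; lra.
have lam0 : 0 < lam by rewrite mulr_gt0 ?powR_gt0.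
have [da d1] : - alpha < Re delta /\ -1 < Re delta.
  have m1 : Num.min alpha 1 <= alpha by rewrite ge_min lexx.
  have m2 : Num.min alpha 1 <= 1 by rewrite ge_min lexx orbT.
  by split; lra.
have [e e0 [e1 e2 e3]] : exists2 e, 0 < e & [/\ -1 < Re delta - e, - alpha < Re delta - e & Re delta + e < 0].
  (* Half the distance to the boundary of the strip. *)
  exists (Num.min (Re delta + 1) (Num.min (Re delta + alpha) (- Re delta)) / 2).
    by rewrite divr_gt0// !lt_min; apply/and3P; split; lra.
  have m1 : Num.min (Re delta + 1) (Num.min (Re delta + alpha) (- Re delta)) <= Re delta + 1.
    by rewrite ge_min lexx.
  have m2 : Num.min (Re delta + 1) (Num.min (Re delta + alpha) (- Re delta)) <= Re delta + alpha.
    by rewrite !ge_min lexx !orbT.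
  have m3 : Num.min (Re delta + 1) (Num.min (Re delta + alpha) (- Re delta)) <= - Re delta.
    by rewrite !ge_min lexx !orbT.
  by split; lra.
have pc c : - alpha < c -> -1 < p * c.
  by move=> ca; rewrite mulrC ltr_pdivlMr// mulN1r.
have Us s : Re delta - e <= Re s <= Re delta + e -> pole_free p s.
  by move=> /andP[s1 s2]; right; split; [lra|apply: pc; lra|lra].
pose H u := contour_integral sigma (fun s => foxH_kernel 2 1 a b s * cpow u (- s)).
have H1 u : H u = barnes p rho kap gam (Re delta - e) u.
  by apply: (fox_contour_line _ p0 rho0 kap0 rate0 cont e1); [exact: pc|lra].
have H2 u : H u = barnes p rho kap gam (Re delta + e) u.
  by apply: (fox_contour_line _ p0 rho0 kap0 rate0 cont _ _ e3); [lra|apply: pc; lra].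
have [iH vH] := mellin_barnes p0 rho0 kap0 rate0 lam0 e0 Us H1 H2.
pose w : R[i] := 2 * pi%:C * (0 +i* 1).
have w0 : w != 0.
  by rewrite /w natrC !mulf_neq0//; apply/eqP => -[]; have := pi_gt0 R; lra.
have fpos x : (\1_(`]0, +oo[%classic) x)%:C * f x =
    A%:C * w^-1 * ((\1_(`]0, +oo[%classic) x)%:C * (cpow x (delta - 1) * H (x / lam))).
  rewrite indicE; case: (boolP (x \in _)) => [|_]; last by rewrite !mul0r mulr0.
  rewrite inE/= in_itv/= andbT => x0.
  rewrite !mul1r /f /N /foxH -/lam -/(H _) -/w ger0_norm ?ltW// /A.
  rewrite cpowD cpowN cpow1// -fmorphV/= invfM !rmorphM/=.
  by ring.
have efpos : (fun x => (\1_(`]0, +oo[%classic) x)%:C * f x) =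
    (fun x => A%:C * w^-1 * ((\1_(`]0, +oo[%classic) x)%:C * (cpow x (delta - 1) * H (x / lam)))).
  by apply/funext.
(* The factor [1 / (alpha * 0)] is [0]. *)
have f0 : f 0 = 0.
  by rewrite /f /N normr0 mulr0 invr0 mulr0 mul0r mulr0.
have fe x : f x = f `|x| by rewrite /f /N normr_id.
have ifp : cintg setT (fun x => (\1_(`]0, +oo[%classic) x)%:C * f x).
  by rewrite efpos; exact: cintgZ measurableT iH.
have [if_ vf] := even_moment f0 fe ifp.
split; first exact: if_.
transitivity (cint setT f); first by [].
rewrite vf efpos (cintZ _ measurableT iH) vH -/w.
have -> : 2 * (A%:C * w^-1 * (w * (cpow lam delta * kern p rho kap gam Gamma delta))) =
    2 * A%:C * cpow lam delta * kern p rho kap gam Gamma delta.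
  by move: (cpow _ _) (kern _ _ _ _ _ _) => u v; field.
have lnlam : ln lam = alpha^-1 * ln eta + mu / alpha * ln t.
  by rewrite /lam lnM ?posrE ?powR_gt0// !ln_powR.
have -> : kern p rho kap gam Gamma delta =
    (Gamma (- (delta / alpha%:C)) * Gamma (1 + delta) * Gamma (1 + delta / alpha%:C)) /
     (Gamma (- (rho%:C * delta)) * Gamma (gam%:C + mu%:C * delta / alpha%:C) *
      Gamma (1 + rho%:C * delta)).
  rewrite /kern.
  have -> : p%:C * delta = delta / alpha%:C by rewrite /p fmorphV mulrC.
  have -> : kap%:C * delta = mu%:C * delta / alpha%:C.
    by rewrite /kap rmorphM fmorphV/= mulrAC.
  by congr (_ / _); rewrite [LHS]mulrC [X in _ * X = _]mulrC mulrA.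
congr (_ * _).
have -> : A%:C = cpow t (gam%:C - 1) * (alpha^-1)%:C.
  rewrite /A rmorphM/=; congr (_ * _).
  by rewrite /powR (gt_eqF t0) -cexp_real /cpow rmorphM rmorphB/=.
have -> : cpow lam delta = cpow eta (delta / alpha%:C) * cpow t (mu%:C * delta / alpha%:C).
  rewrite /cpow -cexpD lnlam; congr cexp.
  by rewrite rmorphD !rmorphM !fmorphV/=; ring.
have -> : gam%:C + mu%:C * delta / alpha%:C - 1 = (gam%:C - 1) + mu%:C * delta / alpha%:C by ring.
rewrite [cpow t (_ - 1 + _)]cpowD rmorphM/= natrC.
by ring.
Qed.
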